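(* Let $W$ be a vector space over $\mathbb{C}$, let $N$ be a positive integer, and let $U$ be any $\mathcal{S}$-local subset of $\mathcal{E}(W,N)=\mathrm{Hom}(W,W((x^{1/N})))$ whose linear span is a $\mathbb{Z}_N$-graded subspace. Then the nonlocal vertex algebra $\langle U\rangle$ generated by $U$ (with vertex operator map $Y_{\mathcal{E}}$ and vacuum vector $1_W$) is a weak quantum vertex algebra on which $\theta$ acts as an automorphism of period $N$, and $W$ is a faithful $\theta$-twisted $\langle U\rangle$-module with $Y_W(a(x),x_0)=a(x_0)$ for $a(x)\in\langle U\rangle$.
   Context: Scalars are $\mathbb{C}$; $\mathbb{N}=\{0,1,2,\dots\}$; $\omega_N=\exp(2\pi\sqrt{-1}/N)$; $\delta(x)=\sum_{n\in\mathbb{Z}}x^n$. Formal binomials $(x\pm y)^\alpha$ are expanded in nonnegative powers of the second variable $y$; e.g. for $f\in\mathbb{C}((x))$, $f(x_2-x_1)$ is expanded in nonnegative powers of $x_1$. $W((x_1^{1/N},\dots,x_r^{1/N}))$ is the space of formal series with coefficients in $W$ and exponents in $\frac1N\mathbb{Z}$ that are bounded below in each variable. For $F(x_1,x_2)\in \mathrm{Hom}(W,W((x_1^{1/N},x_2^{1/N})))$, the substitution $x_1^{1/N}=(x_2+x_0)^{1/N}$ replaces $x_1^{m/N}$ by $(x_2+x_0)^{m/N}$, expanded in nonnegative powers of $x_0$. A nonlocal vertex algebra is a vector space $V$ with a linear map $Y(\cdot,x):V\to\mathrm{Hom}(V,V((x)))$, $v\mapsto Y(v,x)=\sum_n v_nx^{-n-1}$,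 and a vector $\mathbf 1\in V$ such that $Y(\mathbf 1,x)v=v$, $Y(v,x)\mathbf 1\in V[[x]]$, $\lim_{x\to0}Y(v,x)\mathbf 1=v$ for all $v$, and for all $u,v,w\in V$ there is $l\in\mathbb{N}$ with $(x_0+x_2)^lY(u,x_0+x_2)Y(v,x_2)w=(x_0+x_2)^lY(Y(u,x_0)v,x_2)w$. A weak quantum vertex algebra is a vector space $V$ with a linear map $Y:V\to \mathrm{Hom}(V,V((x)))$ and $\mathbf 1\in V$ satisfying the same vacuum and creation properties and such that for all $u,v\in V$ there exist finitely many $u^{(i)},v^{(i)}\in V$, $f_i(x)\in\mathbb{C}((x))$ with $$x_0^{-1}\delta\left(\tfrac{x_1-x_2}{x_0}\right)Y(u,x_1)Y(v,x_2)-x_0^{-1}\delta\left(\tfrac{x_2-x_1}{-x_0}\right)\sum_i f_i(-x_0)Y(v^{(i)},x_2)Y(u^{(i)},x_1)=x_2^{-1}\delta\left(\tfrac{x_1-x_0}{x_2}\right)Y(Y(u,x_0)v,x_2).$$ (Every weak quantum vertex algebra is a nonlocal vertex algebra.) An automorphism $\sigma$ is a linear bijection with $\sigma(\mathbf 1)=\mathbf 1$, $\sigma(Y(u,x)v)=Y(\sigma u,x)\sigma v$; it has period $N$ if $\sigma^N=1$. For a nonlocal vertex algebra $V$ with automorphism $\sigma$ of period $N$, a $\sigma$-twisted $V$-module is a vector space $W$ with a linear map $Y_W:V\to\mathrm{Hom}(W,W((x^{1/N})))$ such that $Y_W(\mathbf 1,x)=1_W$; $Y_W(\sigma v,x)=\lim_{x^{1/N}\to\omega_N^{-1}x^{1/N}}Y_W(v,x)$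 for $v\in V$; and for $u,v\in V$ there is $k\in\mathbb{N}$ with $(x_1-x_2)^kY_W(u,x_1)Y_W(v,x_2)\in\mathrm{Hom}(W,W((x_1^{1/N},x_2^{1/N})))$ and $x_0^kY_W(Y(u,x_0)v,x_2)=\left((x_1-x_2)^kY_W(u,x_1)Y_W(v,x_2)\right)|_{x_1^{1/N}=(x_2+x_0)^{1/N}}$. It is faithful if $Y_W$ is injective. For weak quantum vertex algebras the same notion is used. $\mathcal{E}(W,N)=\bigoplus_{j=0}^{N-1}x^{-j/N}\mathrm{Hom}(W,W((x)))$ is graded by $\mathbb{Z}_N=\mathbb{Z}/N\mathbb{Z}$; $\theta$ is the linear automorphism $\theta(f(x))=\lim_{x^{1/N}\to\omega_N^{-1}x^{1/N}}f(x)$, which acts as $\omega_N^j$ on $\mathcal{E}(W,N)^j=x^{-j/N}\mathrm{Hom}(W,W((x)))$. A graded subspace is a subspace that is the sum of its intersections with the $\mathcal{E}(W,N)^j$. A finite sequence $(a_1(x),\dots,a_r(x))$ in $\mathcal{E}(W,N)$ is compatible if there is $k\in\mathbb{N}$ with $\left(\prod_{i<j}(x_i-x_j)^k\right)a_1(x_1)\cdots a_r(x_r)\in\mathrm{Hom}(W,W((x_1^{1/N},\dots,x_r^{1/N})))$; a subset is compatible if all finite sequences in it are. For a compatible pair $(a(x),b(x))$, $Y_{\mathcal{E}}(a(x),x_0)b(x)=\sum_{n}(a(x)_nb(x))x_0^{-n-1}$ is defined by $Y_{\mathcal{E}}(a(x),x_0)b(x)=x_0^{-k}\left((x_1-x)^ka(x_1)b(x)\right)|_{x_1^{1/N}=(x+x_0)^{1/N}}$,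 for any $k\in\mathbb{N}$ with $(x_1-x_2)^ka(x_1)b(x_2)\in\mathrm{Hom}(W,W((x_1^{1/N},x_2^{1/N})))$. A subspace all of whose ordered pairs are compatible is closed if it contains $a(x)_nb(x)$ for all its elements $a(x),b(x)$ and all $n\in\mathbb{Z}$. A subset $U\subset\mathcal{E}(W,N)$ is $\mathcal{S}$-local if for any $a(x),b(x)\in U$ there exist finitely many $f_i(x)\in\mathbb{C}((x))$, $a_i(x),b_i(x)\in U$ ($1\le i\le r$) and $k\in\mathbb{N}$ with $(x_1-x_2)^ka(x_1)b(x_2)=(x_1-x_2)^k\sum_{i=1}^rf_i(x_2-x_1)a_i(x_2)b_i(x_1)$. Every $\mathcal{S}$-local subset is compatible. For a compatible subset $U$ whose span is graded, $\langle U\rangle$ denotes the unique smallest closed $\mathbb{Z}_N$-graded compatible subspace of $\mathcal{E}(W,N)$ containing $U$ and $1_W$; $(\langle U\rangle,Y_{\mathcal{E}},1_W)$ is a nonlocal vertex algebra. *)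

(* Defs.v *)
From HB Require Import structures.
From mathcomp Require Import all_boot all_order all_algebra.
From mathcomp Require Import all_classical all_reals all_analysis.
From mathcomp Require Import complex.

Set Implicit Arguments.
Unset Strict Implicit.
Unset Printing Implicit Defensive.

Import Order.TTheory GRing.Theory Num.Theory.

Local Open Scope classical_set_scope.
Local Open Scope ring_scope.

(* A formal series is the function giving its coefficients.  An exponent in
   (1/N)Z is represented by its numerator: for a series in x^(1/N), s m is the
   coefficient of x^(m/N).  Hence the type of coefficients does not mention N,
   and N is an argument of exactly those operations that depend on it
   (multiplication by x, expansions of (x_2 + x_0)^(m/N), the grading).
   A map W -> V[[x^(1/N), x^(-1/N)]] is a function W -> int -> V.
   Sums over integer exponents are sums of finitely supported families,
   \sum_(t \in setT); all those below are finitely supported as soon as the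
   series involved satisfy the stated truncation conditions. *)

Section FormalCalculus.
Variable R : realType.

(* exp(2 pi i / N) *)
Definition omega (N : nat) : R[i] :=
  (cos (pi *+ 2 / N%:R) +i* sin (pi *+ 2 / N%:R))%C.

Definition cbinom (x : R[i]) (i : nat) : R[i] :=
  (\prod_(j < i) (x - j%:R)) / (i`!)%:R.

(* V((x^(1/N))) *)
Definition laurent (V : nmodType) (s : int -> V) : Prop :=
  exists L : int, forall m, m < L -> s m = 0.

(* Hom(W, V((x^(1/N)))) *)
Definition hom_laurent (W V : lmodType R[i]) (a : W -> int -> V) : Prop :=
  linear a /\ forall w, laurent (a w).

(* Hom(W, V((x_1^(1/N), x_2^(1/N)))) *)
Definition hom_laurent2 (W V : lmodType R[i]) (F : W -> int -> int -> V) :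
    Prop :=
  linear F /\
  forall w, exists L : int, forall m n, (m < L) || (n < L) -> F w m n = 0.

(* Hom(W, V((x_1^(1/N), ..., x_r^(1/N)))) *)
Definition hom_laurentn (W V : lmodType R[i]) (r : nat)
    (F : W -> ('I_r -> int) -> V) : Prop :=
  linear F /\
  forall w, exists L : int, forall m, (exists i, m i < L) -> F w m = 0.

Definition idser (W : lmodType R[i]) : W -> int -> W :=
  fun w m => if m == 0 then w else 0.

(* a(x_1) b(x_2) *)
Definition prod2 (W : lmodType R[i]) (a b : W -> int -> W) :
    W -> int -> int -> W :=
  fun w m n => a (b w n) m.

(* a_1(x_1) ... a_r(x_r) *)
Definition prodn (W : lmodType R[i]) (r : nat) (a : 'I_r -> W -> int -> W) :
    W -> ('I_r -> int) -> W :=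
  fun w m => foldr (fun i w' => a i w' (m i)) w (enum 'I_r).

(* (x_1 - x_2)^k F(x_1, x_2) *)
Definition mulx12 (W V : lmodType R[i]) (N k : nat)
    (F : W -> int -> int -> V) : W -> int -> int -> V :=
  iter k (fun G w m n => G w (m - N%:Z) n - G w m (n - N%:Z)) F.

(* x_i F(x_1, ..., x_r) *)
Definition mulxi (W V : lmodType R[i]) (N r : nat) (i : 'I_r)
    (F : W -> ('I_r -> int) -> V) : W -> ('I_r -> int) -> V :=
  fun w m => F w (fun l => if l == i then m l - N%:Z else m l).

(* (\prod_(i < j) (x_i - x_j)^k) F(x_1, ..., x_r) *)
Definition mulvander (W V : lmodType R[i]) (N r k : nat)
    (F : W -> ('I_r -> int) -> V) : W -> ('I_r -> int) -> V :=
  foldr (fun p G => iter k (fun H => mulxi N p.1 H - mulxi N p.2 H) G) F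
    [seq p : 'I_r * 'I_r <- enum {: 'I_r * 'I_r} | (p.1 < p.2)%N].

(* F(x_1, x_2) at x_1^(1/N) = (x_2 + x_0)^(1/N): the coefficient of
   x_0^q x_2^(p/N), where
   (x_2 + x_0)^(m/N) = \sum_(i >= 0) binom(m/N, i) x_2^(m/N - i) x_0^i. *)
Definition subst12 (W V : lmodType R[i]) (N : nat)
    (F : W -> int -> int -> V) : W -> int -> int -> V :=
  fun w q p =>
    match q with
    | Posz i => \sum_(m \in [set: int])
        cbinom (m%:~R / N%:R) i *: F w m (p - m + N%:Z * i%:Z)
    | Negz _ => 0
    end.

End FormalCalculus.

Arguments idser {R} W.

Section VertexAlgebras.
Variables (R : realType) (V : lmodType R[i]).

(* The coefficient of x^a y^b z^c in x^-1 delta((y - z) / x), that is, in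
   \sum_(n in Z) x^(-n-1) \sum_(i >= 0) binom(n, i) y^(n-i) (-z)^i. *)
Definition delta3 (a b c : int) : R[i] :=
  match c with
  | Posz i => if a + b + i%:Z == -1
              then cbinom (- a - 1)%:~R i * (-1) ^+ i else 0
  | Negz _ => 0
  end.

(* Product of scalar and vector valued formal series in three variables. *)
Definition mulser3 (f : int -> int -> int -> R[i])
    (A : int -> int -> int -> V) : int -> int -> int -> V :=
  fun p q r => \sum_(t \in [set: int * int * int])
    f t.1.1 t.1.2 t.2 *: A (p - t.1.1) (q - t.1.2) (r - t.2).

(* Y u v m is the coefficient of x^m in Y(u,x)v, i.e. u_n v = Y u v (- n - 1).
   In the identity p, q, r are the exponents of x_0, x_1, x_2; note
   x_0^-1 delta((x_2 - x_1) / (-x_0)) is (- y^-1 delta((x_2 - x_1) / y)) at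
   y = - x_0. *)
Definition S_jacobi (Y : V -> V -> int -> V) (u v : V) (s : nat)
    (u' v' : 'I_s -> V) (f : 'I_s -> int -> R[i]) : Prop :=
  forall (w : V) (p q r : int),
    mulser3 delta3
      (fun p q r => if p == 0 then Y u (Y v w r) q else 0) p q r
    - mulser3 (fun p q r => - (-1) ^ p * delta3 p r q)
      (fun p q r => \sum_(i < s)
         ((-1) ^ p * f i p) *: Y (v' i) (Y (u' i) w q) r) p q r
    = mulser3 (fun p q r => delta3 r q p)
      (fun p q r => if q == 0 then Y (Y u v p) w r else 0) p q r.

Record weak_quantum_vertex_algebra (Y : V -> V -> int -> V) (one : V) :
    Prop := {
  wqva_linear : linear Y;
  wqva_field : forall u, hom_laurent (Y u);
  wqva_vacuum : Y one = idser V;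
  wqva_creation : forall v m, m < 0 -> Y v one m = 0;
  wqva_creation0 : forall v, Y v one 0 = v;
  wqva_S_jacobi : forall u v, exists (s : nat) (u' v' : 'I_s -> V)
      (f : 'I_s -> int -> R[i]),
    (forall i, laurent (f i)) /\ S_jacobi Y u v u' v' f
}.

Record va_automorphism (Y : V -> V -> int -> V) (one : V) (sigma : V -> V) :
    Prop := {
  va_aut_linear : linear sigma;
  va_aut_bij : bijective sigma;
  va_aut_one : sigma one = one;
  va_aut_Y : forall u v m, sigma (Y u v m) = Y (sigma u) (sigma v) m
}.

Definition has_period (N : nat) (sigma : V -> V) : Prop :=
  forall v, iter N sigma v = v.

End VertexAlgebras.

Section TwistedFields.
Variables (R : realType) (W : lmodType R[i]).

(* E(W,N) = Hom(W, W((x^(1/N)))) *)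
Definition EWN : set (W -> int -> W) := [set a | hom_laurent a].

(* x^(-j/N) Hom(W, W((x))) *)
Definition EWN_homog (N j : nat) : set (W -> int -> W) :=
  [set a | EWN a /\
    forall w m, ~~ (N%:Z %| m + j%:Z)%Z -> a w m = 0].

(* x^(1/N) := omega_N^-1 x^(1/N) *)
Definition theta (N : nat) (a : W -> int -> W) : W -> int -> W :=
  fun w m => omega R N ^ (- m) *: a w m.

(* sigma-twisted modules; the exponents of x_0 in Y are integers. *)
Record twisted_module (V : lmodType R[i]) (N : nat)
    (Y : V -> V -> int -> V) (one : V) (sigma : V -> V)
    (YW : V -> W -> int -> W) : Prop := {
  tw_linear : linear YW;
  tw_field : forall v, EWN (YW v);
  tw_vacuum : YW one = idser W;
  tw_sigma : forall v, YW (sigma v) = theta N (YW v);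
  tw_assoc : forall u v, exists k : nat,
    let F := mulx12 N k (prod2 (YW u) (YW v)) in
    hom_laurent2 F /\
    forall w q p, YW (Y u v (q - k%:Z)) w p = subst12 N F w q p
}.

Definition is_subspace (X : set (W -> int -> W)) : Prop :=
  X 0 /\ forall (c : R[i]) a b, X a -> X b -> X (c *: a + b).

Definition lin_span (U : set (W -> int -> W)) : set (W -> int -> W) :=
  [set a | exists (r : nat) (c : 'I_r -> R[i]) (u : 'I_r -> W -> int -> W),
    (forall i, U (u i)) /\ a = \sum_(i < r) c i *: u i].

Definition graded_subspace (N : nat) (X : set (W -> int -> W)) : Prop :=
  is_subspace X /\
  forall a, X a -> exists h : 'I_N -> W -> int -> W,
    (forall j, X (h j) /\ EWN_homog N j (h j)) /\ a = \sum_(j < N) h j.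

Definition compatible_seq (N r : nat) (a : 'I_r -> W -> int -> W) : Prop :=
  exists k : nat, hom_laurentn (mulvander N k (prodn a)).

Definition compatible (N : nat) (X : set (W -> int -> W)) : Prop :=
  forall (r : nat) (a : 'I_r -> W -> int -> W),
    (forall i, X (a i)) -> compatible_seq N a.

(* YE N a b q is the coefficient of x_0^q in Y_E(a(x), x_0) b(x), so that
   a(x)_n b(x) = YE N a b (- n - 1).  It does not depend on the choice of k;
   it is only meaningful for compatible pairs (k is 0 otherwise). *)
Definition YE (N : nat) (a b : W -> int -> W) (q : int) : W -> int -> W :=
  let k := xget 0%N [set k | hom_laurent2 (mulx12 N k (prod2 a b))] in
  fun w p => subst12 N (mulx12 N k (prod2 a b)) w (q + k%:Z) p.

Definition YE_closed (N : nat) (X : set (W -> int -> W)) : Prop :=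
  forall a b (n : int), X a -> X b -> X (YE N a b (- n - 1)).

(* f(x_2 - x_1) F(x_1, x_2); the coefficient of x_1^j x_2^l in f(x_2 - x_1)
   is f_(l+j) binom(l+j, j) (-1)^j for j >= 0 and 0 for j < 0. *)
Definition mul_f21 (N : nat) (f : int -> R[i]) (F : W -> int -> int -> W) :
    W -> int -> int -> W :=
  fun w m n => \sum_(t \in [set: nat * int])
    (f (t.2 + t.1%:Z) * cbinom (t.2 + t.1%:Z)%:~R t.1 * (-1) ^+ t.1) *:
      F w (m - N%:Z * t.1%:Z) (n - N%:Z * t.2).

Definition S_local (N : nat) (U : set (W -> int -> W)) : Prop :=
  forall a b, U a -> U b ->
  exists (r : nat) (f : 'I_r -> int -> R[i]) (a' b' : 'I_r -> W -> int -> W)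
    (k : nat),
    (forall i, laurent (f i) /\ U (a' i) /\ U (b' i)) /\
    mulx12 N k (prod2 a b) =
    mulx12 N k (\sum_(i < r)
      mul_f21 N (f i) (fun w m n => prod2 (a' i) (b' i) w n m)).

(* Closed graded compatible subspaces of E(W,N) containing U and 1_W. *)
Record closed_graded_over (N : nat) (U X : set (W -> int -> W)) : Prop := {
  cgo_sub : X `<=` EWN;
  cgo_graded : graded_subspace N X;
  cgo_compatible : compatible N X;
  cgo_closed : YE_closed N X;
  cgo_gen : U `<=` X;
  cgo_one : X (idser W)
}.

(* <U>, the smallest such subspace; if there were none, it would be the set of
   all coefficient families. *)
Definition gen (N : nat) (U : set (W -> int -> W)) : set (W -> int -> W) :=
  \bigcap_(X in [set X | closed_graded_over N U X]) X.

Lemma gen_smallest N U X : closed_graded_over N U X -> gen N U `<=` X.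
Proof. by move=> HX a; apply. Qed.

Definition gen_pred N U : {pred W -> int -> W} := fun a => a \in gen N U.

Lemma gen_submod_closed N U : submod_closed (gen_pred N U).
Proof.
rewrite /gen_pred; split; first by rewrite unfold_in inE => X HX; case: (cgo_graded HX) => -[].
move=> c a b; rewrite !unfold_in !inE => Ha Hb X HX.
by case: (cgo_graded HX) => -[_ + _]; apply; [exact: Ha | exact: Hb].
Qed.

Lemma gen_idser N U : idser W \in gen N U.
Proof. by rewrite inE => X HX; exact: cgo_one HX. Qed.

Lemma gen_YE N U a b q : a \in gen N U -> b \in gen N U ->
  YE N a b q \in gen N U.
Proof.
rewrite !inE => Ha Hb X HX.
have -> : q = - (- q - 1) - 1 by rewrite opprB addrC opprK addKr.
by apply: (cgo_closed HX); [exact: Ha | exact: Hb].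
Qed.

Lemma omegaXn (N n : nat) : omega R N ^+ n =
  (cos (pi *+ 2 / N%:R *+ n) +i* sin (pi *+ 2 / N%:R *+ n))%C.
Proof.
elim: n => [|n IHn]; first by rewrite expr0 mulr0n cos0 sin0.
rewrite exprS IHn [_ *+ n.+1]mulrS cosD sinD; apply/eqP; rewrite eq_complex /=.
by rewrite !eqxx /= addrC [cos _ * sin _]mulrC [sin _ * cos _]mulrC
  [cos _ * _ + _]addrC eqxx.
Qed.

Lemma omegaXN (N : nat) : (0 < N)%N -> omega R N ^+ N = 1.
Proof.
move=> N0; rewrite omegaXn -[in LHS]mulr_natr divfK ?pnatr_eq0 -?lt0n//.
by rewrite cos2pi sin2pi.
Qed.

Lemma omega_neq0 (N : nat) : (0 < N)%N -> omega R N != 0.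
Proof.
move=> N0; apply/eqP => w0; move: (omegaXN N0).
by rewrite w0 expr0n gtn_eqF//= => /eqP; rewrite eq_sym oner_eq0.
Qed.

Lemma theta_homog (N j : nat) a : (0 < N)%N -> EWN_homog N j a ->
  theta N a = omega R N ^+ j *: a.
Proof.
move=> N0 [_ Ha]; apply/funext => w; apply/funext => m.
rewrite /theta -[RHS]/(omega R N ^+ j *: a w m).
have [/dvdzP[t mE]|/Ha ->] := boolP (N%:Z %| m + j%:Z)%Z; last first.
  by rewrite !scaler0.
congr (_ *: _); have -> : - m = j%:Z + N%:Z * - t.
  by rewrite mulrN mulrC -mE opprD [RHS]addrC subrK.
by rewrite expfzDr ?omega_neq0// -exprz_exp -!exprnP omegaXN// exp1rz mulr1.
Qed.

Lemma theta_sum (N : nat) (I : Type) (s : seq I) (h : I -> W -> int -> W) :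
  theta N (\sum_(i <- s) h i) = \sum_(i <- s) theta N (h i).
Proof.
apply: (big_morph (theta N)) => [a b|]; apply/funext => w; apply/funext => m.
  exact: scalerDr.
exact: scaler0.
Qed.

Lemma gen_theta N U a : a \in gen N U -> theta N a \in gen N U.
Proof.
rewrite !inE => Ha X HX; have [[X0 XD] Xg] := cgo_graded HX.
have [h [Hh ->]] := Xg _ (Ha _ HX); rewrite theta_sum.
elim/big_rec: _ => // j b _ Xb; have [Xh Hj] := Hh j.
have N0 : (0 < N)%N by apply: leq_ltn_trans (ltn_ord j).
by rewrite (theta_homog N0 Hj); exact: XD.
Qed.

(* <U> as a vector space *)
Record genV (N : nat) (U : set (W -> int -> W)) : Type := GenV {
  gen_val : W -> int -> W;
  _ : gen_val \in gen_pred N U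
}.

HB.instance Definition _ (N : nat) (U : set (W -> int -> W)) :=
  GRing.isSubmodClosed.Build R[i] (W -> int -> W) (gen_pred N U)
    (gen_submod_closed N U).
HB.instance Definition _ (N : nat) (U : set (W -> int -> W)) :=
  [isSub for @gen_val N U].
HB.instance Definition _ (N : nat) (U : set (W -> int -> W)) :=
  [Choice of genV N U by <:].
HB.instance Definition _ (N : nat) (U : set (W -> int -> W)) :=
  [SubChoice_isSubLmodule of genV N U by <:].

Definition genV_one N U : genV N U := GenV (gen_idser N U).

Definition genV_Y N U (a b : genV N U) (q : int) : genV N U :=
  GenV (gen_YE q (valP a) (valP b)).

Definition genV_theta N U (a : genV N U) : genV N U :=
  GenV (gen_theta (valP a)).

End TwistedFields.

Arguments EWN {R} W.
Arguments genV_Y {R W} N U.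
Arguments genV_theta {R W} N U.
Arguments gen_val {R W} N U.

(* Main.v *)
(** Clearing the poles of the coefficients f_i turns S-locality into the
    statement that (x_1 - x_2)^k a(x_1) b(x_2) is a finite sum of terms
    h(x_2 - x_1) b'(x_2) a'(x_1) with power series h.  A power series in a
    difference of variables can be carried through the substitution
    x_1 = x_2 + x_0 that defines Y_E (by Taylor's formula in x_0), so S-locality
    passes from a, b, c to the products a_n b and c.  Hence the space obtained
    from U and 1_W by iterating these products is S-local, compatible, graded and
    closed, and it is <U>.

    For a, b, c in <U> and large k, the series
    G(y, s, t) = (s - y)^k (t - y)^k (t - s)^k a(y) b(s) c(t) is lower truncated
    in every variable, and its substitutions may be performed in any order.
    Taking s = t + x_2 before y = t + x_1 gives Y_E(a, x_1) Y_E(b, x_2) c, taking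
    them in the other order gives, by S-locality,
    \sum_i f_i Y_E(b_i, x_2) Y_E(a_i, x_1) c, and y = s + x_0 followed by
    s = t + x_2 gives Y_E(Y_E(a, x_0) b, x_2) c, all up to powers of x_0, x_1,
    x_2 and x_1 - x_2.  So the three terms of the Jacobi identity are the three
    expansions of a single series divided by a power of x_1 - x_2. *)

Require Import Defs.
From HB Require Import structures.
From mathcomp Require Import all_boot all_order all_algebra.
From mathcomp Require Import all_classical all_reals all_analysis.
From mathcomp Require Import complex.
From mathcomp Require Import zify ring.

Set Implicit Arguments.
Unset Strict Implicit.
Unset Printing Implicit Defensive.

Import Order.TTheory GRing.Theory Num.Theory.

Local Open Scope classical_set_scope.
Local Open Scope ring_scope.

(** * Binomial coefficients *)

Section Binomials.
Variable R : realType.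
Implicit Types (x y : R[i]) (i r : nat).

(** Three obstacles shape the argument. A power series in s - y acts through infinitely many terms,
    while the substitution s = t + x_0 may first require a pole to be cleared. Substitution is
    therefore a relation between series, and it is stable under coefficientwise limits as soon as
    one pole order and one truncation bound serve all partial sums. Next, s - y becomes (t - y) +
    x_0, which cannot simply be divided out; but for each single coefficient in x_0 a power of t - y
    is enough, and locality of a_n b with c asks for no more. Finally, the f_i of the Jacobi
    identity must be chosen from u and v alone, whereas the exponent that truncates a(y) b(s) c(t)
    depends on c as well. Writing f_i as x^(-k-e) (x^e h_i) absorbs the extra exponent e without
    changing f_i. *)

Lemma cbinom0 x : cbinom x 0 = 1.
Proof. by rewrite /cbinom big_ord0 fact0 divr1. Qed.

Lemma cbinomS x i : cbinom x i.+1 * i.+1%:R = cbinom x i * (x - i%:R).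
Proof.
rewrite /cbinom big_ord_recr /= factS natrM.
have h1 : i.+1%:R != 0 :> R[i] by rewrite pnatr_eq0.
have h2 : (i`!)%:R != 0 :> R[i] by rewrite pnatr_eq0 -lt0n fact_gt0.
rewrite -natr1 in h1 *; by field; rewrite ?h1 ?h2.
Qed.

Lemma cbinomSE x i : cbinom x i.+1 = cbinom x i * (x - i%:R) / i.+1%:R.
Proof. by rewrite -cbinomS mulfK // pnatr_eq0. Qed.

Lemma cbinom_pascal x i : cbinom (x + 1) i.+1 = cbinom x i.+1 + cbinom x i.
Proof.
elim: i => [|i IH]; first by rewrite !cbinomSE !cbinom0; field.
rewrite cbinomSE IH [in RHS]cbinomSE !cbinomSE.
have h1 : i.+1%:R != 0 :> R[i] by rewrite pnatr_eq0.
have h2 : i.+2%:R != 0 :> R[i] by rewrite pnatr_eq0.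
rewrite -!natr1 in h1 h2 *.
by field; rewrite h1 ?h2 -?addrA.
Qed.

(** Induction through [cbinomS]: in degree r + 1 the factor r + 1 is split as i + (r + 1 - i), and
    each part lowers one of the two binomials. *)
Lemma vandermonde x y r :
  \sum_(i < r.+1) cbinom x i * cbinom y (r - i) = cbinom (x + y) r.
Proof.
elim: r => [|r IH]; first by rewrite big_ord_recl big_ord0 !cbinom0 mulr1 addr0.
have h : r.+1%:R != 0 :> R[i] by rewrite pnatr_eq0.
apply: (mulIf h); rewrite cbinomS -IH.
have -> : (\sum_(i < r.+2) cbinom x i * cbinom y (r.+1 - i)) * r.+1%:R =
  \sum_(i < r.+2) cbinom x i * i%:R * cbinom y (r.+1 - i) +
  \sum_(i < r.+2) cbinom x i * (cbinom y (r.+1 - i) * (r.+1 - i)%:R).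
  rewrite mulr_suml -big_split /=; apply: eq_bigr => i _.
  by rewrite natrB -1?ltnS //; ring.
rewrite big_ord_recl /= mulr0 mul0r add0r [X in _ + X]big_ord_recr /=.
rewrite subnn !mulr0 addr0 -big_split /= mulr_suml; apply: eq_bigr => i _.
have ir : (i <= r)%N by rewrite -ltnS.
rewrite /bump /= add1n subSS cbinomS subSn // cbinomS natrB //; ring.
Qed.

Lemma cbinom_absorb x i : cbinom x i * (x - i%:R) = x * cbinom (x - 1) i.
Proof.
elim: i => [|i IH]; first by rewrite !cbinom0; ring.
have -> : cbinom x i.+1 * (x - i.+1%:R) = cbinom x i * (x - i%:R) * (x - i.+1%:R) / i.+1%:R.
  by rewrite cbinomSE; ring.
rewrite IH cbinomSE -natr1; ring.
Qed.

(** Trinomial revision for a complex upper argument; it is what composes two substitutions in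
    [sb_subst_sy]. *)
Lemma cbinom_mul x i p : (p <= i)%N ->
  cbinom x i * cbinom i%:R p = cbinom x p * cbinom (x - p%:R) (i - p).
Proof.
elim: p => [|p IH] pi; first by rewrite !cbinom0 subr0 subn0 mulr1 mul1r.
have h : p.+1%:R != 0 :> R[i] by rewrite pnatr_eq0.
have [j jE] : exists j, (i - p = j.+1)%N by exists (i - p).-1; lia.
have ji : (i - p.+1 = j)%N by lia.
apply: (mulIf h); rewrite -mulrA cbinomS mulrA IH; last exact: ltnW.
rewrite -natrB ?jE; last exact: ltnW.
rewrite -mulrA cbinomS ji cbinom_absorb -[RHS]mulrA [cbinom (_ - p.+1%:R) j * _]mulrC.
rewrite [RHS]mulrA cbinomS -natr1 opprD addrA; ring.
Qed.

Lemma cbinom_natr (n i : nat) : cbinom n%:R i = 'C(n, i)%:R :> R[i].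
Proof.
elim: i => [|i IH]; first by rewrite cbinom0 bin0.
have h : i.+1%:R != 0 :> R[i] by rewrite pnatr_eq0.
apply: (mulIf h); rewrite cbinomS IH -natrM [(_ * i.+1)%N]mulnC mul_bin_left.
have [hi|hi] := leqP i n; first by rewrite natrM natrB // mulrC.
by rewrite bin_small // muln0 mul0r.
Qed.

Lemma cbinom_opp x i :
  cbinom (x + i%:R - 1) i * (-1) ^+ i = cbinom (- x) i.
Proof.
elim: i => [|i IH]; first by rewrite !cbinom0 mulr1.
have h : i.+1%:R != 0 :> R[i] by rewrite pnatr_eq0.
apply: (mulIf h); rewrite mulrAC !cbinomS cbinom_absorb -IH exprS.
have -> : x + i.+1%:R - 1 = x + i%:R by rewrite -natr1; ring.
by ring.
Qed.

End Binomials.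

(** * Limits of eventually constant sequences and finite sums *)

(** Convergence in the discrete topology. An infinite sum of series is treated, one coefficient at a
    time, as such a limit of partial sums. *)
Definition evto (V : Type) (u : nat -> V) (l : V) :=
  exists M0, forall M, (M0 <= M)%N -> u M = l.

Lemma evto_uniq V (u : nat -> V) l l' : evto u l -> evto u l' -> l = l'.
Proof.
move=> [M h] [M' h']; rewrite -(h (maxn M M')) ?leq_maxl //.
by rewrite -(h' (maxn M M')) ?leq_maxr.
Qed.

Lemma evto_cst V (l : V) : evto (fun=> l) l.
Proof. by exists 0%N. Qed.

Lemma evto_map V V' (f : V -> V') u l : evto u l -> evto (fun M => f (u M)) (f l).
Proof. by move=> [M h]; exists M => m /h ->. Qed.

Lemma evto_map2 V V' V'' (f : V -> V' -> V'') u l u' l' :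
  evto u l -> evto u' l' -> evto (fun M => f (u M) (u' M)) (f l l').
Proof.
move=> [M h] [M' h']; exists (maxn M M') => m; rewrite geq_max => /andP[h1 h2].
by rewrite h // h'.
Qed.

Lemma evto_eq V (u u' : nat -> V) l M0 : (forall M, (M0 <= M)%N -> u M = u' M) ->
  evto u l -> evto u' l.
Proof.
move=> e [M h]; exists (maxn M M0) => m; rewrite geq_max => /andP[h1 h2].
by rewrite -e // h.
Qed.

Lemma evto_sum (V : nmodType) (I : Type) (r : seq I) (u : I -> nat -> V) (l : I -> V) :
  (forall i, evto (u i) (l i)) ->
  evto (fun M => \sum_(i <- r) u i M) (\sum_(i <- r) l i).
Proof.
move=> h; elim: r => [|i r IH].
  by exists 0%N => M _; rewrite !big_nil.
rewrite big_cons; have [M0 h0] := evto_map2 (fun x y => x + y) (h i) IH.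
by exists M0 => M /h0 <-; rewrite big_cons.
Qed.

Lemma exists_uniform_bound (n : nat) (Q : nat -> nat -> Prop) :
  (forall i, (i < n)%N -> exists D, forall D', (D <= D')%N -> Q i D') ->
  exists D, forall i D', (i < n)%N -> (D <= D')%N -> Q i D'.
Proof.
elim: n => [|n IH] h; first by exists 0%N.
have [D hD] := IH (fun i hi => h i (ltnW hi)); have [D' hD'] := h n (ltnSn n).
exists (maxn D D') => i d; rewrite ltnS geq_max => hi /andP[h1 h2].
by move: hi; rewrite leq_eqVlt => /orP[/eqP -> //|hi]; [exact: hD' | exact: hD].
Qed.

Section LinearMaps.
Variables (R : pzRingType) (U V : lmodType R) (f : U -> V).
Hypothesis lf : linear f.

Lemma lin0 : f 0 = 0.
Proof. by have := lf (-1) 0 0; rewrite scaler0 addr0 scaleN1r addNr. Qed.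

Lemma linD u v : f (u + v) = f u + f v.
Proof. by rewrite -[u]scale1r lf !scale1r. Qed.

Lemma linZ c u : f (c *: u) = c *: f u.
Proof. by rewrite -[c *: u]addr0 lf lin0 addr0. Qed.

Lemma linB u v : f (u - v) = f u - f v.
Proof. by rewrite linD -scaleN1r linZ scaleN1r. Qed.

Lemma lin_sum (I : Type) (r : seq I) (P : pred I) (F : I -> U) :
  f (\sum_(i <- r | P i) F i) = \sum_(i <- r | P i) f (F i).
Proof. exact: (big_morph f linD lin0). Qed.

End LinearMaps.

Section FiniteSums.
Variable (T : choiceType).

Definition fins (V : nmodType) (g : T -> V) :=
  exists r : seq T, forall x, x \notin r -> g x = 0.

Lemma fsum_seq (V : nmodType) (r : seq T) (g : T -> V) :
  uniq r -> (forall x, x \notin r -> g x = 0) ->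
  \sum_(x \in [set: T]) g x = \sum_(x <- r) g x.
Proof.
move=> ur h; rewrite (fsbigE r) //=; last by move=> x _; exact: h.
by apply: eq_bigl => x; rewrite in_setT.
Qed.

Lemma fsumD (V : nmodType) (g g' : T -> V) : fins g -> fins g' ->
  \sum_(x \in [set: T]) (g x + g' x) =
  \sum_(x \in [set: T]) g x + \sum_(x \in [set: T]) g' x.
Proof.
move=> [r h] [r' h']; have u := undup_uniq (r ++ r').
have H x : x \notin undup (r ++ r') -> g x = 0 /\ g' x = 0.
  by rewrite mem_undup mem_cat negb_or => /andP[/h -> /h' ->].
rewrite !(fsum_seq u); first exact: big_split.
- by move=> x /H[].
- by move=> x /H[].
by move=> x /H[-> ->]; rewrite addr0.
Qed.

Lemma fsum_lin (K : pzRingType) (V V' : lmodType K) (f : V -> V') (g : T -> V) :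
  linear f -> fins g ->
  \sum_(x \in [set: T]) f (g x) = f (\sum_(x \in [set: T]) g x).
Proof.
move=> lf [r h]; have u := undup_uniq r.
have H x : x \notin undup r -> g x = 0 by rewrite mem_undup => /h.
rewrite !(fsum_seq u) //; first by rewrite (lin_sum lf).
by move=> x /H ->; rewrite (lin0 lf).
Qed.

End FiniteSums.

Lemma sum_iota (V : nmodType) n (F : nat -> V) :
  \sum_(i <- iota 0 n) F i = \sum_(i < n) F i.
Proof. by rewrite -[X in iota 0 X]subn0 big_mkord. Qed.

Lemma fins_window (V : nmodType) (g : int -> V) (L M : int) :
  (forall m, (m < L) || (M < m) -> g m = 0) -> fins g.
Proof.
move=> h; exists [seq L + i%:Z | i <- iota 0 `|M - L|.+1] => x xr.
apply: h; apply: contraNT xr; rewrite negb_or -!leNgt => /andP[h1 h2].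
apply/mapP; exists `|x - L|%N; last by lia.
by rewrite mem_iota; lia.
Qed.

Lemma fsum_window (V : nmodType) (g : int -> V) (L : int) (K : nat) :
  (forall m, (m < L) || (L + K%:Z <= m) -> g m = 0) ->
  \sum_(m \in [set: int]) g m = \sum_(j < K) g (L + j%:Z).
Proof.
move=> h; rewrite (@fsum_seq _ _ [seq L + i%:Z | i <- iota 0 K]).
- by rewrite big_map sum_iota.
- by rewrite map_inj_uniq ?iota_uniq // => i j; lia.
move=> x xr; apply: h; apply: contraNT xr; rewrite negb_or -!leNgt -ltNge.
move=> /andP[h1 h2]; apply/mapP; exists `|x - L|%N; last by lia.
by rewrite mem_iota; lia.
Qed.

Lemma fsum_shift (V : nmodType) (g : int -> V) (c : int) :
  \sum_(m \in [set: int]) g (m + c) = \sum_(m \in [set: int]) g m.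
Proof.
rewrite [RHS](reindex_fsbigT (fun m => m + c)) //.
by exists (fun m => m - c) => x; rewrite ?addrK ?subrK.
Qed.

(** * The substitution x_1 = x_2 + x_0 *)

Section Substitution.
Variables (R : realType) (N : nat).
Hypothesis hN : (0 < N)%N.

Lemma divNN : N%:R / N%:R = 1 :> R[i].
Proof. by rewrite divff // pnatr_eq0 -lt0n. Qed.

Section OneSpace.
Variable V : lmodType R[i].
Implicit Types (F G Phi Psi : int -> int -> V) (L m n p q : int) (k : nat).

(* Multiplications by x_1^(s/N), x_2 and x_1 - x_2 *)
Definition shl (s : int) F : int -> int -> V := fun m n => F (m - s) n.
Definition shr F : int -> int -> V := fun m n => F m (n - N%:Z).
Definition dif F : int -> int -> V := fun m n => F (m - N%:Z) n - F m (n - N%:Z).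

Definition tr2 L F := forall m n, (m < L) || (n < L) -> F m n = 0.

(* F(x_2 + x_0, x_2), as in subst12; only meaningful when tr2 L F for some L,
   since otherwise the sums may be infinite and have the junk value 0. *)
Definition sb F : int -> int -> V := fun q p =>
  match q with
  | Posz i => \sum_(m \in [set: int])
      cbinom (m%:~R / N%:R) i *: F m (p - m + N%:Z * i%:Z)
  | Negz _ => 0
  end.

Lemma tr2_le L L' F : L' <= L -> tr2 L F -> tr2 L' F.
Proof.
by move=> h t m n /orP[] x; apply: t; rewrite (lt_le_trans x h) ?orbT.
Qed.

Lemma tr2_lin L c F G : tr2 L F -> tr2 L G -> tr2 L (c *: F + G).
Proof.
move=> f g m n h; rewrite -[LHS]/(c *: F m n + G m n) f // g //.
by rewrite scaler0 addr0.
Qed.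

Lemma tr2_shl L F : tr2 L F -> tr2 L (shl N%:Z F).
Proof. by move=> t m n h; apply: t; move: h; clear; lia. Qed.

Lemma tr2_shr L F : tr2 L F -> tr2 L (shr F).
Proof. by move=> t m n h; apply: t; move: h; clear; lia. Qed.

Lemma difE F : dif F = shl N%:Z F - shr F. Proof. by []. Qed.

Lemma tr2_dif L F : tr2 L F -> tr2 L (dif F).
Proof.
move=> t; rewrite difE -scaleN1r addrC.
by apply: tr2_lin; [exact: tr2_shr | exact: tr2_shl].
Qed.

Lemma tr2_iter_dif L k F : tr2 L F -> tr2 L (iter k dif F).
Proof. by move=> t; elim: k => //= k IH; exact: tr2_dif. Qed.

Lemma sb_neg F q p : q < 0 -> sb F q p = 0. Proof. by case: q. Qed.

Lemma sb_fins L F i p : tr2 L F ->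
  fins (fun m => cbinom (m%:~R / N%:R) i *: F m (p - m + N%:Z * i%:Z)).
Proof.
move=> t; apply: (@fins_window _ _ L (p + N%:Z * i%:Z - L)) => m h.
by rewrite t ?scaler0 //; move: h; clear; lia.
Qed.

Lemma sb_lin L c F G : tr2 L F -> tr2 L G -> sb (c *: F + G) = c *: sb F + sb G.
Proof.
move=> f g; apply/funext => -[i|i]; apply/funext => p; last first.
  by rewrite -[RHS]/(c *: 0 + 0 : V) scaler0 addr0.
rewrite -[RHS]/(c *: (\sum_(m \in [set: int]) _) + \sum_(m \in [set: int]) _).
rewrite -(fsum_lin (f := fun v => c *: v)) /=; last first.
- exact: sb_fins f.
- by move=> a u v; rewrite scalerDr !scalerA mulrC.
rewrite -fsumD; last first.
- exact: sb_fins g.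
- by have [r h] := sb_fins i p f; exists r => x /h ->; rewrite scaler0.
apply: eq_fsbigr => m _; rewrite -[X in _ *: X]/(c *: F _ _ + G _ _).
by rewrite scalerDr !scalerA mulrC.
Qed.

(** Multiplication by x_1 becomes multiplication by x_2 + x_0; on coefficients this is Pascal's rule
    for binom(m/N + 1, i + 1). *)
Lemma sb_shl L F q p : tr2 L F ->
  sb (shl N%:Z F) q p = sb F q (p - N%:Z) + sb F (q - 1) p.
Proof.
move=> t; case: q => [[|i]|i]; last by rewrite sb_neg // addr0.
  rewrite [X in _ + X]sb_neg // addr0 /sb -[LHS](fsum_shift _ N%:Z).
  apply: eq_fsbigr => m _; rewrite /shl addrK !cbinom0; congr (_ *: F _ _).
  by lia.
rewrite (_ : Posz i.+1 - 1 = Posz i); last by lia.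
rewrite /sb -[LHS](fsum_shift _ N%:Z) -fsumD; last 2 first.
- exact: sb_fins t.
- exact: sb_fins t.
apply: eq_fsbigr => m _; rewrite /shl addrK intrD mulrDl divNN cbinom_pascal.
rewrite scalerDl; congr (_ *: F _ _ + _ *: F _ _); lia.
Qed.

Lemma sb_shr F q p : sb (shr F) q p = sb F q (p - N%:Z).
Proof.
case: q => [i|i] //; apply: eq_fsbigr => m _; rewrite /shr.
by congr (_ *: F _ _); lia.
Qed.

Lemma sb_dif L F q p : tr2 L F -> sb (dif F) q p = sb F (q - 1) p.
Proof.
move=> t; rewrite difE -scaleN1r addrC (@sb_lin L); last 2 first.
- exact: tr2_shr.
- exact: tr2_shl.
rewrite -[LHS]/(-1 *: sb (shr F) q p + sb (shl N%:Z F) q p).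
by rewrite sb_shr (sb_shl _ _ t) scaleN1r addKr.
Qed.

Lemma sb_iter_dif L F k q p : tr2 L F -> sb (iter k dif F) q p = sb F (q - k%:Z) p.
Proof.
move=> t; elim: k q => [|k IH] q; first by rewrite subr0.
rewrite iterS (@sb_dif L); last exact: tr2_iter_dif.
by rewrite IH; congr (sb F _ p); lia.
Qed.

(* Phi is F(x_2 + x_0, x_2), computed after clearing a pole of F at
   x_1 = x_2. *)
Definition subE F Phi := exists k L, tr2 L (iter k dif F) /\
  forall q p, Phi q p = sb (iter k dif F) (q + k%:Z) p.

(** A further factor x_1 - x_2 only becomes a further factor x_0, so all exponents that truncate F
    compute the same series. *)
Lemma subE_at k L F Phi : subE F Phi -> tr2 L (iter k dif F) ->
  forall q p, Phi q p = sb (iter k dif F) (q + k%:Z) p.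
Proof.
move=> [k' [L' [t h]]] t2 q p; rewrite h.
have [kk|kk] := leqP k' k.
  rewrite -(subnK kk) iterD (sb_iter_dif _ _ _ t).
  by congr (sb _ _ p); lia.
rewrite -(subnK (ltnW kk)) iterD (sb_iter_dif _ _ _ t2).
by congr (sb _ _ p); lia.
Qed.

Lemma subE_sb L F : tr2 L F -> subE F (sb F).
Proof. by move=> t; exists 0%N, L; split => // q p; rewrite addr0. Qed.

Lemma subE_uniq F Phi Psi : subE F Phi -> subE F Psi -> Phi = Psi.
Proof.
move=> s [k [L [t h]]]; apply/funext => q; apply/funext => p.
by rewrite h (subE_at s t).
Qed.

Lemma dif_lin c F G : dif (c *: F + G) = c *: dif F + dif G.
Proof.
apply/funext => m; apply/funext => n.
by rewrite /dif !fctE /= scalerBr opprD addrACA.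
Qed.

Lemma iter_dif_lin k c F G :
  iter k dif (c *: F + G) = c *: iter k dif F + iter k dif G.
Proof. by elim: k => //= k ->; exact: dif_lin. Qed.

Lemma tr2_iter_le k k' L F : (k <= k')%N -> tr2 L (iter k dif F) ->
  tr2 L (iter k' dif F).
Proof. by move=> h t; rewrite -(subnK h) iterD; exact: tr2_iter_dif. Qed.

Lemma subE_lin c F G Phi Psi : subE F Phi -> subE G Psi ->
  subE (c *: F + G) (c *: Phi + Psi).
Proof.
move=> s1 s2; have [k1 [L1 [t1 _]]] := s1; have [k2 [L2 [t2 _]]] := s2.
pose k := maxn k1 k2; pose L := Order.min L1 L2.
have T1 : tr2 L (iter k dif F).
  apply: (@tr2_le L1); first by rewrite ge_min lexx.
  exact: tr2_iter_le (leq_maxl _ _) t1.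
have T2 : tr2 L (iter k dif G).
  apply: (@tr2_le L2); first by rewrite ge_min lexx orbT.
  exact: tr2_iter_le (leq_maxr _ _) t2.
exists k, L; rewrite iter_dif_lin; split; first exact: tr2_lin.
move=> q p; rewrite (sb_lin c T1 T2) -[LHS]/(c *: Phi q p + Psi q p).
by rewrite (subE_at s1 T1) (subE_at s2 T2).
Qed.

Lemma subE_0 : subE 0 0.
Proof.
exists 0%N, 0; split => // q p; case: (q + _) => // i.
by rewrite /= fsbig1 // => m _; rewrite scaler0.
Qed.

Lemma iter_dif_shl k F : iter k dif (shl N%:Z F) = shl N%:Z (iter k dif F).
Proof. by elim: k => //= k ->. Qed.

Lemma iter_dif_shr k F : iter k dif (shr F) = shr (iter k dif F).
Proof. by elim: k => //= k ->. Qed.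

(** On the substituted side the first argument is the integer exponent of x_0: there [shl 1] is
    multiplication by x_0, whereas [shl N%:Z] on F is multiplication by x_1. *)
Lemma subE_shl F Phi : subE F Phi -> subE (shl N%:Z F) (shr Phi + shl 1 Phi).
Proof.
move=> [k [L [t h]]]; exists k, L; rewrite iter_dif_shl; split.
  exact: tr2_shl.
move=> q p; rewrite (sb_shl _ _ t) -[LHS]/(Phi q (p - N%:Z) + Phi (q - 1) p).
by rewrite !h; congr (_ + sb _ _ p); lia.
Qed.

Lemma subE_shr F Phi : subE F Phi -> subE (shr F) (shr Phi).
Proof.
move=> [k [L [t h]]]; exists k, L; rewrite iter_dif_shr; split.
  exact: tr2_shr.
by move=> q p; rewrite sb_shr -h.
Qed.

Lemma subE_dif F Phi : subE F Phi -> subE (dif F) (shl 1 Phi).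
Proof.
move=> h; have := subE_lin (-1) (subE_shr h) (subE_shl h).
by rewrite !scaleN1r addKr addrC -difE.
Qed.

Lemma sb_lim L (Fs : nat -> int -> int -> V) F q p :
  (forall M, tr2 L (Fs M)) -> (forall m n, evto (fun M => Fs M m n) (F m n)) ->
  evto (fun M => sb (Fs M) q p) (sb F q p).
Proof.
move=> t h; case: q => [i|i]; last exact: evto_cst.
have tF : tr2 L F.
  move=> m n mn; apply: evto_uniq (h m n) _.
  by exists 0%N => M _; rewrite t.
(* Both exponents of F are at least L and their sum is p + N i, so the first one stays below L + K,
   whatever M is. *)
pose K := (absz (p + N%:Z * i%:Z - L - L)%R).+1.
have W (G : int -> int -> V) : tr2 L G -> sb G i p = \sum_(j < K)
    cbinom ((L + j%:Z)%:~R / N%:R) i *: G (L + j%:Z) (p - (L + j%:Z) + N%:Z * i%:Z).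
  move=> tG; apply: fsum_window => m hm; rewrite tG ?scaler0 //.
  by rewrite /K in hm; lia.
rewrite (W F tF).
apply: (evto_eq (M0 := 0%N)) => [M _|]; first by rewrite (W _ (t M)).
by apply: evto_sum => j; apply: evto_map.
Qed.

Lemma iter_dif_lim k (Fs : nat -> int -> int -> V) F :
  (forall m n, evto (fun M => Fs M m n) (F m n)) ->
  forall m n, evto (fun M => iter k dif (Fs M) m n) (iter k dif F m n).
Proof.
move=> h; elim: k => //= k IH m n.
by apply: (evto_map2 (fun x y => x - y)); exact: IH.
Qed.

(** The common k and L confine each coefficient of the substituted series to a finite sum that is
    the same for all M; the limit passes through this sum. *)
Lemma subE_lim k L (Fs Phis : nat -> int -> int -> V) F Phi :
  (forall M, tr2 L (iter k dif (Fs M))) ->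
  (forall m n, evto (fun M => Fs M m n) (F m n)) ->
  (forall M, subE (Fs M) (Phis M)) ->
  (forall q p, evto (fun M => Phis M q p) (Phi q p)) ->
  subE F Phi.
Proof.
move=> t hF s hP; have hk := iter_dif_lim k hF.
exists k, L; split.
  move=> m n mn; apply: evto_uniq (hk m n) _.
  by exists 0%N => M _; rewrite t.
move=> q p; apply: evto_uniq (hP q p) _.
apply: (evto_eq (M0 := 0%N)) (sb_lim (q + k%:Z) p t hk) => M _.
by rewrite (subE_at (s M) (t M)).
Qed.

(* An N-periodic weight chi only sees m + n, which the substitution turns
   into the exponent of x_2. *)
Lemma subE_periodic (chi : int -> R[i]) F Phi :
  (forall m, chi (m + N%:Z) = chi m) -> subE F Phi ->
  subE (fun m n => chi (m + n) *: F m n) (fun q p => chi p *: Phi q p).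
Proof.
move=> per [k [L [t h]]].
have perB m : chi (m - N%:Z) = chi m by rewrite -per subrK.
have E : iter k dif (fun m n => chi (m + n) *: F m n) =
    fun m n => chi (m + n) *: iter k dif F m n.
  elim: k {t h} => //= k ->; apply/funext => m; apply/funext => n.
  by rewrite /dif addrAC addrA !perB scalerBr.
exists k, L; rewrite E; split=> [m n mn|q p]; first by rewrite t ?scaler0.
rewrite h; case: (q + _) => [i|i]; last by rewrite scaler0.
rewrite /= -(fsum_lin (f := fun v => chi p *: v)); last first.
- exact: sb_fins t.
- by move=> a u v; rewrite scalerDr !scalerA mulrC.
apply: eq_fsbigr => m _; rewrite !scalerA mulrC; congr (_ * _ *: _).
have -> : m + (p - m + N%:Z * i%:Z) = p + N%:Z * i%:Z by lia.
elim: i => [|i IH]; first by rewrite mulr0 addr0.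
by rewrite -addn1 PoszD mulrDr mulr1 addrA per.
Qed.

End OneSpace.

Arguments shl {V} s.
Arguments shr {V}.
Arguments dif {V}.
Arguments sb {V}.

Lemma iter_dif_map (V V' : lmodType R[i]) (f : V -> V') k (F : int -> int -> V) :
  linear f -> iter k dif (fun m n => f (F m n)) = fun m n => f (iter k dif F m n).
Proof.
move=> lf; elim: k => //= k ->; apply/funext => m; apply/funext => n.
by rewrite /dif (linB lf).
Qed.

Lemma sb_map (V V' : lmodType R[i]) (f : V -> V') L (F : int -> int -> V) q p :
  linear f -> tr2 L F -> sb (fun m n => f (F m n)) q p = f (sb F q p).
Proof.
move=> lf t; case: q => [i|i]; last by rewrite /= (lin0 lf).
rewrite /= -(fsum_lin lf); last exact: sb_fins t.
by apply: eq_fsbigr => m _; rewrite (linZ lf).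
Qed.

Lemma subE_map (V V' : lmodType R[i]) (f : V -> V') (F Phi : int -> int -> V) :
  linear f -> subE F Phi ->
  subE (fun m n => f (F m n)) (fun q p => f (Phi q p)).
Proof.
move=> lf [k [L [t h]]]; exists k, L; rewrite iter_dif_map //.
split=> [m n mn|q p]; first by rewrite t ?(lin0 lf).
by rewrite (sb_map _ _ lf t) h.
Qed.

End Substitution.

Arguments shl {R V} s.
Arguments shr {R} N {V}.
Arguments dif {R} N {V}.
Arguments sb {R} N {V}.
Arguments subE {R} N {V}.
Arguments tr2 {R V}.

Lemma sum_triangle (V : nmodType) (a : nat -> nat -> V) (D : nat) :
  \sum_(j < D) \sum_(i < j.+1) a i (j - i)%N =
  \sum_(i < D) \sum_(l < D - i) a i l.
Proof.
elim: D => [|D IH]; first by rewrite !big_ord0.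
rewrite big_ord_recr /= IH [X in _ + X]big_ord_recr [RHS]big_ord_recr /=.
rewrite subSnn big_ord_recr big_ord0 /= add0r subnn addrA; congr (_ + _).
rewrite -big_split /=; apply: eq_bigr => i _.
by rewrite subSn ?big_ord_recr //= ltnW.
Qed.

Lemma int_lt_shift (q q0 : int) : exists d : nat, q < q0 + d%:Z.
Proof. by exists (absz (q - q0)%R).+1; lia. Qed.

(** Phi is a series in x_0, bounded below, and the iterated operator is multiplication by t + e x_0.
    One such factor is removed at a time, by induction on the exponent of x_0; the power of t that
    this costs depends on the coefficient. *)
Lemma eventually_unmultiply (K : pzRingType) (E : lmodType K) (t : E -> E)
    (M : E -> Prop) (e : K) (q0 : int) (k l : nat) (Phi : int -> E) :
  linear t -> M 0 -> (forall c x y, M x -> M y -> M (c *: x + y)) ->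
  (forall x, M x -> M (t x)) ->
  (forall q, q < q0 -> Phi q = 0) ->
  (forall q,
    M (iter l t (iter k (fun Psi q => t (Psi q) + e *: Psi (q - 1)) Phi q))) ->
  forall q, exists l, M (iter l t (Phi q)).
Proof.
move=> lt M0 Ml Mt hPhi h.
pose op (Psi : int -> E) q := t (Psi q) + e *: Psi (q - 1).
have Mit i x : M x -> M (iter i t x) by move=> ?; elim: i => //= i; exact: Mt.
have lit i : linear (iter i t).
  by elim: i => [|i IH] c x y //=; rewrite IH lt.
have : forall q, exists l, M (iter l t (iter k op Phi q)) by move=> q; exists l; exact: h.
elim: k {l h} => // k IH h; apply: IH.
have z q : q < q0 -> iter k op Phi q = 0.
  elim: k {h} q => [|k IHk] q hq; first exact: hPhi.
  have hq' : q - 1 < q0 by clear -hq; lia.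
  by rewrite iterS /op !IHk // (lin0 lt) scaler0 addr0.
move: h; rewrite iterS; move: (iter k op Phi) z => Psi z h q.
have [d] := int_lt_shift q q0.
elim: d q => [|d IHd] q hq.
  by exists 0%N; rewrite z //; rewrite addr0 in hq.
have [l1 h1] := h q; have [l2 h2] : exists l, M (iter l t (Psi (q - 1))).
  by apply: IHd; clear -hq; lia.
(* One t is spent on t Psi_q = (op Psi)_q - e Psi_(q-1); l1 and l2 then bring the two terms on the
   right into M. *)
exists (l1 + l2).+1; rewrite iterSr.
have -> : t (Psi q) = - e *: Psi (q - 1) + op Psi q.
  by rewrite /op scaleNr addrC addrK.
rewrite lit; apply: Ml; first by rewrite iterD; exact: Mit.
by rewrite addnC iterD; exact: Mit.
Qed.

(** * Power series in x_2 - x_1 *)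

Section PowerSeriesAction.
Variables (R : realType) (N : nat).

Section OneSpace.
Variable V : lmodType R[i].
Implicit Types (F G : int -> int -> V) (h g : nat -> R[i]) (m n : int) (D j : nat).

(* Multiplication by x_2 - x_1 *)
Definition rdif F : int -> int -> V := fun m n => F m (n - N%:Z) - F (m - N%:Z) n.

(** The exponents listed here, at least D lowering steps away from (m, n), are the only ones that
    the coefficient at (m, n) of (x_2 - x_1)^d F reads when d >= D. *)
Definition van2 D F m n := forall i j, (D <= i + j)%N ->
  F (m - N%:Z * i%:Z) (n - N%:Z * j%:Z) = 0.

(* The condition under which each coefficient of h(x_2 - x_1) F is a finite sum
   for every power series h. *)
Definition lowfin F := forall m n, exists D, van2 D F m n.

Definition hact h F : int -> int -> V := fun m n =>
  \sum_(j \in [set: nat]) h j *: iter j rdif F m n.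

Lemma rdifE F : rdif F = - dif N F.
Proof. by apply/funext => m; apply/funext => n; rewrite /rdif -opprB. Qed.

Lemma rdif_lin c F G : rdif (c *: F + G) = c *: rdif F + rdif G.
Proof.
apply/funext => m; apply/funext => n.
by rewrite /rdif !fctE /= scalerBr opprD addrACA.
Qed.

Lemma iter_rdif_lin j c F G :
  iter j rdif (c *: F + G) = c *: iter j rdif F + iter j rdif G.
Proof. by elim: j => //= j ->; exact: rdif_lin. Qed.

Lemma van2_le D D' F m n : (D <= D')%N -> van2 D F m n -> van2 D' F m n.
Proof. by move=> h v i j ij; apply: v; apply: leq_trans ij. Qed.

Lemma van2_shift D F m n i j :
  van2 D F m n -> van2 (D - (i + j)) F (m - N%:Z * i%:Z) (n - N%:Z * j%:Z).
Proof.
move=> v i' j' h; have := v (i + i')%N (j + j')%N.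
rewrite !PoszD !mulrDr !opprD !addrA; apply; lia.
Qed.

Lemma van2_0 F m n : van2 0 F m n -> F m n = 0.
Proof. by move/(_ 0%N 0%N (leqnn _)); rewrite !mulr0 !subr0. Qed.

Lemma van2_rdif D F m n : van2 D.+1 F m n -> van2 D (rdif F) m n.
Proof.
move=> v i j ij; have h1 := v i.+1 j; have h2 := v i j.+1.
have e l (x : int) : x - N%:Z * l%:Z - N%:Z = x - N%:Z * l.+1%:Z by lia.
by rewrite /rdif !e h1 ?h2 ?subr0 //; lia.
Qed.

Lemma van2_iter D j F m n : van2 (j + D) F m n -> van2 D (iter j rdif F) m n.
Proof.
elim: j D => // j IH D v; rewrite iterS; apply: van2_rdif; apply: IH.
by rewrite addnS.
Qed.

Lemma iter_rdif_van D j F m n : van2 D F m n -> (D <= j)%N -> iter j rdif F m n = 0.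
Proof.
by move=> v Dj; apply/van2_0/van2_iter; apply: van2_le v; rewrite addn0.
Qed.

Lemma van2_lin D c F G m n : van2 D F m n -> van2 D G m n -> van2 D (c *: F + G) m n.
Proof.
move=> f g i j ij; rewrite -[LHS]/(c *: F _ _ + G _ _) f // g //.
by rewrite scaler0 addr0.
Qed.

Lemma lowfin0 : lowfin 0. Proof. by move=> m n; exists 0%N. Qed.

Lemma lowfin_lin c F G : lowfin F -> lowfin G -> lowfin (c *: F + G).
Proof.
move=> f g m n; have [D d] := f m n; have [D' d'] := g m n.
exists (maxn D D'); apply: van2_lin.
  by apply: van2_le d; rewrite leq_maxl.
by apply: van2_le d'; rewrite leq_maxr.
Qed.

Lemma hactE D h F m n : van2 D F m n ->
  hact h F m n = \sum_(j < D) h j *: iter j rdif F m n.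
Proof.
move=> v; rewrite /hact (@fsum_seq _ _ (index_iota 0 D)) ?iota_uniq //.
  by rewrite big_mkord.
move=> j; rewrite mem_index_iota -leqNgt => Dj.
by rewrite (iter_rdif_van v) ?scaler0.
Qed.

Lemma hact_evto h F m n : lowfin F ->
  evto (fun M => \sum_(j < M) h j *: iter j rdif F m n) (hact h F m n).
Proof.
move=> /(_ m n)[D v]; exists D => M DM; rewrite (@hactE M) //.
exact: van2_le DM v.
Qed.

Lemma van2_hact D h F m n : van2 D F m n -> van2 D (hact h F) m n.
Proof.
move=> v i j ij; rewrite (@hactE 0) ?big_ord0 //.
by apply: (van2_le _ (van2_shift (i := i) (j := j) v)); lia.
Qed.

Lemma lowfin_hact h F : lowfin F -> lowfin (hact h F).
Proof. by move=> f m n; have [D v] := f m n; exists D; exact: van2_hact. Qed.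

Lemma hact_lin h c F G : lowfin F -> lowfin G ->
  hact h (c *: F + G) = c *: hact h F + hact h G.
Proof.
move=> f g; apply/funext => m; apply/funext => n.
apply: evto_uniq (hact_evto h m n (lowfin_lin c f g)) _.
have := evto_map2 (fun x y => c *: x + y) (hact_evto h m n f) (hact_evto h m n g).
apply: (evto_eq (M0 := 0%N)) => M _.
rewrite scaler_sumr -big_split /=; apply: eq_bigr => j _.
by rewrite iter_rdif_lin scalerA mulrC -scalerA -scalerDr.
Qed.

Lemma hactZ h c F : lowfin F -> hact h (c *: F) = c *: hact h F.
Proof.
move=> f; have := hact_lin h c f lowfin0; rewrite addr0 => ->.
rewrite (_ : hact h 0 = 0) ?addr0 //; apply/funext => m; apply/funext => n.
by rewrite (@hactE 0) ?big_ord0.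
Qed.

Lemma iter_rdifZ j c F : iter j rdif (c *: F) = c *: iter j rdif F.
Proof. exact: (linZ (iter_rdif_lin j)). Qed.

Lemma hact_rdif h F : lowfin F -> hact h (rdif F) = rdif (hact h F).
Proof.
move=> f; apply/funext => m; apply/funext => n.
have fr : lowfin (rdif F).
  by rewrite rdifE difE => m' n'; have [D v] := f m' n'; exists D;
    rewrite -difE -rdifE; apply: van2_rdif; apply: van2_le v.
apply: evto_uniq (hact_evto h m n fr) _.
have := evto_map2 (fun x y => x - y) (hact_evto h m (n - N%:Z) f)
  (hact_evto h (m - N%:Z) n f).
apply: (evto_eq (M0 := 0%N)) => M _.
rewrite -sumrB; apply: eq_bigr => j _.
by rewrite -iterSr iterS /rdif scalerBr.
Qed.

Lemma lowfin_rdif F : lowfin F -> lowfin (rdif F).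
Proof.
move=> f m n; have [D v] := f m n; exists D.
by apply: van2_rdif; apply: van2_le v.
Qed.

Lemma lowfin_iter_rdif j F : lowfin F -> lowfin (iter j rdif F).
Proof. by move=> f; elim: j => //= j; exact: lowfin_rdif. Qed.

Lemma hact_iter_rdif h j F : lowfin F -> hact h (iter j rdif F) = iter j rdif (hact h F).
Proof.
move=> f; elim: j => //= j <-; rewrite hact_rdif //; exact: lowfin_iter_rdif.
Qed.

Lemma hact_scale h c F : lowfin F -> hact (fun j => c * h j) F = c *: hact h F.
Proof.
move=> f; apply/funext => m; apply/funext => n.
have [D v] := f m n; rewrite -[RHS]/(c *: hact h F m n) !(hactE _ v).
by rewrite scaler_sumr; apply: eq_bigr => j _; rewrite scalerA.
Qed.

Lemma hact_one F : hact (fun j => (j == 0%N)%:R) F = F.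
Proof.
apply/funext => m; apply/funext => n.
rewrite /hact (@fsum_seq _ _ [:: 0%N]) ?big_seq1 ?scale1r //.
by move=> j; rewrite inE => /negbTE ->; rewrite scale0r.
Qed.

Lemma hact_X F : hact (fun j => (j == 1%N)%:R) F = rdif F.
Proof.
apply/funext => m; apply/funext => n.
rewrite /hact (@fsum_seq _ _ [:: 1%N]) ?big_seq1 ?scale1r //.
by move=> j; rewrite inE => /negbTE ->; rewrite scale0r.
Qed.

Definition cauchy_product h g : nat -> R[i] := fun j => \sum_(i < j.+1) h i * g (j - i)%N.

(** At a given exponent only powers of x_2 - x_1 below some D contribute, and both sides become the
    same sum over the triangle i + l < D. *)
Lemma hact_hact h g F : lowfin F -> hact h (hact g F) = hact (cauchy_product h g) F.
Proof.
move=> f; apply/funext => m; apply/funext => n; have [D v] := f m n.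
rewrite (hactE _ (van2_hact g v)) (hactE _ v).
transitivity (\sum_(j < D) \sum_(i < j.+1)
    (h i * g (j - i)%N) *: iter ((j - i) + i) rdif F m n); last first.
  apply: eq_bigr => j _; rewrite scaler_suml; apply: eq_bigr => i _.
  by rewrite subnK // -ltnS.
rewrite (sum_triangle (fun i l => (h i * g l) *: iter (l + i) rdif F m n)).
apply: eq_bigr => i _; rewrite -hact_iter_rdif //.
have vi : van2 (D - i) (iter i rdif F) m n.
  by apply: van2_iter; rewrite subnKC // ltnW.
rewrite (hactE _ vi) scaler_sumr; apply: eq_bigr => l _.
by rewrite scalerA iterD.
Qed.

Lemma iter_rdif_swap j F m n :
  iter j rdif (fun m n => F n m) m n = (-1) ^+ j *: iter j rdif F n m.
Proof.
elim: j m n => [|j IH] m n; first by rewrite scale1r.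
by rewrite !iterS /rdif !IH -scalerBr exprS mulN1r scaleNr -scalerN opprB.
Qed.

Lemma hact_swap h F m n :
  hact h (fun m n => F n m) m n = hact (fun j => h j * (-1) ^+ j) F n m.
Proof.
by apply: eq_fsbigr => j _; rewrite iter_rdif_swap scalerA.
Qed.

(* The s-th divided derivative of h *)
Definition divder h (s : nat) : nat -> R[i] := fun j => h (s + j)%N * 'C(s + j, s)%:R.

(** The binomial theorem for (x_2 - x_1) + x_0. The outer argument q of Xi is the exponent of x_0,
    so Xi is a series in x_0 with two-variable series as coefficients. *)
Lemma iter_taylor i (Xi : int -> int -> int -> V) q :
  iter i (fun Psi q => rdif (Psi q) + Psi (q - 1)) Xi q =
  \sum_(s < i.+1) 'C(i, s)%:R *: iter (i - s) rdif (Xi (q - s%:Z)).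
Proof.
have rsum (n : nat) (c : nat -> R[i]) (f : nat -> int -> int -> V) :
    rdif (\sum_(s < n) c s *: f s) = \sum_(s < n) c s *: rdif (f s).
  rewrite (lin_sum rdif_lin); apply: eq_bigr => s _.
  by rewrite (linZ rdif_lin).
elim: i q => [|i IH] q; first by rewrite big_ord1 bin0 scale1r subr0.
rewrite iterS IH (IH (q - 1)).
rewrite (rsum _ (fun s => 'C(i, s)%:R) (fun s => iter (i - s) rdif (Xi (q - s%:Z)))).
rewrite big_ord_recl [RHS]big_ord_recl !bin0 !scale1r subr0 -addrA.
congr (_ + _); first by rewrite /= !subn0.
transitivity (\sum_(s < i.+1) ('C(i, s.+1)%:R + 'C(i, s)%:R : R[i]) *:
    iter (i - s) rdif (Xi (q - s.+1%:Z))); last first.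
  by apply: eq_bigr => s _; rewrite lift0 subSS binS natrD.
under [RHS]eq_bigr do rewrite scalerDl.
rewrite big_split /=; congr (_ + _); last first.
  by apply: eq_bigr => s _; congr (_ *: iter _ _ (Xi _)); lia.
rewrite [RHS]big_ord_recr /= bin_small // scale0r addr0.
apply: eq_bigr => s _; by rewrite /bump add1n -iterS subnSK.
Qed.

(** Taylor's formula h(u + x_0) = sum_s x_0^s h^(s)(u) / s! at u = x_2 - x_1. As Xi starts at
    x_0^q0, only derivatives with s < S reach the coefficient of x_0^q. *)
Lemma taylor_evto h (Xi : int -> int -> int -> V) q0 (S : nat) q m n :
  (forall q, q < q0 -> Xi q = 0) -> (forall q, lowfin (Xi q)) -> q - S%:Z < q0 ->
  evto (fun M => \sum_(i < M) h i *:
      iter i (fun Psi q => rdif (Psi q) + Psi (q - 1)) Xi q m n)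
    (\sum_(s < S) hact (divder h s) (Xi (q - s%:Z)) m n).
Proof.
move=> z f hS.
have zi (s l : nat) : (S <= s)%N -> iter l rdif (Xi (q - s%:Z)) m n = 0.
  move=> Ss; rewrite z; last by lia.
  by rewrite (iter_rdif_van (D := 0)).
apply: (evto_eq (M0 := S) (u := fun M => \sum_(s < S) \sum_(l < M - s)
    divder h s l *: iter l rdif (Xi (q - s%:Z)) m n)); last first.
  apply: evto_sum => s; have [M0 h0] := hact_evto (divder h s) m n (f (q - s%:Z)).
  by exists (M0 + s)%N => M hM; apply: h0; lia.
move=> M SM.
transitivity (\sum_(s < M) \sum_(l < M - s)
    divder h s l *: iter l rdif (Xi (q - s%:Z)) m n).
  rewrite -(subnKC SM) big_split_ord /= [X in _ = _ + X]big1 ?addr0 // => s _.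
  by rewrite big1 // => l _; rewrite zi ?scaler0 // leq_addr.
rewrite -(sum_triangle (fun s l => divder h s l *: iter l rdif (Xi (q - s%:Z)) m n)).
apply: eq_bigr => i _; rewrite iter_taylor.
rewrite -[X in _ = _ *: X](_ : \sum_(s < i.+1)
    ('C(i, s)%:R *: iter (i - s) rdif (Xi (q - s%:Z))) m n = _); last first.
  by rewrite !fct_sumE.
rewrite scaler_sumr; apply: eq_bigr => s _; rewrite /divder.
by rewrite subnKC -1?ltnS // -scalerA.
Qed.

End OneSpace.
Arguments rdif {V}.

Lemma iter_rdif_map (V V' : lmodType R[i]) (f : V -> V') j (F : int -> int -> V) :
  linear f -> iter j rdif (fun m n => f (F m n)) = fun m n => f (iter j rdif F m n).
Proof.
move=> lf; elim: j => //= j ->; apply/funext => m; apply/funext => n.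
by rewrite /rdif (linB lf).
Qed.

Lemma hact_map (V V' : lmodType R[i]) (f : V -> V') h (F : int -> int -> V) :
  linear f -> lowfin F ->
  hact h (fun m n => f (F m n)) = fun m n => f (hact h F m n).
Proof.
move=> lf l; apply/funext => m; apply/funext => n; have [D v] := l m n.
rewrite (hactE _ v) (@hactE _ D); last by move=> i j ij; rewrite v ?(lin0 lf).
rewrite (lin_sum lf); apply: eq_bigr => j _.
by rewrite iter_rdif_map // (linZ lf).
Qed.

End PowerSeriesAction.

Arguments rdif {R} N {V}.
Arguments hact {R} N {V}.
Arguments van2 {R} N {V}.
Arguments lowfin {R} N {V}.

(** Used with a substitution as the relation and, with a relation that ignores its second argument,
    for the invariance of a predicate under polynomials in one operator. *)
Lemma psum_rel (K : pzRingType) (E E' : lmodType K) (rel : E -> E' -> Prop)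
    (t : E -> E) (t' : E' -> E') (h : nat -> K) (M : nat) x x' :
  rel 0 0 ->
  (forall c y y' z z', rel y y' -> rel z z' -> rel (c *: y + z) (c *: y' + z')) ->
  (forall y y', rel y y' -> rel (t y) (t' y')) -> rel x x' ->
  rel (\sum_(j < M) h j *: iter j t x) (\sum_(j < M) h j *: iter j t' x').
Proof.
move=> r0 rl rt rx.
have ri j : rel (iter j t x) (iter j t' x') by elim: j => //= j; exact: rt.
elim: M => [|M IH]; first by rewrite !big_ord0.
by rewrite !big_ord_recr /= addrC [X in rel _ X]addrC; apply: rl.
Qed.

(** * Three variables *)

Section ThreeVariables.
Variables (R : realType) (N : nat).
Hypothesis hN : (0 < N)%N.
Variable V : lmodType R[i].
Implicit Types (F Phi : int -> int -> int -> V) (h : nat -> R[i]) (D k : nat).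
Implicit Types (y s t L p q : int).

Definition van3 D F y s t := forall i j l, (D <= i + j + l)%N ->
  F (y - N%:Z * i%:Z) (s - N%:Z * j%:Z) (t - N%:Z * l%:Z) = 0.

Definition lowfin3 F := forall y s t, exists D, van3 D F y s t.

Definition hact_ys h F : int -> int -> int -> V :=
  fun y s t => hact N h (fun y s => F y s t) y s.

Definition hact_yt h F : int -> int -> int -> V :=
  fun y s t => hact N h (fun y t => F y s t) y t.

(* Multiplications by s - y and t - y *)
Definition rys F : int -> int -> int -> V :=
  fun y s t => F y (s - N%:Z) t - F (y - N%:Z) s t.

Definition ryt F : int -> int -> int -> V :=
  fun y s t => F y s (t - N%:Z) - F (y - N%:Z) s t.

Lemma van3_le D D' F y s t : (D <= D')%N -> van3 D F y s t -> van3 D' F y s t.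
Proof. by move=> h v i j l ij; apply: v; apply: leq_trans ij. Qed.

Lemma van3_shift i j l D F y s t : van3 D F y s t ->
  van3 (D - (i + j + l)) F (y - N%:Z * i%:Z) (s - N%:Z * j%:Z) (t - N%:Z * l%:Z).
Proof.
move=> v i' j' l' h; have := v (i + i')%N (j + j')%N (l + l')%N.
rewrite !PoszD !mulrDr !opprD !addrA; apply; lia.
Qed.

Lemma van3_ys D F y s t : van3 D F y s t -> van2 N D (fun y s => F y s t) y s.
Proof.
by move=> v i j ij; have := v i j 0%N; rewrite mulr0 subr0; apply; rewrite addn0.
Qed.

Lemma van3_yt D F y s t : van3 D F y s t -> van2 N D (fun y t => F y s t) y t.
Proof.
by move=> v i j ij; have := v i 0%N j; rewrite mulr0 subr0; apply; rewrite addn0.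
Qed.

Lemma lowfin3_ys F t : lowfin3 F -> lowfin N (fun y s => F y s t).
Proof. by move=> f y s; have [D v] := f y s t; exists D; exact: van3_ys. Qed.

Lemma lowfin3_yt F s : lowfin3 F -> lowfin N (fun y t => F y s t).
Proof. by move=> f y t; have [D v] := f y s t; exists D; exact: van3_yt. Qed.

Lemma lowfin3_hact_ys h F : lowfin3 F -> lowfin3 (hact_ys h F).
Proof.
move=> f y s t; have [D v] := f y s t; exists D => i j l ijl.
rewrite /hact_ys (hactE (D := 0)) ?big_ord0 //; apply: van3_ys.
by apply: (van3_le _ (van3_shift (i := i) (j := j) (l := l) v)); lia.
Qed.

Lemma lowfin3_hact_yt h F : lowfin3 F -> lowfin3 (hact_yt h F).
Proof.
move=> f y s t; have [D v] := f y s t; exists D => i j l ijl.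
rewrite /hact_yt (hactE (D := 0)) ?big_ord0 //; apply: van3_yt.
by apply: (van3_le _ (van3_shift (i := i) (j := j) (l := l) v)); lia.
Qed.

Lemma lowfin3_lin c F Phi : lowfin3 F -> lowfin3 Phi -> lowfin3 (c *: F + Phi).
Proof.
move=> f g y s t; have [D d] := f y s t; have [D' d'] := g y s t.
exists (maxn D D') => i j l ijl; rewrite !fctE /= d ?d' ?scaler0 ?addr0 //; lia.
Qed.

Lemma iter_rys j F y s t : iter j rys F y s t = iter j (rdif N) (fun y s => F y s t) y s.
Proof. by elim: j y s => // j IH y s; rewrite !iterS /rys /rdif !IH. Qed.

Lemma iter_ryt j F y s t : iter j ryt F y s t = iter j (rdif N) (fun y t => F y s t) y t.
Proof. by elim: j y t => // j IH y t; rewrite !iterS /ryt /rdif !IH. Qed.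

(* The bounds do not depend on i, so they survive multiplication of F by power
   series in s - y, which involve all translates y - N i. *)
Definition utr y k L F := forall i : nat,
  tr2 L (iter k (dif N) (F (y - N%:Z * i%:Z))).

Lemma utr_lin y k L c F Phi : utr y k L F -> utr y k L Phi -> utr y k L (c *: F + Phi).
Proof.
move=> f g i; rewrite -[X in iter k _ X]/(c *: F _ + Phi _) iter_dif_lin.
exact: tr2_lin.
Qed.

Lemma utr_le y k L k' L' F : (k <= k')%N -> L' <= L -> utr y k L F -> utr y k' L' F.
Proof.
move=> hk hL f i; apply: (tr2_iter_le hk); exact: tr2_le (f i).
Qed.

Lemma utr_down y k L F : utr y k L F -> utr y k L (fun y => F (y - N%:Z)).
Proof.
move=> f i; have := f i.+1; have -> // : y - N%:Z * i.+1%:Z = y - N%:Z * i%:Z - N%:Z.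
by lia.
Qed.

Lemma utr_rys y k L F : utr y k L F -> utr y k L (rys F).
Proof.
move=> f; have -> : rys F = -1 *: (fun y => F (y - N%:Z)) + (fun y => shl N%:Z (F y)).
  by rewrite scaleN1r addrC.
apply: utr_lin; first exact: utr_down.
by move=> i; rewrite iter_dif_shl; apply: tr2_shl.
Qed.

Lemma utr_ryt y k L F : utr y k L F -> utr y k L (ryt F).
Proof.
move=> f; have -> : ryt F = -1 *: (fun y => F (y - N%:Z)) + (fun y => shr N (F y)).
  by rewrite scaleN1r addrC.
apply: utr_lin; first exact: utr_down.
by move=> i; rewrite iter_dif_shr; apply: tr2_shr.
Qed.

Lemma utr_psum (t : (int -> int -> int -> V) -> _) h M y k L F :
  (forall G, utr y k L G -> utr y k L (t G)) -> utr y k L F ->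
  utr y k L (\sum_(j < M) h j *: iter j t F).
Proof.
move=> ht f.
apply: (@psum_rel _ _ _ (fun G _ => utr y k L G) t t h M F F) => //.
- by move=> i m n _; rewrite (_ : iter k (dif N) _ = 0) //; elim: k {f ht} => //= k ->;
    apply/funext => ?; apply/funext => ?; rewrite /dif subr0.
- by move=> c G G' H H'; exact: utr_lin.
by move=> G _; exact: ht.
Qed.

Lemma evto_hact_ys h F y s t : lowfin3 F ->
  evto (fun M => (\sum_(j < M) h j *: iter j rys F) y s t) (hact_ys h F y s t).
Proof.
move=> f; have := hact_evto h y s (lowfin3_ys t f).
apply: (evto_eq (M0 := 0%N)) => M _; rewrite !fct_sumE.
by apply: eq_bigr => j _; rewrite -iter_rys.
Qed.

Lemma evto_hact_yt h F y s t : lowfin3 F ->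
  evto (fun M => (\sum_(j < M) h j *: iter j ryt F) y s t) (hact_yt h F y s t).
Proof.
move=> f; have := hact_evto h y t (lowfin3_yt s f).
apply: (evto_eq (M0 := 0%N)) => M _; rewrite !fct_sumE.
by apply: eq_bigr => j _; rewrite -iter_ryt.
Qed.

(** The first condition makes h(s - y) and h(t - y) act by finite sums; the second lets the
    substitution s = t + x_0 pass to the limit of the partial sums of h. *)
Definition utame F := lowfin3 F /\ forall y, exists k L, utr y k L F.

Lemma tr2_lim L (Fs : nat -> int -> int -> V) (G : int -> int -> V) :
  (forall M, tr2 L (Fs M)) -> (forall m n, evto (fun M => Fs M m n) (G m n)) ->
  tr2 L G.
Proof.
move=> t h m n mn; apply: evto_uniq (h m n) _.
by exists 0%N => M _; rewrite t.
Qed.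

Lemma utr_lim (Fs : nat -> int -> int -> int -> V) y k L F :
  (forall M, utr y k L (Fs M)) ->
  (forall y s t, evto (fun M => Fs M y s t) (F y s t)) -> utr y k L F.
Proof.
move=> u e i; apply: (tr2_lim (fun M => u M i)) => m n.
exact: iter_dif_lim.
Qed.

Lemma utame_lin c F Phi : utame F -> utame Phi -> utame (c *: F + Phi).
Proof.
move=> [f1 f2] [g1 g2]; split=> [|y]; first exact: lowfin3_lin.
have [k [L u]] := f2 y; have [k' [L' u']] := g2 y.
exists (maxn k k'), (Order.min L L'); apply: utr_lin.
- by apply: utr_le u; rewrite ?leq_maxl ?ge_min ?lexx.
by apply: utr_le u'; rewrite ?leq_maxr ?ge_min ?lexx ?orbT.
Qed.

Lemma utame0 : utame 0.
Proof.
split=> [y s t|y]; first by exists 0%N.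
by exists 0%N, 0 => i.
Qed.

Lemma utame_hact_ys h F : utame F -> utame (hact_ys h F).
Proof.
move=> [f u]; split=> [|y]; first exact: lowfin3_hact_ys.
have [k [L uy]] := u y; exists k, L.
apply: (@utr_lim (fun M => \sum_(j < M) h j *: iter j rys F)).
  by move=> M; apply: utr_psum uy; exact: utr_rys.
by move=> *; exact: evto_hact_ys.
Qed.

Lemma utame_hact_yt h F : utame F -> utame (hact_yt h F).
Proof.
move=> [f u]; split=> [|y]; first exact: lowfin3_hact_yt.
have [k [L uy]] := u y; exists k, L.
apply: (@utr_lim (fun M => \sum_(j < M) h j *: iter j ryt F)).
  by move=> M; apply: utr_psum uy; exact: utr_ryt.
by move=> *; exact: evto_hact_yt.
Qed.

(** The substitution s = t + x_0 with y as a parameter; the arguments of Phi are the exponents of y,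
    x_0 and t. *)
Definition sub3 F Phi := forall y, subE N (F y) (Phi y).

Lemma sub3_lin c F G Phi Psi : sub3 F Phi -> sub3 G Psi ->
  sub3 (c *: F + G) (c *: Phi + Psi).
Proof. by move=> f g y; exact: (subE_lin hN c (f y) (g y)). Qed.

Lemma sub3_0 : sub3 0 0. Proof. by move=> y; exact: subE_0. Qed.

Definition shiftq Phi : int -> int -> int -> V := fun y q p => Phi y (q - 1) p.

(** s - y = (t - y) + (s - t), and s - t becomes x_0, multiplication by which is [shiftq]. *)
Lemma sub3_rys F Phi : sub3 F Phi -> sub3 (rys F) (ryt Phi + shiftq Phi).
Proof.
move=> f y; have := subE_lin hN (-1) (f (y - N%:Z)) (subE_shl hN (f y)).
rewrite !scaleN1r addrC [X in subE _ _ X]addrC.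
by rewrite [X in subE _ _ X]addrAC.
Qed.

Lemma sub3_ryt F Phi : sub3 F Phi -> sub3 (ryt F) (ryt Phi).
Proof.
move=> f y; have := subE_lin hN (-1) (f (y - N%:Z)) (subE_shr hN (f y)).
by rewrite !scaleN1r addrC [X in subE _ _ X]addrC.
Qed.

Lemma sub3_hact_yt h F Phi : utame F -> sub3 F Phi ->
  (forall q, lowfin N (fun y p => Phi y q p)) ->
  sub3 (hact_yt h F) (fun y q p => hact N h (fun y p => Phi y q p) y p).
Proof.
move=> [f u] FP lP y; have [k [L uy]] := u y.
apply: (@subE_lim _ _ hN _ k L (fun M => (\sum_(j < M) h j *: iter j ryt F) y)
  (fun M => (\sum_(j < M) h j *: iter j ryt Phi) y)).
- move=> M; have := utr_psum h M (@utr_ryt y k L) uy 0%N.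
  by rewrite mulr0 subr0.
- by move=> m n; exact: evto_hact_yt.
- move=> M; suff /(_ y) : sub3 (\sum_(j < M) h j *: iter j ryt F)
      (\sum_(j < M) h j *: iter j ryt Phi) by [].
  apply: (@psum_rel _ _ _ sub3 ryt ryt) => //.
  + exact: sub3_0.
  + by move=> c G G' H H'; exact: sub3_lin.
  by move=> G G'; exact: sub3_ryt.
move=> q p; have := hact_evto h y p (lP q).
apply: (evto_eq (M0 := 0%N)) => M _; rewrite !fct_sumE.
by apply: eq_bigr => j _; rewrite -iter_ryt.
Qed.

Lemma evto_hact_ys_taylor h Phi q0 (S : int -> nat) y q p :
  (forall q, lowfin N (fun y p => Phi y q p)) ->
  (forall y q p, q < q0 -> Phi y q p = 0) -> (forall q, q - (S q)%:Z < q0) ->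
  evto (fun M => (\sum_(j < M) h j *: iter j (fun P => ryt P + shiftq P) Phi) y q p)
    (\sum_(s < S q) hact N (divder h s) (fun y p => Phi y (q - s%:Z) p) y p).
Proof.
move=> lP hP hS; have hz r : r < q0 -> (fun y p => Phi y r p) = 0.
  by move=> hr; apply/funext => y'; apply/funext => p'; exact: hP.
have := @taylor_evto _ N _ h (fun q y p => Phi y q p) q0 (S q) q y p hz lP (hS q).
apply: (evto_eq (M0 := 0%N)) => M _; rewrite !fct_sumE.
apply: eq_bigr => j _; rewrite -[RHS]/(h j *: _); congr (_ *: _).
elim: (j : nat) q y p => // i IH q y' p.
by rewrite !iterS -[LHS]/(_ - _ + _) -[RHS]/(_ - _ + _) /shiftq !IH.
Qed.

(** h(s - y) becomes h((t - y) + x_0), which Taylor's formula expands in x_0. The partial sums of h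
    inherit the bounds [utr] of F, so the limit may be taken after substituting. *)
Lemma sub3_hact_ys h F Phi q0 (S : int -> nat) : utame F -> sub3 F Phi ->
  (forall q, lowfin N (fun y p => Phi y q p)) ->
  (forall y q p, q < q0 -> Phi y q p = 0) -> (forall q, q - (S q)%:Z < q0) ->
  sub3 (hact_ys h F) (fun y q p =>
    \sum_(s < S q) hact N (divder h s) (fun y p => Phi y (q - s%:Z) p) y p).
Proof.
move=> [f u] FP lP hP hS y; have [k [L uy]] := u y.
pose op Phi := ryt Phi + shiftq Phi.
apply: (@subE_lim _ _ hN _ k L (fun M => (\sum_(j < M) h j *: iter j rys F) y)
  (fun M => (\sum_(j < M) h j *: iter j op Phi) y)).
- move=> M; have := utr_psum h M (@utr_rys y k L) uy 0%N.
  by rewrite mulr0 subr0.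
- by move=> m n; exact: evto_hact_ys.
- move=> M; suff /(_ y) : sub3 (\sum_(j < M) h j *: iter j rys F)
      (\sum_(j < M) h j *: iter j op Phi) by [].
  apply: (@psum_rel _ _ _ sub3 rys op) => //.
  + exact: sub3_0.
  + by move=> c G G' H H'; exact: sub3_lin.
  by move=> G G'; exact: sub3_rys.
by move=> q p; exact: (@evto_hact_ys_taylor h Phi q0 S y q p lP hP hS).
Qed.

End ThreeVariables.

Arguments rys {R} N {V}.
Arguments ryt {R} N {V}.
Arguments hact_ys {R} N {V}.
Arguments hact_yt {R} N {V}.
Arguments shiftq {R V}.

(** Beyond I0 nothing is required of x, and the finitely many smaller i have a common bound J; hence
    D = I0 + J. *)
Lemma exists_total_bound (X : Type) (sz : X -> nat) (P : nat -> X -> Prop) :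
  (exists I0, forall i x, (I0 <= i)%N -> P i x) ->
  (forall i, exists J, forall x, (J <= sz x)%N -> P i x) ->
  exists D, forall i x, (D <= i + sz x)%N -> P i x.
Proof.
move=> [I0 h1] h2.
have [i hi|J hJ] := @exists_uniform_bound I0
    (fun i D => forall x, (D <= sz x)%N -> P i x).
  have [J hJ] := h2 i; exists J => D' JD x Dx; exact: hJ (leq_trans JD Dx).
exists (I0 + J)%N => i x h; have [hi|hi] := leqP I0 i; first exact: h1.
by apply: (hJ i J) => //; lia.
Qed.

Lemma common_lower_bound (I : finType) (Q : I -> int -> Prop) :
  (forall i L L', L' <= L -> Q i L -> Q i L') ->
  (forall i, exists L, Q i L) -> exists L, forall i, Q i L.
Proof.
move=> mono h; suff [L hL] : exists L, forall i, i \in enum I -> Q i L.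
  by exists L => i; apply: hL; rewrite mem_enum.
elim: (enum I) => [|i r [L hL]]; first by exists 0.
have [L' hL'] := h i; exists (Order.min L L') => j; rewrite inE.
case/orP => [/eqP ->|/hL hj].
  by apply: mono hL'; rewrite ge_min lexx orbT.
by apply: mono hj; rewrite ge_min lexx.
Qed.

(** * Pairs of twisted fields *)

Section Fields.
Variables (R : realType) (N : nat).
Hypothesis hN : (0 < N)%N.
Variable W : lmodType R[i].
Notation field := (W -> int -> W).
Implicit Types (a b c : field) (w : W).

Lemma lin_at a m : linear a -> linear (fun w => a w m).
Proof. by move=> la x u v; rewrite la. Qed.

Lemma field0 a m : linear a -> a 0 m = 0.
Proof. by move=> la; rewrite (lin0 la). Qed.

Lemma field_down a w m : EWN W a ->
  exists I0, forall i, (I0 <= i)%N -> a w (m - N%:Z * i%:Z) = 0.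
Proof.
move=> [_ /(_ w)[L h]]; exists (absz (m - L)%R).+1 => i hi; apply: h.
by move: hi hN; clear; nia.
Qed.

(** The field a acts first and gives 0 at all low exponents; each of the finitely many remaining
    vectors is truncated by b. *)
Lemma lowfin_prod a b w : EWN W a -> EWN W b -> lowfin N (fun m n => b (a w m) n).
Proof.
move=> ha hb m n.
apply: (@exists_total_bound nat id (fun i j =>
  b (a w (m - N%:Z * i%:Z)) (n - N%:Z * j%:Z) = 0)).
  have [I0 h] := field_down w m ha; exists I0 => i j /h ->.
  by rewrite (field0 _ hb.1).
by move=> i; exact: field_down.
Qed.

Lemma lowfin3_prod_yts a b c w : EWN W a -> EWN W b -> EWN W c ->
  lowfin3 N (fun y s t => b (c (a w y) t) s).
Proof.
move=> ha hb hc y s t.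
have [||D h] := @exists_total_bound (nat * nat)%type (fun x => x.1 + x.2)%N (fun i x =>
  b (c (a w (y - N%:Z * i%:Z)) (t - N%:Z * x.1%:Z)) (s - N%:Z * x.2%:Z) = 0).
- have [I0 h] := field_down w y ha; exists I0 => i j /h ->.
  by rewrite (field0 _ hc.1) (field0 _ hb.1).
- move=> i; have [D v] := lowfin_prod (a w (y - N%:Z * i%:Z)) hc hb t s.
  by exists D => -[l j]; exact: v.
by exists D => i j l ijl; apply: (h i (l, j)); rewrite /=; lia.
Qed.

Lemma lowfin3_prod_tsy a b c w : EWN W a -> EWN W b -> EWN W c ->
  lowfin3 N (fun y s t => c (a (b w t) s) y).
Proof.
move=> ha hb hc y s t.
have [||D h] := @exists_total_bound (nat * nat)%type (fun x => x.1 + x.2)%N (fun i x =>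
  c (a (b w (t - N%:Z * i%:Z)) (s - N%:Z * x.1%:Z)) (y - N%:Z * x.2%:Z) = 0).
- have [I0 h] := field_down w t hb; exists I0 => i j /h ->.
  by rewrite (field0 _ ha.1) (field0 _ hc.1).
- move=> i; have [D v] := lowfin_prod (b w (t - N%:Z * i%:Z)) ha hc s y.
  by exists D => -[l j]; exact: v.
by exists D => i j l ijl; apply: (h l (j, i)); rewrite /=; lia.
Qed.

Definition pair_compatible a b := exists k, hom_laurent2 (mulx12 N k (prod2 a b)).

Lemma mulx12E k (F : W -> int -> int -> W) w : mulx12 N k F w = iter k (dif N) (F w).
Proof. by elim: k => [//|k IH]; rewrite [RHS]iterS -IH. Qed.

Lemma YE_spec a b : pair_compatible a b -> exists k, forall w,
  (exists L, tr2 L (iter k (dif N) (prod2 a b w))) /\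
  forall q p, YE N a b q w p = sb N (iter k (dif N) (prod2 a b w)) (q + k%:Z) p.
Proof.
move=> cab; rewrite /YE; set k := xget _ _.
have [lk hk] : hom_laurent2 (mulx12 N k (prod2 a b)) by exact: (xgetPex 0%N cab).
exists k => w; split=> [|q p]; last by rewrite -mulx12E.
by have [L h] := hk w; exists L; rewrite -mulx12E.
Qed.

(** Together with [subE_uniq] this determines [YE] without reference to the exponent selected in its
    definition. *)
Lemma subE_YE a b w : pair_compatible a b ->
  subE N (prod2 a b w) (fun q p => YE N a b q w p).
Proof. by move=> /YE_spec[k /(_ w)[[L t] h]]; exists k, L. Qed.

Lemma YE_bounded a b : pair_compatible a b ->
  exists q0, forall q, q < q0 -> YE N a b q = 0.
Proof.
move=> /YE_spec[k h]; exists (- k%:Z) => q hq.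
apply/funext => w; apply/funext => p; rewrite (h w).2 sb_neg //; lia.
Qed.

Lemma linear_prod2 a b : linear a -> linear b -> linear (prod2 a b).
Proof.
move=> la lb x u v; apply/funext => m; apply/funext => n.
by rewrite /prod2 lb !fctE /= (lin_at m la).
Qed.

Lemma EWN_YE a b q : EWN W a -> EWN W b -> pair_compatible a b -> EWN W (YE N a b q).
Proof.
move=> [la fa] [lb fb] cab; split=> [x u v|w].
  have lp := linear_prod2 la lb x u v.
  have := subE_lin hN x (subE_YE u cab) (subE_YE v cab).
  rewrite -lp => /(subE_uniq hN (subE_YE _ cab)) E.
  by apply/funext => p; exact: (congr1 (fun f => f q p) E).
have [k /(_ w)[[L t] h]] := YE_spec cab.
case E: (q + k%:Z) => [i|i]; last first.
  by exists 0 => p _; rewrite h E.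
exists (L + L - N%:Z * i%:Z) => p hp; rewrite h E /= fsbig1 // => m _.
by rewrite t ?scaler0 //; move: hp; clear; lia.
Qed.

(* Sums of h(x_2 - x_1) b(x_2) a(x_1); the first integer argument of the series
   is the exponent of x_1. *)
Inductive RF (A B : set field) : (W -> int -> int -> W) -> Prop :=
| RF0 : RF A B 0
| RF_lin x G G' : RF A B G -> RF A B G' -> RF A B (x *: G + G')
| RF_hact_prod h a b : A a -> B b ->
    RF A B (fun w => hact N h (fun m n => b (a w m) n)).

Lemma RF_prod A B a b : A a -> B b -> RF A B (fun w m n => b (a w m) n).
Proof.
move=> ha hb; have := RF_hact_prod (fun j => (j == 0%N)%:R) ha hb.
by under eq_fun do rewrite hact_one.
Qed.

Lemma RF_sub (A B A' B' : set field) G : A `<=` A' -> B `<=` B' -> RF A B G -> RF A' B' G.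
Proof.
move=> AA BB; elim=> [|x G1 G2 _ h1 _ h2|h a b ha hb]; first exact: RF0.
  exact: RF_lin.
by apply: RF_hact_prod; [exact: AA | exact: BB].
Qed.

Lemma RF_lowfin A B G : A `<=` EWN W -> B `<=` EWN W -> RF A B G ->
  forall w, lowfin N (G w).
Proof.
move=> hA hB; elim=> [|x G1 G2 _ h1 _ h2|h a b ha hb] w; first exact: lowfin0.
  exact: lowfin_lin.
exact: (lowfin_hact _ (lowfin_prod w (hA _ ha) (hB _ hb))).
Qed.

Lemma RF_hact A B h G : A `<=` EWN W -> B `<=` EWN W -> RF A B G ->
  RF A B (fun w => hact N h (G w)).
Proof.
move=> hA hB; elim=> [|x G1 G2 R1 h1 R2 h2|g a b ha hb].
- have -> : (fun w : W => hact N h ((0 : W -> int -> int -> W) w)) = 0; last exact: RF0.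
  apply/funext => w; apply/funext => m; apply/funext => n.
  by rewrite (hactE (D := 0)) ?big_ord0.
- have -> : (fun w => hact N h ((x *: G1 + G2) w)) =
    x *: (fun w => hact N h (G1 w)) + (fun w => hact N h (G2 w)).
    by apply/funext => w; rewrite -[LHS]/(hact N h (x *: G1 w + G2 w)) hact_lin //;
      exact: RF_lowfin hA hB _ w.
  exact: RF_lin.
have -> : (fun w => hact N h (hact N g (fun m n => b (a w m) n))) =
    (fun w => hact N (cauchy_product h g) (fun m n => b (a w m) n)).
  apply/funext => w; exact: (hact_hact _ _ (lowfin_prod w (hA _ ha) (hB _ hb))).
exact: RF_hact_prod.
Qed.

(* S-locality with the poles of the coefficients f_i(x_2 - x_1) cleared *)
Definition slocal (A B : set field) := forall a b, A a -> B b ->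
  exists k, RF A B (fun w => iter k (rdif N) (prod2 a b w)).

Lemma iter_rdifE k (V : lmodType R[i]) (F : int -> int -> V) :
  iter k (rdif N) F = (-1) ^+ k *: iter k (dif N) F.
Proof.
elim: k => [|k IH]; first by rewrite scale1r.
rewrite !iterS IH rdifE -[_ *: _]addr0 dif_lin exprS mulN1r scaleNr.
by rewrite (_ : dif N 0 = 0) ?addr0 //; apply/funext => m; apply/funext => n; rewrite /dif subr0.
Qed.

Lemma RF_trunc A B G : A `<=` EWN W -> B `<=` EWN W -> RF A B G ->
  forall w, exists L, forall m n, m < L -> G w m n = 0.
Proof.
move=> hA hB; elim=> [|x G1 G2 _ h1 _ h2|h a b ha hb] w.
- by exists 0.
- have [L1 e1] := h1 w; have [L2 e2] := h2 w.
  exists (Order.min L1 L2) => m n; rewrite lt_min => /andP[l1 l2].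
  by rewrite !fctE /= e1 // e2 // scaler0 addr0.
have [L e] := (hA _ ha).2 w; exists L => m n hm.
rewrite (hactE (D := 0)) ?big_ord0 // => i j _.
rewrite e ?(field0 _ (hB _ hb).1) //.
by move: hm; clear; nia.
Qed.

(** In a(x_1) b(x_2) the field b acts first, which bounds the exponents of x_2. In the other order
    the field in x_1 acts first, and a power series in x_2 - x_1 preserves the resulting bound on
    the exponents of x_1. *)
Lemma slocal_compatible A B a b : A `<=` EWN W -> B `<=` EWN W -> slocal A B ->
  A a -> B b -> pair_compatible a b.
Proof.
move=> hA hB hS ha hb; have [k hk] := hS a b ha hb; exists k; split.
  move=> x u v; rewrite !mulx12E (linear_prod2 (hA _ ha).1 (hB _ hb).1).
  exact: iter_dif_lin.
move=> w; rewrite mulx12E.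
have [L1 h1] := RF_trunc hA hB hk w; have [L2 h2] := (hB _ hb).2 w.
exists (Order.min L1 L2) => m n; rewrite !lt_min => /orP[/andP[hm _]|/andP[_ hn]].
  have := h1 m n hm; rewrite iter_rdifE -[LHS]/((-1) ^+ k *: _) => /eqP.
  by rewrite scaler_eq0 signr_eq0 => /eqP.
elim: k {hk h1} m n hn => [|k IH] m n hn.
  by rewrite /= /prod2 h2 // (field0 _ (hA _ ha).1).
rewrite iterS /dif !IH ?subr0 //; lia.
Qed.

End Fields.

(** * Substitutions whose coefficients lie in a given class of series *)

Section ThreeFields.
Variables (R : realType) (N : nat).
Hypothesis hN : (0 < N)%N.
Variable W : lmodType R[i].
Notation field := (W -> int -> W).
Implicit Types (a b c : field) (w : W) (F : W -> int -> int -> int -> W).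

Lemma lowfin_down (F : int -> int -> W) : lowfin N F -> lowfin N (fun m => F (m - N%:Z)).
Proof.
move=> f m n; have [D v] := f (m - N%:Z) n; exists D => i j ij.
by rewrite addrAC; exact: v.
Qed.

Lemma hact_ys_ryt h (F : int -> int -> int -> W) :
  (forall t, lowfin N (fun y s => F y s t)) ->
  hact_ys N h (ryt N F) = ryt N (hact_ys N h F).
Proof.
move=> f; apply/funext => y; apply/funext => s; apply/funext => t.
rewrite /hact_ys.
have f' := lowfin_down (f t).
have := hact_lin h (-1) f' (f (t - N%:Z)).
rewrite !scaleN1r addrC [X in _ = X]addrC => E.
rewrite -[LHS]/(hact N h (_ - (fun y s => F (y - N%:Z) s t)) y s) E.
congr (_ - _).
apply: eq_fsbigr => j _; congr (_ *: _).
elim: j y s => // j IH y s; rewrite !iterS /rdif IH IH.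
by [].
Qed.

Lemma hact_yt_rys h (F : int -> int -> int -> W) :
  (forall s, lowfin N (fun y t => F y s t)) ->
  hact_yt N h (rys N F) = rys N (hact_yt N h F).
Proof.
move=> f; have := @hact_ys_ryt h (fun y s t => F y t s) f => E.
apply/funext => y; apply/funext => s; apply/funext => t.
exact: (congr1 (fun G => G y t s) E).
Qed.

Lemma hact_ys_iter_ryt h l (F : int -> int -> int -> W) :
  (forall t, lowfin N (fun y s => F y s t)) ->
  hact_ys N h (iter l (ryt N) F) = iter l (ryt N) (hact_ys N h F).
Proof.
elim: l F => // l IH F f; rewrite !iterSr IH ?hact_ys_ryt // => t.
have := lowfin_lin (-1) (lowfin_down (f t)) (f (t - N%:Z)).
by rewrite scaleN1r addrC.
Qed.

Lemma hact_yt_iter_rys h l (F : int -> int -> int -> W) :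
  (forall s, lowfin N (fun y t => F y s t)) ->
  hact_yt N h (iter l (rys N) F) = iter l (rys N) (hact_yt N h F).
Proof.
elim: l F => // l IH F f; rewrite !iterSr IH ?hact_yt_rys // => s.
have := lowfin_lin (-1) (lowfin_down (f s)) (f (s - N%:Z)).
by rewrite scaleN1r addrC.
Qed.

Section Substitutable.
(** M will be the class of sums h(x_2 - x_1) b(x_2) a(x_1) in which the coefficients of a locality
    relation are to be found, with the two variables exchanged for products on the left. *)
Variable M : (W -> int -> int -> W) -> Prop.
Hypotheses (M0 : M 0)
  (Mlin : forall x G G', M G -> M G' -> M (x *: G + G'))
  (Mhact : forall h G, M G -> M (fun w => hact N h (G w)))
  (Mlow : forall G, M G -> forall w, lowfin N (G w)).

(* F(y, s, t) admits the substitution s = t + x_0, and all coefficients of the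
   powers of x_0 in the result lie in M. *)
Definition substitutable F := exists Theta, [/\ forall w, utame N (F w),
  forall w, sub3 N (F w) (Theta w),
  exists q0, forall w y q p, q < q0 -> Theta w y q p = 0 &
  forall q, M (fun w y p => Theta w y q p)].

Lemma substitutable0 : substitutable 0.
Proof.
exists 0; split=> //.
- by move=> w; exact: utame0.
- by move=> w; exact: sub3_0.
by exists 0.
Qed.

Lemma substitutable_lin x F G :
  substitutable F -> substitutable G -> substitutable (x *: F + G).
Proof.
move=> [T [u s [q b] m]] [T' [u' s' [q' b'] m']]; exists (x *: T + T'); split.
- by move=> w; exact: utame_lin.
- by move=> w; exact: (sub3_lin hN).
- exists (Order.min q q') => w y r p; rewrite lt_min => /andP[h1 h2].
  by rewrite !fctE /= b // b' // scaler0 addr0.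
by move=> r; exact: (Mlin x (m r) (m' r)).
Qed.

Lemma substitutable_hact_yt h F :
  substitutable F -> substitutable (fun w => hact_yt N h (F w)).
Proof.
move=> [T [u s [q b] m]].
exists (fun w y q p => hact N h (fun y p => T w y q p) y p); split.
- by move=> w; exact: utame_hact_yt.
- move=> w; apply: (sub3_hact_yt hN) => // r; exact: (Mlow (m r) w).
- exists q => w y r p hr; rewrite (hactE (D := 0)) ?big_ord0 // => i j _.
  exact: b.
by move=> r; exact: (Mhact h (m r)).
Qed.

Lemma substitutable_hact_ys h F :
  substitutable F -> substitutable (fun w => hact_ys N h (F w)).
Proof.
move=> [T [u s [q0 b] m]].
pose S q := (absz (q - q0)%R).+1.
have hS q : q - (S q)%:Z < q0 by rewrite /S; clear; lia.
exists (fun w y q p => \sum_(i < S q)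
  hact N (divder h i) (fun y p => T w y (q - i%:Z) p) y p); split.
- by move=> w; exact: utame_hact_ys.
- move=> w; apply: (@sub3_hact_ys _ _ hN _ h _ _ q0 S) => //.
    by move=> r; exact: (Mlow (m r) w).
  by move=> *; exact: b.
- exists q0 => w y q p hq; rewrite big1 // => i _.
  rewrite (hactE (D := 0)) ?big_ord0 // => i' j' _.
  by apply: b; move: hq; clear; lia.
move=> q.
have -> : (fun w y p => \sum_(i < S q)
    hact N (divder h i) (fun y p => T w y (q - i%:Z) p) y p) =
    \sum_(i < S q) (fun w => hact N (divder h i) (fun y p => T w y (q - i%:Z) p)).
  apply/funext => w; apply/funext => y; apply/funext => p.
  by rewrite !fct_sumE.
elim/big_rec: _ => // i G _ mG.
by rewrite -[X in M (X + _)]scale1r; apply: Mlin => //; exact: (Mhact _ (m _)).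
Qed.

Lemma substitutable_iter_ryt l F :
  substitutable F -> substitutable (fun w => iter l (ryt N) (F w)).
Proof.
move=> z; elim: l => // l IH.
have := substitutable_hact_yt (fun j => (j == 1%N)%:R) IH.
have -> // : (fun w => hact_yt N (fun j => (j == 1%N)%:R) (iter l (ryt N) (F w))) =
  fun w => iter l.+1 (ryt N) (F w).
apply/funext => w; apply/funext => y; apply/funext => s; apply/funext => t.
by rewrite /hact_yt hact_X.
Qed.

Lemma substitutable_iter_rys l F :
  substitutable F -> substitutable (fun w => iter l (rys N) (F w)).
Proof.
move=> z; elim: l => // l IH.
have := substitutable_hact_ys (fun j => (j == 1%N)%:R) IH.
have -> // : (fun w => hact_ys N (fun j => (j == 1%N)%:R) (iter l (rys N) (F w))) =
  fun w => iter l.+1 (rys N) (F w).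
apply/funext => w; apply/funext => y; apply/funext => s; apply/funext => t.
by rewrite /hact_ys hact_X.
Qed.

Lemma substitutable_coef F Theta :
  (forall w, sub3 N (F w) (Theta w)) -> substitutable F ->
  forall q, M (fun w y p => Theta w y q p).
Proof.
move=> h [T [_ s _ m]] q; have -> // : Theta = T.
by apply/funext => w; apply/funext => y; exact: (subE_uniq hN (h w y) (s w y)).
Qed.

(* The two operators act on the same arguments, listed as (y, q, p) on the
   left and as (q, w, y, p) on the right. *)
Lemma iter_ryt_shiftq k (Phi : W -> int -> int -> int -> W) w y q p :
  iter k (fun P => ryt N P + shiftq P) (Phi w) y q p =
  iter k (fun Psi q => (fun w => rdif N (Psi q w)) + 1 *: Psi (q - 1))
    (fun q w y p => Phi w y q p) q w y p.
Proof.
elim: k y q p => // k IH y q p; rewrite !iterS.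
by rewrite -[LHS]/(_ - _ + _) /shiftq !IH -[RHS]/(_ - _ + 1 *: _) scale1r.
Qed.

(** The coefficients of (t - y)^l (s - y)^k F after substitution lie in M. There s - y has become (t
    - y) + x_0, and [eventually_unmultiply] with e = 1 removes it from Phi, one coefficient in x_0
    at a time. *)
Lemma substitutable_cancel l k (Phi : W -> int -> int -> int -> W) F q0 :
  (forall w, sub3 N (F w) (Phi w)) ->
  (forall w y q p, q < q0 -> Phi w y q p = 0) ->
  substitutable (fun w => iter l (ryt N) (iter k (rys N) (F w))) ->
  forall q, exists K, M (fun w => iter K (rdif N) (fun y p => Phi w y q p)).
Proof.
move=> s b z q.
pose t (G : W -> int -> int -> W) := fun w => rdif N (G w).
have itert K (G : W -> int -> int -> W) w : iter K t G w = iter K (rdif N) (G w).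
  by elim: K => // K IH; rewrite [RHS]iterS -IH.
have lt : linear t.
  by move=> x G G'; apply/funext => w; exact: rdif_lin.
have Mt G : M G -> M (t G).
  by move=> /(Mhact (fun j => (j == 1%N)%:R)); under eq_fun do rewrite hact_X.
have bP r : r < q0 -> (fun w y p => Phi w y r p) = 0.
  by move=> hr; apply/funext => w; apply/funext => y; apply/funext => p; exact: b.
have [|K hK] := @eventually_unmultiply _ _ t M 1 q0 k l
    (fun q w y p => Phi w y q p) lt M0 Mlin Mt bP _ q; last first.
  exists K; have -> // : (fun w => iter K (rdif N) (fun y p => Phi w y q p)) =
    iter K t (fun w y p => Phi w y q p).
  by apply/funext => w; rewrite itert.
move=> r.
have s' w : sub3 N (iter l (ryt N) (iter k (rys N) (F w)))
    (iter l (ryt N) (iter k (fun P => ryt N P + shiftq P) (Phi w))).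
  elim: l {z} => [|l IH]; last by apply: (sub3_ryt hN).
  by elim: k => [|k IH]; [exact: s | exact: (sub3_rys hN)].
have := substitutable_coef s' z r.
have -> // : (fun w y p => iter l (ryt N) (iter k (fun P => ryt N P + shiftq P)
    (Phi w)) y r p) =
  iter l t (iter k (fun Psi q => t (Psi q) + 1 *: Psi (q - 1))
    (fun q w y p => Phi w y q p) r).
apply/funext => w; apply/funext => y; apply/funext => p.
rewrite itert; elim: l {z s'} y p => [|l IH] y p; first exact: iter_ryt_shiftq.
by rewrite !iterS /ryt /rdif !IH.
Qed.

End Substitutable.

End ThreeFields.

(** * Locality of products *)

Section LocalityOfProducts.
Variables (R : realType) (N : nat).
Hypothesis hN : (0 < N)%N.
Variable W : lmodType R[i].
Notation field := (W -> int -> W).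
Implicit Types (a b c : field) (w : W) (F : W -> int -> int -> int -> W).

Section Right.
Variables A B B' : set field.
Hypotheses (hA : A `<=` EWN W) (hB : B `<=` EWN W) (hB' : B' `<=` EWN W)
  (cB : forall b c, B b -> B c -> pair_compatible N b c)
  (YB : forall b c q, B b -> B c -> B' (YE N b c q))
  (sAB : slocal N A B).

Let M := RF N A B'.
Let Mlin := @RF_lin R N W A B'.
Let Mhact h G (HG : M G) := RF_hact hN h hA hB' HG.
Let Mlow G (HG : M G) := RF_lowfin hN hA hB' HG.

(** b(s) c(t) is applied to the coefficients of a(y) w. The pole order of the pair b, c is the same
    for all vectors; the truncation bound is not, but only finitely many translates y - N i give a
    nonzero vector. *)
Lemma substitutable_prod_right a b c : A a -> B b -> B c ->
  substitutable N M (fun w y s t => b (c (a w y) t) s).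
Proof.
move=> ha hb hc; exists (fun w y q p => YE N b c q (a w y) p); split.
- move=> w; split=> [|y].
    exact: (lowfin3_prod_yts hN w (hA ha) (hB hb) (hB hc)).
  have [k h] := YE_spec (cB hb hc).
  have [I0 hI] := field_down hN w y (hA ha).
  have [||L hL] := @common_lower_bound 'I_I0 (fun i L =>
      tr2 L (iter k (dif N) (prod2 b c (a w (y - N%:Z * i%:Z))))).
  + by move=> i L L' LL; exact: tr2_le.
  + by move=> i; exact: (h _).1.
  exists k, L => i; have [/hI z|hi] := leqP I0 i; last exact: (hL (Ordinal hi)).
  have e0 : (fun s t => b (c 0 t) s) = 0 := lin0 (linear_prod2 (hB hb).1 (hB hc).1).
  rewrite z e0 => m n _.
  elim: k {h hL} m n => // k IH m n.
  by rewrite iterS /dif !IH subr0.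
- by move=> w y; exact: (subE_YE (a w y) (cB hb hc)).
- have [q0 h] := YE_bounded hN (cB hb hc); exists q0 => w y q p hq.
  by rewrite h.
by move=> q; exact: (RF_prod N ha (YB q hb hc)).
Qed.

Lemma substitutable_RF_right b G : B b -> RF N A B G ->
  substitutable N M (fun w y s t => b (G w y t) s).
Proof.
move=> hb; have lb s := lin_at s (hB hb).1.
elim=> [|x G1 G2 _ h1 _ h2|h a c ha hc].
- have -> : (fun (w : W) (y s t : int) => b ((0 : W -> int -> int -> W) w y t) s) = 0.
    by do 4!apply/funext => ?; rewrite (lin0 (lb _)).
  exact/substitutable0/RF0.
- have -> : (fun w y s t => b ((x *: G1 + G2) w y t) s) =
    x *: (fun w y s t => b (G1 w y t) s) + (fun w y s t => b (G2 w y t) s).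
    by do 4!apply/funext => ?; exact: lb.
  exact: (substitutable_lin hN Mlin).
have -> : (fun w y s t => b (hact N h (fun m n => c (a w m) n) y t) s) =
    (fun w => hact_yt N h (fun y s t => b (c (a w y) t) s)).
  do 4!apply/funext => ?; rewrite /hact_yt (hact_map _ (lb _)) //.
  exact: (lowfin_prod hN _ (hA ha) (hB hc)).
exact: (substitutable_hact_yt hN Mhact Mlow h (substitutable_prod_right ha hb hc)).
Qed.

(** In h(s - y) b(s) a(y) c(t), a power of t - y lets a(y) pass c(t). This leaves terms h(s - y) g(t
    - y) b(s) c'(t) a'(y), where b and c' are adjacent and s = t + x_0 produces their products. *)
Lemma substitutable_mul_right c G : B c -> RF N A B G ->
  exists l, substitutable N M (fun w => iter l (ryt N) (fun y s t => G (c w t) y s)).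
Proof.
move=> hc; elim=> [|x G1 G2 R1 [l1 h1] R2 [l2 h2]|h a b ha hb].
- exists 0%N; rewrite (_ : (fun w => _) = 0) //.
  exact/substitutable0/RF0.
- exists (l1 + l2)%N.
  have := substitutable_lin hN Mlin x
    (substitutable_iter_ryt hN Mhact Mlow l2 h1) (substitutable_iter_ryt hN Mhact Mlow l1 h2).
  congr substitutable; apply/funext => w.
  rewrite -[LHS]/(x *: iter l2 _ _ + iter l1 _ _) -!iterD [(l2 + l1)%N]addnC.
  do 3!apply/funext => ?; rewrite !fctE /= !iter_ryt.
  by rewrite -[RHS]/(iter _ _ (x *: (fun y t => _) + (fun y t => _)) _ _) iter_rdif_lin.
have [l hl] := sAB ha hc; exists l.
have := substitutable_hact_ys hN (RF0 _ _ _) Mlin Mhact Mlow h (substitutable_RF_right hb hl).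
congr substitutable; apply/funext => w.
have -> : (fun y s t => b (iter l (rdif N) (prod2 a c w) y t) s) =
    iter l (ryt N) (fun y s t => b (a (c w t) y) s).
  apply/funext => y; apply/funext => s; apply/funext => t.
  rewrite iter_ryt (@iter_rdif_map _ _ _ _ (fun v => b v s)) //.
  exact: (lin_at s (hB hb).1).
rewrite hact_ys_iter_ryt // => t.
exact: (lowfin_prod hN _ (hA ha) (hB hb)).
Qed.

(** The substitution s = t + x_0 in a(y) b(s) c(t) has the coefficients a(y) (b_n c)(t). Moving a(y)
    to the right, past b(s) and then past c(t), costs (s - y)^k and (t - y)^l. *)
Lemma slocal_YE_right a b c q : A a -> B b -> B c ->
  exists k, RF N A B' (fun w => iter k (rdif N) (prod2 a (YE N b c q) w)).
Proof.
move=> ha hb hc; have [k hk] := sAB ha hb.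
have [l hl] := substitutable_mul_right hc hk.
have [q0 hq0] := YE_bounded hN (cB hb hc).
apply: (@substitutable_cancel _ _ hN _ M (RF0 _ _ _) Mlin Mhact l k
  (fun w y q p => a (YE N b c q w p) y) (fun w y s t => a (b (c w t) s) y) q0).
- move=> w y; exact: (subE_map (lin_at y (hA ha).1) (subE_YE w (cB hb hc))).
- by move=> w y r p hr; rewrite hq0 // (lin0 (lin_at _ (hA ha).1)).
move: hl; congr substitutable; apply/funext => w; congr (iter _ _ _).
by do 3!apply/funext => ?; rewrite iter_rys.
Qed.

End Right.

Lemma utame_prod a b c w : EWN W a -> EWN W b -> EWN W c -> pair_compatible N a b ->
  utame N (fun y s t => c (a (b w t) s) y).
Proof.
move=> ha hb hc cab; split=> [|y]; first exact: (lowfin3_prod_tsy hN w ha hb hc).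
have [k /(_ w)[[L t] _]] := YE_spec cab; exists k, L => i.
rewrite (@iter_dif_map _ _ _ _ (fun v => c v _) k (prod2 a b w)); last exact: (lin_at _ hc.1).
by move=> m n mn; rewrite t // (field0 _ hc.1).
Qed.

Section Left.
Variables A B A' : set field.
Hypotheses (hA : A `<=` EWN W) (hB : B `<=` EWN W) (hA' : A' `<=` EWN W)
  (cA : forall a b, A a -> A b -> pair_compatible N a b)
  (YA : forall a b q, A a -> A b -> A' (YE N a b q))
  (sAB : slocal N A B).

(** The parameter y of the substitution is now the variable of the field from B, which [RF] lists
    second; hence the exchanged arguments. *)
Let M (G : W -> int -> int -> W) := RF N A' B (fun w m n => G w n m).

Let M0 : M 0. Proof. exact: RF0. Qed.

Let Mlin x G G' : M G -> M G' -> M (x *: G + G').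
Proof. exact: RF_lin. Qed.

Let Mhact h G : M G -> M (fun w => hact N h (G w)).
Proof.
move=> /(RF_hact hN (fun j => h j * (-1) ^+ j) hA' hB).
congr RF; do 3!apply/funext => ?.
by rewrite [RHS](hact_swap N h (fun m n => G _ n m)).
Qed.

Let Mlow G : M G -> forall w, lowfin N (G w).
Proof.
move=> hG w m n; have [D v] := RF_lowfin hN hA' hB hG w n m.
by exists D => i j ij; apply: v; rewrite addnC.
Qed.

Lemma substitutable_prod_left a b c : A a -> A b -> B c ->
  substitutable N M (fun w y s t => c (a (b w t) s) y).
Proof.
move=> ha hb hc; have lc y := lin_at y (hB hc).1.
exists (fun w y q p => c (YE N a b q w p) y); split.
- by move=> w; exact: (utame_prod w (hA ha) (hA hb) (hB hc) (cA ha hb)).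
- by move=> w y; exact: (subE_map (lc y) (subE_YE w (cA ha hb))).
- have [q0 h] := YE_bounded hN (cA ha hb); exists q0 => w y q p hq.
  by rewrite h // (lin0 (lc _)).
by move=> q; exact: (RF_prod N (YA q ha hb) hc).
Qed.

Lemma substitutable_RF_left b G : A b -> RF N A B G ->
  substitutable N M (fun w y s t => G (b w t) s y).
Proof.
move=> hb; elim=> [|x G1 G2 _ h1 _ h2|h a c ha hc].
- exact: substitutable0.
- exact: (substitutable_lin hN Mlin x h1 h2).
have := substitutable_hact_ys hN M0 Mlin Mhact Mlow
  (fun j => h j * (-1) ^+ j) (substitutable_prod_left ha hb hc).
congr substitutable; do 4!apply/funext => ?.
rewrite /hact_ys [RHS](hact_swap N h (fun n m => c (a (b _ _) m) n)).
by [].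
Qed.

Lemma substitutable_mul_left a G : A a -> RF N A B G ->
  exists l, substitutable N M (fun w => iter l (rys N) (fun y s t => a (G w t y) s)).
Proof.
move=> ha; have la s := lin_at s (hA ha).1.
elim=> [|x G1 G2 R1 [l1 h1] R2 [l2 h2]|h b c hb hc].
- exists 0%N; rewrite (_ : (fun w => _) = 0); first exact: substitutable0.
  by do 4!apply/funext => ?; rewrite /= (lin0 (la _)).
- exists (l1 + l2)%N.
  have := substitutable_lin hN Mlin x
    (substitutable_iter_rys hN M0 Mlin Mhact Mlow l2 h1)
    (substitutable_iter_rys hN M0 Mlin Mhact Mlow l1 h2).
  congr substitutable; apply/funext => w.
  rewrite -[LHS]/(x *: iter l2 _ _ + iter l1 _ _) -!iterD [(l2 + l1)%N]addnC.
  apply/funext => y; apply/funext => s; apply/funext => t.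
  rewrite !fctE /= !iter_rys.
  have -> : (fun y s => a ((x *: G1 + G2) w t y) s) =
      x *: (fun y s => a (G1 w t y) s) + (fun y s => a (G2 w t y) s).
    by apply/funext => ?; apply/funext => ?; exact: la.
  by rewrite iter_rdif_lin.
have [l hl] := sAB ha hc; exists l.
have := substitutable_hact_yt hN Mhact Mlow (fun j => h j * (-1) ^+ j)
  (substitutable_RF_left hb hl).
move=> z; have := substitutable_lin hN Mlin ((-1) ^+ l) z (substitutable0 N M0); move: z => _.
rewrite addr0; congr substitutable; apply/funext => w.
have lowF s : lowfin N (fun y t => a (c (b w t) y) s).
  move=> y t; have [D v] := lowfin_prod hN w (hA hb) (hB hc) t y.
  by exists D => i j ij; rewrite v ?(lin0 (la s)) // addnC.
have -> : (fun y s t => a (hact N h (fun m n => c (b w m) n) t y) s) =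
    hact_yt N (fun j => h j * (-1) ^+ j) (fun y s t => a (c (b w t) y) s).
  apply/funext => y; apply/funext => s; apply/funext => t.
  rewrite (hact_swap N h (fun y t => c (b w t) y)).
  have low : lowfin N (fun y t => c (b w t) y).
    move=> m n; have [D v] := lowfin_prod hN w (hA hb) (hB hc) n m.
    by exists D => i j ij; apply: v; rewrite addnC.
  exact: (esym (congr1 (fun f => f y t) (hact_map _ (la s) low))).
rewrite -hact_yt_iter_rys //.
have -> : iter l (rys N) (fun y s t => a (c (b w t) y) s) =
    (-1) ^+ l *: (fun y s t => iter l (rdif N) (prod2 a c (b w t)) s y).
  apply/funext => y; apply/funext => s; apply/funext => t.
  by rewrite iter_rys (@iter_rdif_swap _ _ _ l (prod2 a c (b w t))).
apply/funext => y; apply/funext => s; apply/funext => t.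
rewrite -[LHS]/((-1) ^+ l *: hact N _ (fun y t => iter l (rdif N) (prod2 a c (b w t)) s y) y t).
have lowG : lowfin N (fun y t => iter l (rdif N) (prod2 a c (b w t)) s y).
  by have [T [tm _ _ _]] := substitutable_RF_left hb hl; exact: (lowfin3_yt s (tm w).1).
exact: (esym (congr1 (fun f => f y t) (hactZ _ ((-1) ^+ l) lowG))).
Qed.

(** In a(s) b(t) c(y) the field c(y) is moved to the left, past b(t) and then past a(s). The factor
    (t - y)^k does not involve s, so it survives the substitution unchanged and stays in the
    conclusion; only (s - y)^l has to be removed. *)
Lemma slocal_YE_left a b c q : A a -> A b -> B c ->
  exists k, RF N A' B (fun w => iter k (rdif N) (prod2 (YE N a b q) c w)).
Proof.
move=> ha hb hc; have [k hk] := sAB hb hc.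
have [l hl] := substitutable_mul_left ha hk.
have [q0 hq0] := YE_bounded hN (cA ha hb).
pose F w y s t := a (b (c w y) t) s.
pose Phi w y q p := YE N a b q (c w y) p.
have sF w : sub3 N (iter k (ryt N) (F w)) (iter k (ryt N) (Phi w)).
  elim: k {hk hl} => [y|k IH]; first exact: (subE_YE (c w y) (cA ha hb)).
  exact: (sub3_ryt hN).
have bPhi k' w y r p : r < q0 -> iter k' (ryt N) (Phi w) y r p = 0.
  move=> hr; elim: k' y p => [|k' IH] y p; first by rewrite /= /Phi hq0.
  by rewrite iterS /ryt !IH subr0.
have la s := lin_at s (hA ha).1.
have zF : substitutable N M (fun w => iter 0 (ryt N) (iter l (rys N) (iter k (ryt N) (F w)))).
  have := substitutable_lin hN Mlin ((-1) ^+ k) hl (substitutable0 N M0).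
  rewrite addr0; congr substitutable; apply/funext => w.
  apply/funext => y; apply/funext => s; apply/funext => t.
  rewrite -[LHS]/((-1) ^+ k *: iter l (rys N) _ y s t) !iter_rys.
  have -> : (fun y s => a (iter k (rdif N) (prod2 b c w) t y) s) =
      (-1) ^+ k *: (fun y s => iter k (ryt N) (F w) y s t).
    apply/funext => y'; apply/funext => s'.
    rewrite -[RHS]/((-1) ^+ k *: iter k (ryt N) (F w) y' s' t) iter_ryt /F.
    rewrite (@iter_rdif_map _ _ _ _ (fun v => a v s') k (fun y t => b (c w y) t)) //.
    rewrite -(linZ (la s')); congr (a _ _).
    exact: (@iter_rdif_swap _ _ _ k (fun y t => b (c w y) t)).
  rewrite iter_rdifZ -[X in _ *: X = _]/((-1) ^+ k *: iter l _ _ y s).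
  rewrite scalerA -expr2 sqrr_sign scale1r.
  by rewrite -iter_rys.
have [K] := @substitutable_cancel _ _ hN _ M M0 Mlin Mhact 0 l
  (fun w => iter k (ryt N) (Phi w)) (fun w => iter k (ryt N) (F w)) q0 sF (bPhi k) zF q.
move=> hK; exists (K + k)%N.
have := RF_lin ((-1) ^+ (K + k)) hK (RF0 N A' B).
rewrite addr0; congr RF; apply/funext => w.
apply/funext => m; apply/funext => n.
rewrite -[LHS]/((-1) ^+ (K + k) *: iter K (rdif N) _ n m).
rewrite (@iter_rdif_swap _ _ _ _ (fun n m => prod2 (YE N a b q) c w m n)).
congr (_ *: _); rewrite iterD; congr (iter _ _ _ _ _).
by apply/funext => y; apply/funext => p; rewrite iter_ryt.
Qed.

End Left.

End LocalityOfProducts.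

(** * Clearing poles *)

Section ClearingPoles.
Variables (R : realType) (N : nat).
Hypothesis hN : (0 < N)%N.
Variable V : lmodType R[i].
Implicit Types (f : int -> R[i]) (F : int -> int -> V) (m n : int).

(* f(x_2 - x_1) F as in mul_f21, for a fixed vector *)
Definition act_diff f F : int -> int -> V := fun m n =>
  \sum_(t \in [set: nat * int])
    (f (t.2 + t.1%:Z) * cbinom (t.2 + t.1%:Z)%:~R t.1 * (-1) ^+ t.1) *:
      F (m - N%:Z * t.1%:Z) (n - N%:Z * t.2).

(** The terms of [act_diff] in which f contributes x_1^i. As F is truncated in x_1, finitely many
    slices make up a coefficient. *)
Definition slice f F (i : nat) m n : V :=
  \sum_(t \in [set: int])
    (f (t + i%:Z) * cbinom (t + i%:Z)%:~R i * (-1) ^+ i) *: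
      F (m - N%:Z * i%:Z) (n - N%:Z * t).

Definition vanishes_below (l0 : int) f := forall l, l < l0 -> f l = 0.

Lemma slice_window l0 f F i m n : vanishes_below l0 f -> lowfin N F ->
  exists D, forall t, (t < l0 - i%:Z) || (l0 - i%:Z + D%:Z <= t) ->
    (f (t + i%:Z) * cbinom (t + i%:Z)%:~R i * (-1) ^+ i) *:
      F (m - N%:Z * i%:Z) (n - N%:Z * t) = 0.
Proof.
move=> hf hF; have [D v] := hF m (n - N%:Z * (l0 - i%:Z)); exists D => t.
case/orP => ht.
  by rewrite hf ?mul0r ?scale0r //; move: ht; clear; lia.
have := v i (absz (t - (l0 - i%:Z))%R).
have -> : n - N%:Z * (l0 - i%:Z) - N%:Z * (absz (t - (l0 - i%:Z))%R)%:Z =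
    n - N%:Z * t.
  have -> : (absz (t - (l0 - i%:Z))%R)%:Z = t - (l0 - i%:Z).
    by move: ht; clear; lia.
  by ring.
by move=> -> //; [rewrite scaler0 | move: ht; clear; lia].
Qed.

Lemma slice_fins l0 f F i m n : vanishes_below l0 f -> lowfin N F ->
  fins (fun t => (f (t + i%:Z) * cbinom (t + i%:Z)%:~R i * (-1) ^+ i) *:
      F (m - N%:Z * i%:Z) (n - N%:Z * t)).
Proof.
move=> hf hF; have [D h] := slice_window i m n hf hF.
apply: (@fins_window _ _ (l0 - i%:Z) (l0 - i%:Z + D%:Z)) => t.
by case/orP => ht; apply: h; rewrite ?ht // (ltW ht) orbT.
Qed.

Lemma act_diff_slices l0 L f F m n : vanishes_below l0 f -> lowfin N F ->
  (forall m n, m < L -> F m n = 0) ->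
  exists I0, forall I, (I0 <= I)%N -> act_diff f F m n = \sum_(i < I) slice f F i m n.
Proof.
move=> hf hF hL; pose I0 := (absz (m - L)%R).+1.
have hI i t c : (I0 <= i)%N -> c *: F (m - N%:Z * i%:Z) t = 0.
  by move=> hi; rewrite hL ?scaler0 //; move: hi hN; rewrite /I0; clear; nia.
have [i hi|D hD] := @exists_uniform_bound I0 (fun i D => forall t,
    (t < l0 - i%:Z) || (l0 - i%:Z + D%:Z <= t) ->
    (f (t + i%:Z) * cbinom (t + i%:Z)%:~R i * (-1) ^+ i) *:
      F (m - N%:Z * i%:Z) (n - N%:Z * t) = 0).
  have [D h] := slice_window i m n hf hF; exists D => D' DD' t ht.
  by apply: h; move: ht DD'; clear; lia.
have hz i t : (t < l0 - I0%:Z) || (l0 + D%:Z <= t) ->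
    (f (t + i%:Z) * cbinom (t + i%:Z)%:~R i * (-1) ^+ i) *:
      F (m - N%:Z * i%:Z) (n - N%:Z * t) = 0.
  move=> ht; have [hi|hi] := leqP I0 i; first exact: hI.
  by apply: (hD i D) => //; move: ht hi; clear; lia.
exists I0 => I hII.
pose r := [seq (i, l0 - I0%:Z + j%:Z) | i <- iota 0 I, j <- iota 0 (I0 + D)].
rewrite /act_diff (@fsum_seq _ _ r).
- rewrite /r big_allpairs_dep sum_iota; apply: eq_bigr => i _; rewrite sum_iota.
  rewrite /slice (@fsum_window _ _ (l0 - I0%:Z) (I0 + D)) // => t ht.
  by apply: hz; move: ht; clear; lia.
- apply: allpairs_uniq; rewrite ?iota_uniq // => -[i j] [i' j'] _ _ /= e.
  have := congr1 snd e; have /= -> := congr1 fst e => /= /addrI; by case=> ->.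
move=> [i t] hit /=; have [hi|hi] := leqP I i; first exact: (hI _ _ _ (leq_trans hII hi)).
apply: hz; apply: contraNT hit; rewrite negb_or -!leNgt -ltNge => /andP[h1 h2].
apply/allpairsP; exists (i, absz (t - (l0 - I0%:Z))%R); split; rewrite ?mem_iota /=.
- by move: hi; clear; lia.
- by move: h1 h2; clear; lia.
by congr (_, _); move: h1; clear; lia.
Qed.

Lemma slice_X0 f F m n : slice (fun l => f (l - 1)) F 0 m n = slice f F 0 m (n - N%:Z).
Proof.
rewrite /slice -[RHS](fsum_shift _ (-1)); apply: eq_fsbigr => t _.
rewrite !cbinom0; congr (f _ * _ * _ *: F _ _); clear; lia.
Qed.

Lemma slice_XS l0 f F i m n : vanishes_below l0 f -> lowfin N F ->
  slice (fun l => f (l - 1)) F i.+1 m n =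
  slice f F i.+1 m (n - N%:Z) - slice f F i (m - N%:Z) n.
Proof.
move=> hf hF; have -> : slice f F i.+1 m (n - N%:Z) = \sum_(t \in [set: int])
    (f (t - 1 + i.+1%:Z) * cbinom (t - 1 + i.+1%:Z)%:~R i.+1 * (-1) ^+ i.+1) *:
      F (m - N%:Z * i.+1%:Z) (n - N%:Z - N%:Z * (t - 1)).
  by rewrite /slice -[LHS](fsum_shift _ (-1)).
rewrite /slice.
rewrite -scaleN1r -(fsum_lin (f := fun v => -1 *: v)); last first.
- exact: slice_fins hf hF.
- by move=> a u v; rewrite scalerDr !scalerA mulrC.
rewrite -fsumD; last first.
- have [r h] := slice_fins i (m - N%:Z) n hf hF.
  by exists r => t /h ->; rewrite scaler0.
- have [r h] := slice_fins i.+1 m (n - N%:Z) hf hF.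
  exists [seq t + 1 | t <- r] => t ht; apply: h.
  apply: contra ht => ht; apply/mapP; exists (t - 1) => //; clear; lia.
apply: eq_fsbigr => t _; rewrite scalerA mulN1r.
have -> : n - N%:Z - N%:Z * (t - 1) = n - N%:Z * t by clear; lia.
have -> : m - N%:Z - N%:Z * i%:Z = m - N%:Z * i.+1%:Z by clear; lia.
rewrite -scalerDl; congr (_ *: _).
have -> : t - 1 + i.+1%:Z = t + i%:Z by clear; lia.
have -> : t + i.+1%:Z - 1 = t + i%:Z by clear; lia.
have -> : t + i.+1%:Z = t + i%:Z + 1 by clear; lia.
rewrite intrD cbinom_pascal exprS; ring.
Qed.

(** Pascal's rule, slice by slice: (x_2 - x_1) f(x_2 - x_1) is the series x f(x) at x = x_2 -
    x_1. *)
Lemma rdif_act_diff l0 L f F : vanishes_below l0 f -> lowfin N F ->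
  (forall m n, m < L -> F m n = 0) ->
  rdif N (act_diff f F) = act_diff (fun l => f (l - 1)) F.
Proof.
move=> hf hF hL; apply/funext => m; apply/funext => n.
have hf' : vanishes_below (l0 + 1) (fun l => f (l - 1)).
  by move=> l hl; apply: hf; move: hl; clear; lia.
have [I1 h1] := act_diff_slices m n hf' hF hL.
have [I2 h2] := act_diff_slices m (n - N%:Z) hf hF hL.
have [I3 h3] := act_diff_slices (m - N%:Z) n hf hF hL.
pose I := (I1 + I2 + I3)%N.
rewrite (h1 I.+1) ?(h2 I.+1) /rdif ?(h3 I); try by rewrite /I; clear; lia.
rewrite (h2 I.+1); last by rewrite /I; clear; lia.
rewrite big_ord_recl [RHS]big_ord_recl slice_X0 -addrA; congr (_ + _).
rewrite -sumrB; apply: eq_bigr => i _.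
by rewrite lift0 (slice_XS _ _ _ hf hF).
Qed.

Lemma iter_rdif_act_diff l0 L k f F : vanishes_below l0 f -> lowfin N F ->
  (forall m n, m < L -> F m n = 0) ->
  iter k (rdif N) (act_diff f F) = act_diff (fun l => f (l - k%:Z)) F.
Proof.
move=> hf hF hL; elim: k => [|k IH].
  by congr act_diff; apply/funext => l; rewrite subr0.
have hf' : vanishes_below (l0 + k%:Z) (fun l => f (l - k%:Z)).
  by move=> l hl; apply: hf; move: hl; clear; lia.
rewrite iterS IH (rdif_act_diff hf' hF hL); congr act_diff; apply/funext => l.
by congr f; clear; lia.
Qed.

Lemma act_diff_lin l0 L x f g F : vanishes_below l0 f -> vanishes_below l0 g ->
  lowfin N F -> (forall m n, m < L -> F m n = 0) ->
  act_diff (fun l => x * f l + g l) F = x *: act_diff f F + act_diff g F.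
Proof.
move=> hf hg hF hL; apply/funext => m; apply/funext => n.
have hfg : vanishes_below l0 (fun l => x * f l + g l).
  by move=> l hl; rewrite hf ?hg ?mulr0 ?addr0.
have [I1 h1] := act_diff_slices m n hfg hF hL.
have [I2 h2] := act_diff_slices m n hf hF hL.
have [I3 h3] := act_diff_slices m n hg hF hL.
pose I := (I1 + I2 + I3)%N.
rewrite -[RHS]/(x *: act_diff f F m n + act_diff g F m n).
rewrite (h1 I) ?(h2 I) ?(h3 I); try by rewrite /I; clear; lia.
rewrite scaler_sumr -big_split /=; apply: eq_bigr => i _.
rewrite /slice -(fsum_lin (f := fun v => x *: v)); last first.
- exact: slice_fins hf hF.
- by move=> a u v; rewrite scalerDr !scalerA mulrC.
rewrite -fsumD; last first.
- exact: slice_fins hg hF.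
- have [r h] := slice_fins i m n hf hF.
  by exists r => t /h ->; rewrite scaler0.
apply: eq_fsbigr => t _; rewrite scalerA -scalerDl; congr (_ *: _); ring.
Qed.

Lemma act_diff_1 F : act_diff (fun l => (l == 0)%:R) F = F.
Proof.
apply/funext => m; apply/funext => n.
rewrite /act_diff (@fsum_seq _ _ [:: (0%N, 0)]) //.
  by rewrite big_seq1 /= addr0 cbinom0 ?eqxx !mulr1 scale1r !mulr0 !subr0.
move=> [i t] /=; rewrite inE xpair_eqE negb_and.
have [e|] := eqVneq (t + i%:Z) 0; last by rewrite !mul0r scale0r.
case: i e => [|i] e; first by move: e; rewrite addr0 => ->; rewrite eqxx.
by rewrite e /cbinom big_ord_recl subr0 !mul0r mulr0 mul0r scale0r.
Qed.

Lemma act_diff_tail L F m n : lowfin N F -> (forall m n, m < L -> F m n = 0) ->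
  exists M0, forall M (f : int -> R[i]), (M0 <= M)%N -> vanishes_below M%:Z f ->
    act_diff f F m n = 0.
Proof.
move=> hF hL; pose I0 := (absz (m - L)%R).+1.
(* The exponent t of x_2 in f may be negative, but t + i >= M and i < I0. Seen from a point I0 steps
   higher, n - N t is reached by t + I0 steps, a natural number that is at least D. *)
have [D v] := hF m (n + N%:Z * I0%:Z); exists D => M f hM hf.
rewrite /act_diff fsbig1 // => -[i t] _ /=.
have [hi|hi] := leqP I0 i.
  by rewrite hL ?scaler0 //; move: hi hN; rewrite /I0; clear; nia.
have [ht|ht] := ltP (t + i%:Z) M%:Z; first by rewrite hf ?mul0r ?scale0r.
have := v i (absz (t + I0%:Z)%R).
have -> : (absz (t + I0%:Z)%R)%:Z = t + I0%:Z by move: ht hi; clear; lia.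
have -> : n + N%:Z * I0%:Z - N%:Z * (t + I0%:Z) = n - N%:Z * t by ring.
by move=> -> //; [rewrite scaler0 | move: ht hi hM; clear; lia].
Qed.

(** For a given coefficient f is split into a polynomial and a tail of order M. A tail of high order
    does not reach the coefficient, and the monomials come from the constant series 1 by
    [iter_rdif_act_diff]. *)
Lemma act_diff_hact L (f : int -> R[i]) F : vanishes_below 0 f -> lowfin N F ->
  (forall m n, m < L -> F m n = 0) ->
  act_diff f F = hact N (fun j => f j%:Z) F.
Proof.
move=> hf hF hL; apply/funext => m; apply/funext => n.
apply: evto_uniq (hact_evto _ m n hF).
have [M0 hM0] := act_diff_tail m n hF hL; exists M0 => M hM.
pose tl := fun l : int => if l < M%:Z then 0 else f l.
have v1 : vanishes_below 0 (fun l : int => (l == 0)%:R : R[i]).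
  by move=> l; case: eqP => // ->; rewrite ltxx.
have htl : vanishes_below M%:Z tl by move=> l; rewrite /tl => ->.
have htl0 : vanishes_below 0 tl by move=> l hl; rewrite /tl hf // if_same.
have S M' : act_diff (fun l => \sum_(j < M') f j%:Z * (l == j%:Z)%:R) F =
    \sum_(j < M') f j%:Z *: iter j (rdif N) F.
  elim: M' => [|M' IH].
    rewrite big_ord0; apply/funext => m'; apply/funext => n'.
    by rewrite /act_diff fsbig1 // => t _; rewrite big_ord0 !mul0r scale0r.
  rewrite big_ord_recr /= -IH addrC.
  have E := iter_rdif_act_diff M' v1 hF hL; rewrite act_diff_1 in E.
  rewrite E -(act_diff_lin _ (l0 := 0) (L := L)) //.
  - congr act_diff; apply/funext => l; rewrite big_ord_recr /= addrC.
    by rewrite subr_eq0.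
  - move=> l hl; rewrite subr_eq0; case: eqP => // e.
    by exfalso; move: hl; rewrite e; clear.
  move=> l hl; rewrite big1 // => j _; case: eqP => [e|]; last by rewrite mulr0.
  by exfalso; move: hl; rewrite e; clear.
have vS : vanishes_below 0 (fun l => \sum_(j < M) f j%:Z * (l == j%:Z)%:R).
  move=> l hl; rewrite big1 // => j _; case: eqP => [e|]; last by rewrite mulr0.
  by exfalso; move: hl; rewrite e; clear.
have fE : f = fun l => 1 * (\sum_(j < M) f j%:Z * (l == j%:Z)%:R) + tl l.
  apply/funext => l; rewrite mul1r /tl; case: ltP => hl; last first.
    rewrite big1 ?add0r // => j _; case: eqP => [e|_]; last by rewrite mulr0.
    by exfalso; move: hl (ltn_ord j); rewrite e; clear; lia.
  rewrite addr0; case: l hl => [l|l] hl; last first.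
    by rewrite hf // big1 // => j _; rewrite mulr0.
  rewrite (bigD1 (Ordinal (hl : (l < M)%N))) //= eqxx mulr1 big1 ?addr0 // => j.
  rewrite -val_eqE /= eq_sym => /negbTE hj.
  by rewrite eqz_nat hj mulr0.
rewrite [in RHS]fE (act_diff_lin _ vS htl0 hF hL) scale1r S.
rewrite -[RHS]/((\sum_(j < M) f j%:Z *: iter j (rdif N) F) m n + act_diff tl F m n).
by rewrite (hM0 M tl) // addr0 !fct_sumE.
Qed.

End ClearingPoles.

(** * Spans and levels of iterated products *)

Section Generation.
Variables (R : realType) (N : nat).
Hypothesis hN : (0 < N)%N.
Variable W : lmodType R[i].
Notation field := (W -> int -> W).
Implicit Types (a b c : field) (w : W) (A B S X : set field).

Lemma RFD A B G G' : RF N A B G -> RF N A B G' -> RF N A B (G + G').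
Proof. by move=> h h'; rewrite -[G]scale1r; exact: RF_lin. Qed.

Lemma RF_sum A B (r : nat) (G : 'I_r -> W -> int -> int -> W) :
  (forall i, RF N A B (G i)) -> RF N A B (\sum_(i < r) G i).
Proof.
move=> h; elim/big_rec: _ => [|i x _]; first exact: RF0.
exact: RFD.
Qed.

Lemma RF_iter_rdif A B k G : A `<=` EWN W -> B `<=` EWN W -> RF N A B G ->
  RF N A B (fun w => iter k (rdif N) (G w)).
Proof.
move=> hA hB hG; elim: k => // k IH.
have := RF_hact hN (fun j => (j == 1%N)%:R) hA hB IH.
by under eq_fun do rewrite hact_X.
Qed.

Lemma EWN0 : EWN W 0.
Proof.
split=> [x u v|w]; last by exists 0.
by apply/funext => m; rewrite !fctE /= scaler0 addr0.
Qed.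

Lemma EWN_lin x a b : EWN W a -> EWN W b -> EWN W (x *: a + b).
Proof.
move=> [la fa] [lb fb]; split=> [y u v|w].
  apply/funext => m; rewrite !fctE /= la lb !fctE /=.
  by rewrite !scalerDr !scalerA addrACA mulrC.
have [L h] := fa w; have [L' h'] := fb w; exists (Order.min L L') => m.
by rewrite lt_min => /andP[l1 l2]; rewrite !fctE /= h // h' // scaler0 addr0.
Qed.

Lemma EWN_idser : EWN W (idser W).
Proof.
split=> [x u v|w]; last by exists 0 => m; rewrite /idser; case: eqP => // ->; rewrite ltxx.
by apply/funext => m; rewrite /idser !fctE /=; case: ifP => // _; rewrite scaler0 addr0.
Qed.

Inductive spn S : set field :=
| spn_in a : S a -> spn S a
| spn0 : spn S 0
| spn_lin x a b : spn S a -> spn S b -> spn S (x *: a + b).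

Lemma spn_sum S (r : nat) (h : 'I_r -> field) :
  (forall i, spn S (h i)) -> spn S (\sum_(i < r) h i).
Proof.
move=> H; elim/big_rec: _ => [|i x _ hx]; first exact: spn0.
by rewrite -[h i]scale1r; exact: spn_lin.
Qed.

Lemma spn_sub S X : is_subspace X -> S `<=` X -> spn S `<=` X.
Proof. by move=> [X0 Xl] SX a; elim=> [b /SX //||x b c _ hb _ hc]; [exact: X0|exact: Xl]. Qed.

Lemma EWN_spn S : S `<=` EWN W -> spn S `<=` EWN W.
Proof. by move=> h; apply: spn_sub => //; split; [exact: EWN0|exact: EWN_lin]. Qed.

Definition slocal_pair A B a b :=
  exists k, RF N A B (fun w => iter k (rdif N) (prod2 a b w)).

Lemma slocal_pair_sub A B A' B' a b : A `<=` A' -> B `<=` B' ->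
  slocal_pair A B a b -> slocal_pair A' B' a b.
Proof. by move=> hA hB [k h]; exists k; exact: RF_sub h. Qed.

Lemma slocal_pair_lin A B x a b a' b' a'' b'' : A `<=` EWN W -> B `<=` EWN W ->
  (forall w, prod2 a'' b'' w = x *: prod2 a b w + prod2 a' b' w) ->
  slocal_pair A B a b -> slocal_pair A B a' b' -> slocal_pair A B a'' b''.
Proof.
move=> hA hB e [k h] [k' h']; exists (k + k')%N.
have := RF_lin x (RF_iter_rdif k' hA hB h) (RF_iter_rdif k hA hB h').
congr RF; apply/funext => w.
rewrite -[LHS]/(x *: iter _ _ (iter _ _ _) + iter _ _ (iter _ _ _)).
by rewrite -!iterD e iter_rdif_lin addnC.
Qed.

Lemma slocal_pair0 A B a b : (forall w, prod2 a b w = 0) -> slocal_pair A B a b.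
Proof.
move=> h; exists 0%N; rewrite (_ : (fun w => _) = 0); first exact: RF0.
exact/funext.
Qed.

Lemma slocal_spn_r A B A' B' : A `<=` EWN W -> A' `<=` EWN W -> B' `<=` EWN W ->
  (forall a b, A a -> B b -> slocal_pair A' B' a b) ->
  forall a b, A a -> spn B b -> slocal_pair A' B' a b.
Proof.
move=> hA hA' hB' h a b ha; elim=> [{}b hb||x b1 b2 _ h1 _ h2].
- exact: h.
- apply: slocal_pair0 => w; apply/funext => m; apply/funext => n.
  exact: (field0 m (hA _ ha).1).
apply: (slocal_pair_lin (x := x) hA' hB' _ h1 h2) => w.
apply/funext => m; apply/funext => n; exact: (lin_at m (hA _ ha).1).
Qed.

Lemma slocal_spn_l A B A' B' : A' `<=` EWN W -> B' `<=` EWN W ->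
  (forall a b, A a -> B b -> slocal_pair A' B' a b) ->
  forall a b, spn A a -> B b -> slocal_pair A' B' a b.
Proof.
move=> hA' hB' h a b ha hb; elim: ha => [{}a ha||x b1 b2 _ h1 _ h2].
- exact: h.
- exact: slocal_pair0.
exact: (slocal_pair_lin (x := x) hA' hB' _ h1 h2).
Qed.

Lemma slocal_idser_l b A B : EWN W b -> A (idser W) -> B b ->
  slocal_pair A B (idser W) b.
Proof.
move=> hb h1 hB; exists 0%N; have := RF_prod N h1 hB; congr RF.
do 3!apply/funext => ?; rewrite /= /prod2 /idser; case: ifP => // _.
by rewrite (field0 _ hb.1).
Qed.

Lemma slocal_idser_r a A B : EWN W a -> A a -> B (idser W) ->
  slocal_pair A B a (idser W).
Proof.
move=> ha hA h1; exists 0%N; have := RF_prod N hA h1; congr RF.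
do 3!apply/funext => ?; rewrite /= /prod2 /idser; case: ifP => // _.
by rewrite (field0 _ ha.1).
Qed.

Lemma slocal_of_S_local U : U `<=` EWN W -> S_local N U -> slocal N U U.
Proof.
move=> hU hS a b ha hb; have [r [f [a' [b' [k [hf E]]]]]] := hS a b ha hb.
have [i L L' LL h l hl|i|L vf] := @common_lower_bound 'I_r (fun i L => vanishes_below L (f i)).
- by apply: h; exact: lt_le_trans LL.
- by have [[L h] _] := hf i; exists L.
(* L bounds the orders of all f_i from below, so |L| factors clear their poles; k factors are needed
   for the S-locality relation. *)
pose K := (absz L + k)%N.
exists K; have -> : (fun w => iter K (rdif N) (prod2 a b w)) =
    \sum_(i < r) fun w => hact N (fun j => f i (j%:Z - K%:Z)) (fun m n => a' i (b' i w m) n).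
  apply/funext => w; rewrite fct_sumE.
  have Ek : iter k (dif N) (prod2 a b w) = iter k (dif N)
      (\sum_(i < r) act_diff N (f i) (fun m n => a' i (b' i w m) n)).
    by rewrite -mulx12E E mulx12E; congr (iter _ _ _); rewrite fct_sumE.
  have Er : iter k (rdif N) (prod2 a b w) = iter k (rdif N)
      (\sum_(i < r) act_diff N (f i) (fun m n => a' i (b' i w m) n)).
    by rewrite !iter_rdifE Ek.
  have lK : linear (iter K (@rdif R N W)) by move=> x G G'; exact: iter_rdif_lin.
  rewrite {1}/K iterD Er -iterD -/K (lin_sum lK).
  apply: eq_bigr => i _; have [_ [ua ub]] := hf i.
  have [L' hL'] := (hU _ ub).2 w.
  have low := lowfin_prod hN w (hU _ ub) (hU _ ua).
  have tr m n : m < L' -> a' i (b' i w m) n = 0.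
    by move=> hm; rewrite hL' // (field0 _ (hU _ ua).1).
  rewrite (iter_rdif_act_diff hN K (vf i) low tr).
  rewrite (@act_diff_hact _ _ hN _ L' (fun l => f i (l - K%:Z)) _ _ low) // => l hl.
  by apply: vf; move: hl; rewrite /K; clear; lia.
apply: RF_sum => i; have [_ [ua ub]] := hf i.
exact: (RF_hact_prod N (fun j => f i (j%:Z - K%:Z)) ub ua).
Qed.

Section Levels.
Variable U : set field.
Hypotheses (hU : U `<=` EWN W) (hS : S_local N U)
  (hg : graded_subspace N (lin_span U)).

Definition products X : set field :=
  [set c | exists a b q, X a /\ X b /\ c = YE N a b q].

(** A construction from below, whose union is compared with the intersection [gen N U]. *)
Fixpoint level n : set field :=
  match n with
  | 0 => spn (U `|` [set idser W])
  | n.+1 => spn (level n `|` products (level n))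
  end.

Lemma level_EWN_slocal n : level n `<=` EWN W /\ slocal N (level n) (level n).
Proof.
have lU := slocal_of_S_local hU hS.
elim: n => [|n [hE hL]] /=.
  set S := U `|` [set idser W].
  have SE : S `<=` EWN W by move=> a [/hU//|->]; exact: EWN_idser.
  have E := EWN_spn SE; split=> //.
  have SS : S `<=` spn S by move=> a; exact: spn_in.
  have US : U `<=` spn S by move=> a ha; apply: SS; left.
  have S1 : spn S (idser W) by apply: SS; right.
  apply: (slocal_spn_r E E E) => a b ha hb.
  apply: (slocal_spn_l E E _ ha hb) => {a b ha hb} a b ha [hb|->].
    case: ha => [ha|->]; last first.
      by apply: slocal_idser_l => //; [exact: hU | exact: US].
    exact: (slocal_pair_sub US US (lU a b ha hb)).
  by apply: slocal_idser_r => //; [exact: SE | exact: SS].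
set X := level n in hE hL *.
have XX : X `<=` spn (X `|` products X) by move=> a ha; apply: spn_in; left.
have PX : products X `<=` spn (X `|` products X) by move=> a ha; apply: spn_in; right.
have cX a b (ha : X a) (hb : X b) := slocal_compatible hN hE hE hL ha hb.
have E : spn (X `|` products X) `<=` EWN W.
  apply: EWN_spn => c [/hE//|[a [b [q [ha [hb ->]]]]]].
  by apply: (EWN_YE hN); [exact: hE | exact: hE | exact: cX].
split=> //.
have YX a b q : X a -> X b -> spn (X `|` products X) (YE N a b q).
  by move=> ha hb; apply: PX; exists a, b, q.
have sr : slocal N X (spn (X `|` products X)).
  apply: (slocal_spn_r hE hE E) => a b ha [hb|[b1 [b2 [q [h1 [h2 ->]]]]]].
    exact: (slocal_pair_sub (fun x h => h) XX (hL a b ha hb)).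
  exact: (slocal_YE_right hN hE hE E cX YX hL q ha h1 h2).
move=> a b ha hb; apply: (slocal_spn_l E E _ ha hb) => {a b ha hb} a b ha hb.
case: ha => [ha|[b1 [b2 [q [h1 [h2 ->]]]]]].
  exact: (slocal_pair_sub XX (fun x h => h) (sr a b ha hb)).
exact: (slocal_YE_left hN hE E E cX YX sr q h1 h2 hb).
Qed.

End Levels.

End Generation.

(** * Compatibility of sequences *)

Section ManyVariables.
Variables (R : realType) (N : nat).
Hypothesis hN : (0 < N)%N.
Variable W : lmodType R[i].
Notation field := (W -> int -> W).

Section Indices.
Variable I : eqType.
Implicit Types (i j v : I) (m : I -> int) (F G : (I -> int) -> W) (ps qs : seq (I * I)).

Definition lower_at i m : I -> int := fun l => if l == i then m l - N%:Z else m l.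

(** Multiplication by x_i - x_j for p = (i, j). The variables are labelled by an arbitrary type, so
    that a part of a product keeps its labels. *)
Definition mdif (p : I * I) F : (I -> int) -> W := fun m => F (lower_at p.1 m) - F (lower_at p.2 m).

Definition mdifs ps F := foldr mdif F ps.

Definition nprod (s : seq (I * field)) (w : W) m : W :=
  foldr (fun p w' => p.2 w' (m p.1)) w s.

Definition truncated_in v F := exists L : int, forall m, m v < L -> F m = 0.

Lemma lower_at_comm i j m : lower_at i (lower_at j m) = lower_at j (lower_at i m).
Proof. by apply/funext => l; rewrite /lower_at; case: eqP => //; case: eqP. Qed.

Lemma lower_at_lt v i m (L : int) : m v < L -> lower_at i m v < L.
Proof. by rewrite /lower_at; case: eqP => // _; move: hN; clear; lia. Qed.

Lemma mdif_comm p q F : mdif p (mdif q F) = mdif q (mdif p F).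
Proof.
apply/funext => m; rewrite /mdif !(lower_at_comm q.1) !(lower_at_comm q.2).
by rewrite !opprB addrACA [X in _ + X]addrC addrACA.
Qed.

Lemma mdifs_cat ps qs F : mdifs (ps ++ qs) F = mdifs ps (mdifs qs F).
Proof. exact: foldr_cat. Qed.

Lemma mdifs_mdif ps p F : mdifs ps (mdif p F) = mdif p (mdifs ps F).
Proof. by elim: ps => //= q ps ->; rewrite mdif_comm. Qed.

Lemma mdifs_perm ps qs F : perm_eq ps qs -> mdifs ps F = mdifs qs F.
Proof.
elim: ps qs => [|p ps IH] qs; first by rewrite perm_sym => /perm_nilP ->.
move=> h; have pq : p \in qs by rewrite -(perm_mem h) mem_head.
have [qs1 [qs2 E]] : exists s1 s2, qs = s1 ++ p :: s2.
  by case/splitPr: pq => s1 s2; exists s1, s2.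
move: h; rewrite E perm_sym -cat1s perm_catCA perm_cons perm_sym => /IH E'.
by rewrite /= E' !mdifs_cat /= mdifs_mdif.
Qed.

Lemma mdif_lin p x F G : mdif p (x *: F + G) = x *: mdif p F + mdif p G.
Proof.
by apply/funext => m; rewrite /mdif !fctE /= scalerBr opprD addrACA.
Qed.

Lemma mdifs_lin ps x F G : mdifs ps (x *: F + G) = x *: mdifs ps F + mdifs ps G.
Proof. by elim: ps => //= p ps ->; exact: mdif_lin. Qed.

Lemma truncated_in_mdif v p F : truncated_in v F -> truncated_in v (mdif p F).
Proof.
by move=> [L h]; exists L => m hm; rewrite /mdif !h ?subr0 //; exact: lower_at_lt.
Qed.

Lemma truncated_in_mdifs v ps F : truncated_in v F -> truncated_in v (mdifs ps F).
Proof. by move=> h; elim: ps => //= p ps; exact: truncated_in_mdif. Qed.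

(** Multiplications by differences commute, so only multiplicities count, and additional factors
    preserve truncation. *)
Lemma truncated_in_more v ps qs F : (forall p, (count_mem p ps <= count_mem p qs)%N) ->
  truncated_in v (mdifs ps F) -> truncated_in v (mdifs qs F).
Proof.
elim: ps qs F => [|p ps IH] qs F h; first exact: truncated_in_mdifs.
have pq : p \in qs.
  by rewrite -has_pred1 has_count; apply: leq_trans (h p); rewrite /= eqxx.
rewrite /= -mdifs_mdif (mdifs_perm _ (perm_to_rem pq)) /= -mdifs_mdif.
by apply: IH => q; have := h q; rewrite (permP (perm_to_rem pq)) /= leq_add2l.
Qed.

Lemma truncated_in_lin v x F G :
  truncated_in v F -> truncated_in v G -> truncated_in v (x *: F + G).
Proof.
move=> [L h] [L' h']; exists (Order.min L L') => m; rewrite lt_min => /andP[l1 l2].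
by rewrite !fctE /= h // h' // scaler0 addr0.
Qed.

Lemma mdifs_lim ps (Fs : nat -> (I -> int) -> W) F :
  (forall m, evto (fun M => Fs M m) (F m)) ->
  forall m, evto (fun M => mdifs ps (Fs M) m) (mdifs ps F m).
Proof.
move=> h; elim: ps => //= p ps IH m.
exact: (evto_map2 (fun x y => x - y) (IH _) (IH _)).
Qed.

Lemma nprod_lower_at s w m i : i \notin map fst s -> nprod s w (lower_at i m) = nprod s w m.
Proof.
elim: s => //= -[j b] s IH /=; rewrite inE negb_or => /andP[ij /IH ->].
by rewrite {1}/lower_at eq_sym (negbTE ij).
Qed.

Lemma linear_nprod (s : seq (I * field)) m :
  {in s, forall p, linear p.2} -> linear (fun w => nprod s w m).
Proof.
elim: s => [|p s IH] h x u v //=.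
rewrite IH => [|q hq]; last by apply: h; rewrite inE hq orbT.
exact: (lin_at _ (h p (mem_head _ _))).
Qed.

Lemma iter_mdif_prod2 k v j (a b : field) (s : seq (I * field)) w m :
  v != j -> v \notin map fst s -> j \notin map fst s ->
  iter k (mdif (j, v)) (fun m => b (a (nprod s w m) (m v)) (m j)) m =
  iter k (rdif N) (fun x y => b (a (nprod s w m) x) y) (m v) (m j).
Proof.
move=> vj vs js; elim: k m => // k IH m; rewrite !iterS /rdif /mdif /= !IH.
rewrite !nprod_lower_at // /lower_at !eqxx (negbTE vj) eq_sym (negbTE vj) //.
Qed.

Lemma mdifs_prod ps (b : field) F j : linear b ->
  (forall p, p \in ps -> (p.1 != j) && (p.2 != j)) ->
  mdifs ps (fun m => b (F m) (m j)) = fun m => b (mdifs ps F m) (m j).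
Proof.
move=> lb; elim: ps => //= p ps IH h; rewrite IH; last first.
  by move=> q hq; apply: h; rewrite inE hq orbT.
have /andP[h1 h2] := h p (mem_head _ _).
apply/funext => m; rewrite /mdif (linB (lin_at _ lb)).
by rewrite {2 4}/lower_at ![j == _]eq_sym (negbTE h1) (negbTE h2).
Qed.

Lemma mdifs_nseq k p F : mdifs (nseq k p) F = iter k (mdif p) F.
Proof. by elim: k => //= k ->. Qed.

Lemma iter_mdif_opp k v j F :
  iter k (mdif (j, v)) F = (-1) ^+ k *: iter k (mdif (v, j)) F.
Proof.
elim: k => [|k IH]; first by rewrite scale1r.
rewrite !iterS IH; apply/funext => m; rewrite /mdif !fctE /= -scalerBr.
by rewrite exprS mulN1r scaleNr -scalerN opprB.
Qed.

(** Multiplication by x_j - x_v never lowers the least exponent of x_v, so one bound L serves all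
    partial sums of h; applying b(x_j), which is linear and free of x_v, preserves it too. *)
Lemma truncated_in_hact (A : set field) h (a b : field) (s : seq (I * field)) v j ps w :
  A `<=` EWN W -> A a -> A b -> v != j -> v \notin map fst s -> j \notin map fst s ->
  {in ps, forall p, p.1 = v /\ p.2 \in map fst s} ->
  truncated_in v (mdifs ps (nprod ((v, a) :: s) w)) ->
  truncated_in v (mdifs ps (fun m =>
    hact N h (fun x y => b (a (nprod s w m) x) y) (m v) (m j))).
Proof.
move=> hA ha hb vj vs js hps [L hL]; exists L => m hm.
pose F m := b (a (nprod s w m) (m v)) (m j).
pose Fs M := \sum_(i < M) h i *: iter i (mdif (j, v)) F.
have hF m' : evto (fun M => Fs M m')
    (hact N h (fun x y => b (a (nprod s w m') x) y) (m' v) (m' j)).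
  have := hact_evto h (m' v) (m' j) (lowfin_prod hN (nprod s w m') (hA _ ha) (hA _ hb)).
  apply: (evto_eq (M0 := 0%N)) => M _; rewrite /Fs fct_sumE.
  apply: eq_bigr => i _; rewrite -[RHS]/(h i *: _); congr (_ *: _).
  exact: (esym (iter_mdif_prod2 i a b w m' vj vs js)).
apply: evto_uniq (mdifs_lim ps hF m) _; exists 0%N => M _.
rewrite /Fs (lin_sum (mdifs_lin ps)) fct_sumE big1 // => i _.
rewrite (linZ (mdifs_lin ps)) -[LHS]/(h i *: _).
have -> : mdifs ps (iter i (mdif (j, v)) F) = iter i (mdif (j, v)) (mdifs ps F).
  by elim: (i : nat) => //= i' <-; rewrite mdifs_mdif.
suff H : forall m, m v < L -> iter i (mdif (j, v)) (mdifs ps F) m = 0.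
  by rewrite H ?scaler0.
have lb := (hA _ hb).1.
have F0 m' : m' v < L -> mdifs ps F m' = 0.
  move=> hm'; rewrite /F (mdifs_prod (fun m => a (nprod s w m) (m v)) lb).
    by rewrite (hL m' hm') (field0 _ lb).
  move=> p /hps [-> hp]; rewrite vj /=; apply: contraNneq js => <-; exact: hp.
elim: (i : nat) => [|i' IH] m' hm' //=; first exact: F0.
by rewrite /mdif !IH ?subr0 //; exact: lower_at_lt.
Qed.

(** Induction on the length of the word: a power of x_v - x_j lets the field in x_v pass the next
    one, in x_j, and it then heads a shorter word. At the end it acts directly on w. *)
Lemma truncated_in_nprod (A : set field) (s : seq (I * field)) v a :
  A `<=` EWN W -> slocal N A A -> {in s, forall p, A p.2} -> A a ->
  uniq (v :: map fst s) ->
  exists ps, {in ps, forall p, p.1 = v /\ p.2 \in map fst s} /\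
    forall w, truncated_in v (mdifs ps (nprod ((v, a) :: s) w)).
Proof.
move=> hA hS; elim: s a => [|[j b] s IH] a hs ha hu.
  exists [::]; split=> // w; have [L h] := (hA _ ha).2 w.
  by exists L => m hm; rewrite /= h.
have hs' : {in s, forall p, A p.2} by move=> p hp; apply: hs; rewrite inE hp orbT.
have hb : A b := hs (j, b) (mem_head _ _).
move: hu; rewrite /= inE negb_or -andbA => /and4P[vj vs js us].
have uvs : uniq (v :: map fst s) by rewrite /= vs us.
have claim (G : W -> int -> int -> W) : RF N A A G -> exists ps,
    {in ps, forall p, p.1 = v /\ p.2 \in map fst s} /\ forall w,
    truncated_in v (mdifs ps (fun m => G (nprod s w m) (m v) (m j))).
  elim=> [|x G1 G2 _ [ps1 [h1 t1]] _ [ps2 [h2 t2]]|h a' b' ha' hb'].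
  - by exists [::]; split=> // w; exists 0.
  - exists (ps1 ++ ps2); split=> [p|w].
      by rewrite mem_cat => /orP[]; [exact: h1 | exact: h2].
    rewrite -[X in mdifs _ X]/(x *: (fun m => G1 (nprod s w m) (m v) (m j)) +
      (fun m => G2 (nprod s w m) (m v) (m j))) mdifs_lin.
    apply: truncated_in_lin.
      by apply: truncated_in_more (t1 w) => p; rewrite count_cat leq_addr.
    by apply: truncated_in_more (t2 w) => p; rewrite count_cat leq_addl.
  have [ps [h1 h2]] := IH a' hs' ha' uvs; exists ps; split=> // w.
  exact: (truncated_in_hact h hA ha' hb' vj vs js h1 (h2 w)).
have [k hk] := hS a b ha hb; have [ps [h1 h2]] := claim _ hk.
exists (ps ++ nseq k (v, j)); split=> [p|w].
  rewrite mem_cat inE => /orP[/h1[-> ->]|]; first by rewrite orbT.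
  by rewrite mem_nseq => /andP[_ /eqP ->]; rewrite eqxx.
rewrite mdifs_cat mdifs_nseq; have := truncated_in_lin ((-1) ^+ k) (h2 w)
  (ex_intro _ 0 (fun m _ => erefl) : truncated_in v 0).
rewrite addr0 -(linZ (mdifs_lin ps)); congr (truncated_in _ (mdifs _ _)).
have := iter_mdif_opp k j v (nprod ((v, a) :: (j, b) :: s) w) => ->.
apply/funext => m; rewrite !fctE /=; congr (_ *: _).
elim: k m {hk h1 h2} => // k IHk m; rewrite !iterS /rdif /mdif /=.
by rewrite -!IHk /= !nprod_lower_at // /lower_at !eqxx (negbTE vj) eq_sym (negbTE vj).
Qed.

End Indices.

End ManyVariables.

Section Compatibility.
Variables (R : realType) (N : nat).
Hypothesis hN : (0 < N)%N.
Variable W : lmodType R[i].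
Notation field := (W -> int -> W).

Lemma nprod_cat (I : eqType) (s1 s2 : seq (I * field)) w m :
  nprod (s1 ++ s2) w m = nprod s1 (nprod s2 w m) m.
Proof. by rewrite /nprod foldr_cat. Qed.

Lemma mdifs_nprod (I : eqType) ps (s : seq (I * field)) (G : (I -> int) -> W) :
  {in s, forall p, linear p.2} ->
  (forall p, p \in ps -> (p.1 \notin map fst s) && (p.2 \notin map fst s)) ->
  mdifs N ps (fun m => nprod s (G m) m) = fun m => nprod s (mdifs N ps G m) m.
Proof.
move=> ls; elim: ps => //= p ps IH h; rewrite IH; last first.
  by move=> q hq; apply: h; rewrite inE hq orbT.
have /andP[h1 h2] := h p (mem_head _ _).
apply/funext => m; rewrite /mdif (linB (linear_nprod m ls)).
by rewrite !nprod_lower_at.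
Qed.

Lemma mulvanderE (r k : nat) (F : W -> ('I_r -> int) -> W) w :
  mulvander N k F w = mdifs N (flatten [seq nseq k p |
    p <- [seq p : 'I_r * 'I_r <- enum {: 'I_r * 'I_r} | (p.1 < p.2)%N]]) (F w).
Proof.
rewrite /mulvander; elim: [seq p <- _ | _] => //= p s IH.
rewrite mdifs_cat mdifs_nseq -IH; move: (foldr _ F s) => G.
by elim: k {IH} => [//|k IH]; rewrite [RHS]iterS -IH.
Qed.

Lemma count_flatten_nseq (T : eqType) (k : nat) (s : seq T) p :
  p \in s -> (k <= count_mem p (flatten [seq nseq k q | q <- s]))%N.
Proof.
elim: s => //= q s IH; rewrite inE count_cat => /orP[/eqP ->|/IH h].
  by rewrite count_nseq /= eqxx mul1n leq_addr.
exact: leq_trans h (leq_addl _ _).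
Qed.

Lemma sorted_enum_ord r : sorted (fun i j : 'I_r => (i < j)%N) (enum 'I_r).
Proof.
by have := iota_ltn_sorted 0 r; rewrite -val_enum_ord sorted_map.
Qed.

(** Truncation is proved for one variable x_i at a time. The fields to the left of position i are
    linear and free of x_i, and those to the right require only factors x_i - x_j with i < j, all of
    which occur in the product. *)
Lemma slocal_compatible_seq (A : set field) r (a : 'I_r -> field) :
  A `<=` EWN W -> slocal N A A -> (forall i, A (a i)) -> compatible_seq N a.
Proof.
move=> hA hS ha.
pose s := [seq (i, a i) | i <- enum 'I_r].
have prodnE w : prodn a w = nprod s w.
  apply/funext => m; rewrite /prodn /nprod /s.
  by elim: (enum _) => //= i s' ->.
have ls (s' : seq 'I_r) : {in [seq (i, a i) | i <- s'], forall p, linear p.2}.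
  by move=> p /mapP[i _ ->]; exact: (hA _ (ha i)).1.
have mapK (s' : seq 'I_r) : map fst [seq (i, a i) | i <- s'] = s'.
  by rewrite -map_comp; exact: map_id.
have /choice[ps hps] (i : 'I_r) : exists psi : seq ('I_r * 'I_r),
    {in psi, forall p : 'I_r * 'I_r, p.1 = i /\ (i < p.2)%N} /\
    forall w, truncated_in i (mdifs N psi (nprod s w)).
  have [s1 [s2 E]] : exists s1 s2, enum 'I_r = s1 ++ i :: s2.
    have : i \in enum 'I_r by rewrite mem_enum.
    by case/splitPr => s1 s2; exists s1, s2.
  have := enum_uniq 'I_r; rewrite E cat_uniq => /and3P[_ h12 u2].
  have lt2 j : j \in s2 -> (i < j)%N.
    have := sorted_enum_ord r; rewrite E => /cat_sorted2[_] /=.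
    move=> hp hj; have tr : transitive (fun i j : 'I_r => (i < j)%N).
      by move=> x y z; exact: ltn_trans.
    exact: (allP (order_path_min tr hp)).
  have hs2 : {in [seq (i, a i) | i <- s2], forall p, A p.2}.
    by move=> p /mapP[j _ ->]; exact: ha.
  have := truncated_in_nprod hN hA hS hs2 (ha i) (v := i).
  rewrite mapK => /(_ u2)[ps [h1 h2]]; exists ps; split.
    by move=> p /h1[-> /lt2].
  move=> w; have [L hL] := h2 w; exists L => m hm.
  have -> : nprod s w = fun m => nprod [seq (i, a i) | i <- s1]
      (nprod [seq (i, a i) | i <- i :: s2] w m) m.
    by apply/funext => m'; rewrite /s E map_cat nprod_cat.
  rewrite mdifs_nprod //; last first.
    move=> p /h1[-> hp2]; rewrite mapK.
    move: h12; rewrite -all_predC => /allP h12.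
    apply/andP; split; first exact: (h12 i (mem_head _ _)).
    by apply: (h12 p.2); rewrite inE hp2 orbT.
  by rewrite (hL m hm) (lin0 (linear_nprod m (ls s1))).
(* At least the multiplicity of every factor required for any of the variables. *)
pose k := (\sum_(i < r) size (ps i))%N; exists k; split.
  move=> x u v; rewrite !mulvanderE !prodnE.
  rewrite -mdifs_lin; congr mdifs; apply/funext => m.
  exact: (linear_nprod m (ls (enum 'I_r))).
move=> w.
have [||L hL] := @common_lower_bound 'I_r (fun i L =>
    forall m : 'I_r -> int, m i < L -> mulvander N k (prodn a) w m = 0).
- by move=> i L L' LL h m hm; apply: h; exact: lt_le_trans LL.
- move=> i; have [h1 /(_ w) h2] := hps i.
  have [|L hL] := truncated_in_more hN (qs := flatten [seq nseq k p |
    p <- [seq p : 'I_r * 'I_r <- enum {: 'I_r * 'I_r} | (p.1 < p.2)%N]]) _ h2.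
    move=> p; have [/h1[p1 p2]|] := boolP (p \in ps i); last first.
      by rewrite -has_pred1 has_count -leqNgt leqn0 => /eqP ->.
    apply: leq_trans (count_flatten_nseq k _); last first.
      by rewrite mem_filter p1 p2 mem_enum.
    apply: leq_trans (count_size _ _) _.
    by rewrite /k (bigD1 i) //= leq_addr.
  by exists L => m hm; rewrite mulvanderE prodnE hL.
by exists L => m [i hi]; exact: (hL i).
Qed.

(** Multiplication by t - s, completing [rys] and [ryt]. *)
Definition rst (F : int -> int -> int -> W) : int -> int -> int -> W :=
  fun y => rdif N (F y).

(** The labels 0, 1, 2 stand for y, s, t. The first two are truncated by [truncated_in_nprod], the
    last because c acts first; k0 is found before the vector w is given. *)
Lemma slocal_triple (A : set field) a b c :
  A `<=` EWN W -> slocal N A A -> A a -> A b -> A c ->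
  exists k0, forall k, (k0 <= k)%N -> forall w, exists L : int, forall y s t,
    [|| y < L, s < L | t < L] ->
    iter k (rys N) (iter k (ryt N) (iter k rst (fun y s t => a (b (c w t) s) y))) y s t = 0.
Proof.
move=> hA hS ha hb hc.
pose ix y s t (i : nat) : int := match i with 0 => y | 1 => s | 2 => t | _ => 0 end.
have hs2 : {in [:: (2%N, c)], forall p, A p.2} by move=> p; rewrite inE => /eqP ->.
have hs1 : {in [:: (1%N, b); (2%N, c)], forall p, A p.2}.
  by move=> p; rewrite !inE => /orP[] /eqP ->.
have [ps0 [p0 t0]] := truncated_in_nprod hN hA hS hs1 ha (v := 0%N) isT.
have [ps1 [p1 t1]] := truncated_in_nprod hN hA hS hs2 hb (v := 1%N) isT.
exists (size ps0 + size ps1)%N => k hk w.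
pose qs := nseq k (0%N, 1%N) ++ nseq k (0%N, 2%N) ++ nseq k (1%N, 2%N).
pose Fn := nprod [:: (0%N, a); (1%N, b); (2%N, c)] w.
have cnt ps : (size ps <= k)%N -> {in ps, forall p : nat * nat,
    [|| p == (0%N, 1%N), p == (0%N, 2%N) | p == (1%N, 2%N)]} ->
    forall p, (count_mem p ps <= count_mem p qs)%N.
  move=> sk h p; have [/h|] := boolP (p \in ps); last first.
    by rewrite -has_pred1 has_count -leqNgt leqn0 => /eqP ->.
  move=> hp; apply: leq_trans (count_size _ _) (leq_trans sk _).
  rewrite !count_cat !count_nseq /=.
  by case/or3P: hp => /eqP ->; rewrite ?eqxx /= ?mul1n ?mul0n ?add0n ?addn0.
have T0 : truncated_in 0%N (mdifs N qs Fn).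
  have sk := leq_trans (leq_addr _ _) hk.
  apply: (truncated_in_more hN (cnt ps0 sk _) (t0 w)).
  by move=> [i j] /p0[/= -> ]; rewrite !inE !xpair_eqE /= orbF.
have T1 : truncated_in 1%N (mdifs N qs Fn).
  have sk := leq_trans (leq_addl _ _) hk.
  apply: (truncated_in_more hN (cnt ps1 sk _)).
    by move=> [i j] /p1[/= -> ]; rewrite !inE !xpair_eqE /=.
  have [L hL] := t1 w; exists L => m hm.
  have -> : Fn = fun m => nprod [:: (0%N, a)] (nprod [:: (1%N, b); (2%N, c)] w m) m by [].
  rewrite mdifs_nprod => [|p|[i j] /p1[/= -> ]]; last by rewrite !inE /= => /eqP ->.
    by rewrite /= (hL m hm) (field0 _ (hA _ ha).1).
  by rewrite inE => /eqP ->; exact: (hA _ ha).1.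
have T2 : truncated_in 2%N (mdifs N qs Fn).
  apply: (truncated_in_mdifs hN); have [L hL] := (hA _ hc).2 w; exists L => m hm.
  by rewrite /Fn /= hL // (field0 _ (hA _ hb).1) (field0 _ (hA _ ha).1).
have [[L0 h0] [L1 h1] [L2 h2]] := And3 T0 T1 T2.
exists (Order.min L0 (Order.min L1 L2)) => y s t hyst.
have z : mdifs N qs Fn (ix y s t) = 0.
  by case/or3P: hyst; rewrite !lt_min => /and3P[l0 l1 l2];
    [apply: h0 | apply: h1 | apply: h2].
have d0 y' s' t' : lower_at N 0%N (ix y' s' t') = ix (y' - N%:Z) s' t'.
  by apply/funext => -[|[|[|l]]].
have d1 y' s' t' : lower_at N 1%N (ix y' s' t') = ix y' (s' - N%:Z) t'.
  by apply/funext => -[|[|[|l]]].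
have d2 y' s' t' : lower_at N 2%N (ix y' s' t') = ix y' s' (t' - N%:Z).
  by apply/funext => -[|[|[|l]]].
have E1 j (G : (nat -> int) -> W) : (fun y s t => iter j (mdif N (1%N, 0%N)) G (ix y s t)) =
    iter j (rys N) (fun y s t => G (ix y s t)).
  by elim: j => //= j <-; do 3!apply/funext => ?; rewrite /mdif d0 d1.
have E2 j (G : (nat -> int) -> W) : (fun y s t => iter j (mdif N (2%N, 0%N)) G (ix y s t)) =
    iter j (ryt N) (fun y s t => G (ix y s t)).
  by elim: j => //= j <-; do 3!apply/funext => ?; rewrite /mdif d0 d2.
have E3 j (G : (nat -> int) -> W) : (fun y s t => iter j (mdif N (2%N, 1%N)) G (ix y s t)) =
    iter j rst (fun y s t => G (ix y s t)).
  by elim: j => //= j <-; do 3!apply/funext => ?; rewrite /mdif d1 d2.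
rewrite -[X in iter k rst X]/(fun y s t => Fn (ix y s t)) -E3 -E2 -E1.
have li p : linear (iter k (@mdif R N W nat p)).
  by move=> x G G'; rewrite -!mdifs_nseq mdifs_lin.
rewrite (iter_mdif_opp _ _ 1) (iter_mdif_opp _ _ 0) (iter_mdif_opp _ _ 0).
rewrite !(linZ (li _)) !fctE /=; move: z.
by rewrite /qs !mdifs_cat !mdifs_nseq => ->; rewrite !scaler0.
Qed.

End Compatibility.

(** * The closed subspace generated by an S-local set *)

Section Closure.
Variables (R : realType) (N : nat).
Hypothesis hN : (0 < N)%N.
Variable W : lmodType R[i].
Notation field := (W -> int -> W).
Implicit Types (a b c : field) (w : W) (X : set field).

Lemma YE_lin_l x a a' b q : pair_compatible N a b -> pair_compatible N a' b ->
  pair_compatible N (x *: a + a') b ->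
  YE N (x *: a + a') b q = x *: YE N a b q + YE N a' b q.
Proof.
move=> h1 h2 h3; apply/funext => w; apply/funext => p.
have E := subE_uniq hN (subE_YE w h3) (subE_lin hN x (subE_YE w h1) (subE_YE w h2)).
exact: (congr1 (fun f => f q p) E).
Qed.

Lemma YE_lin_r x a b b' q : linear a -> pair_compatible N a b -> pair_compatible N a b' ->
  pair_compatible N a (x *: b + b') ->
  YE N a (x *: b + b') q = x *: YE N a b q + YE N a b' q.
Proof.
move=> la h1 h2 h3; apply/funext => w; apply/funext => p.
have := subE_lin hN x (subE_YE w h1) (subE_YE w h2).
have <- : prod2 a (x *: b + b') w = x *: prod2 a b w + prod2 a b' w.
  by apply/funext => m; apply/funext => n; exact: (lin_at m la).
by move=> /(subE_uniq hN (subE_YE w h3)) E; exact: (congr1 (fun f => f q p) E).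
Qed.

Definition component (j : int) a : field :=
  fun w m => if (N%:Z %| m + j)%Z then a w m else 0.

Lemma component_lin j x a b : component j (x *: a + b) = x *: component j a + component j b.
Proof.
apply/funext => w; apply/funext => m; rewrite !fctE /component.
by case: ifP => // _; rewrite scaler0 addr0.
Qed.

Lemma EWN_component j a : EWN W a -> EWN W (component j a).
Proof.
move=> [la fa]; split=> [x u v|w].
  apply/funext => m; rewrite !fctE /component la.
  by case: ifP => // _; rewrite scaler0 addr0.
by have [L h] := fa w; exists L => m /h e; rewrite /component e if_same.
Qed.

Lemma dvdz_between (m : int) : exists! j : 'I_N, (N%:Z %| m + j%:Z)%Z.
Proof.
have N0 : N%:Z != 0 :> int by move: hN; clear; lia.
have h1 : 0 <= ((- m) %% N%:Z)%Z by rewrite modz_ge0.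
have h2 : ((- m) %% N%:Z)%Z < N%:Z by rewrite ltz_pmod //; move: hN; clear; lia.
case E : ((- m) %% N%:Z)%Z h1 h2 => [j|//] _ hj.
have hj' : (j < N)%N by move: hj; clear; lia.
have dj : (N%:Z %| m + j%:Z)%Z.
  apply/dvdzP; exists (- ((- m) %/ N%:Z)%Z).
  have := divz_eq (- m) N%:Z; rewrite E => e.
  by rewrite mulNr -[LHS]opprK opprD {1}e; ring.
exists (Ordinal hj'); split=> // j' hj2; apply/val_inj => /=.
have : (N%:Z %| j'%:Z - j%:Z)%Z.
  have -> : j'%:Z - j%:Z = (m + j'%:Z) - (m + j%:Z) by ring.
  exact: rpredB.
have := ltn_ord j'; move: hj'; clear; move: (j' : nat) => i hj hi /dvdzP[q e].
have q0 : q = 0 by nia.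
by move: e; rewrite q0 mul0r; lia.
Qed.

Lemma sum_component a : a = \sum_(j < N) component j%:Z a.
Proof.
apply/funext => w; apply/funext => m; rewrite !fct_sumE.
have [j [hj uj]] := dvdz_between m.
rewrite (bigD1 j) //= big1 => [|i hi]; first by rewrite addr0 /component hj.
rewrite /component; case: ifP => // /uj e; by rewrite e eqxx in hi.
Qed.

Lemma EWN_homog_component (j : nat) a : EWN W a -> EWN_homog N j (component j%:Z a).
Proof.
move=> ha; split; first exact: EWN_component.
by move=> w m /negbTE h; rewrite /component h.
Qed.

Lemma component_homog (j : 'I_N) (i : nat) a : EWN_homog N i a ->
  component j%:Z a = if (N%:Z %| j%:Z - i%:Z)%Z then a else 0.
Proof.
move=> [_ h]; apply/funext => w; apply/funext => m; rewrite /component.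
have [dm|dm] := boolP (N%:Z %| m + i%:Z)%Z; last first.
  by rewrite h //; case: ifP; case: ifP => //; rewrite h.
have -> : m + j%:Z = (m + i%:Z) + (j%:Z - i%:Z) by ring.
by rewrite rpredDl //; case: ifP.
Qed.

Lemma graded_component X (j : 'I_N) a : graded_subspace N X -> X a -> X (component j%:Z a).
Proof.
move=> [[X0 Xl] Xg] /Xg[h [hh ->]].
have -> : component j%:Z (\sum_(i < N) h i) = h j.
  rewrite (lin_sum (component_lin j%:Z)) (bigD1 j) //= big1 => [|i hi].
    by rewrite (component_homog _ (hh j).2) subrr dvdz0 addr0.
  rewrite (component_homog _ (hh i).2); case: ifP => // /dvdzP[q e].
  have q0 : q = 0.
    by move: e (ltn_ord i) (ltn_ord j); clear; move: (i : nat) (j : nat) => i' j' *; nia.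
  exfalso; move: hi; rewrite -val_eqE /=; move: e; rewrite q0 mul0r; clear.
  by move: (i : nat) (j : nat) => i' j' *; lia.
exact: (hh j).1.
Qed.

Lemma graded_of_component X : X `<=` EWN W -> is_subspace X ->
  (forall a (j : 'I_N), X a -> X (component j%:Z a)) -> graded_subspace N X.
Proof.
move=> XE Xs h; split=> // a ha; exists (fun j => component j%:Z a).
split; last exact: sum_component.
by move=> j; split; [exact: h | apply: EWN_homog_component; exact: XE].
Qed.

(** The indicator of exponents congruent to -(i + j) modulo N is a periodic weight that leaves
    a(x_1) b(x_2) unchanged. By [subE_periodic] and uniqueness it leaves [YE N a b] unchanged as
    well. *)
Lemma YE_homog (i j : int) a b q : EWN W a -> EWN W b -> pair_compatible N a b ->
  (forall w m, ~~ (N%:Z %| m + i)%Z -> a w m = 0) ->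
  (forall w m, ~~ (N%:Z %| m + j)%Z -> b w m = 0) ->
  forall w m, ~~ (N%:Z %| m + (i + j))%Z -> YE N a b q w m = 0.
Proof.
move=> ha hb hab hi hj w m hm.
pose chi n : R[i] := (N%:Z %| n + (i + j))%Z%:R.
have per n : chi (n + N%:Z) = chi n.
  rewrite /chi; have -> : n + N%:Z + (i + j) = n + (i + j) + N%:Z by ring.
  by rewrite rpredDr // dvdzz.
have := subE_periodic hN per (subE_YE w hab).
have -> : (fun m n => chi (m + n) *: prod2 a b w m n) = prod2 a b w.
  apply/funext => m'; apply/funext => n; rewrite /prod2 /chi.
  have [d1|d1] := boolP (N%:Z %| m' + i)%Z; last by rewrite hi // scaler0.
  have [d2|d2] := boolP (N%:Z %| n + j)%Z; last by rewrite hj // (field0 _ ha.1) scaler0.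
  have -> : m' + n + (i + j) = (m' + i) + (n + j) by ring.
  by rewrite rpredD // scale1r.
move=> /(subE_uniq hN (subE_YE w hab)) E.
have /= -> := congr1 (fun f => f q m) E.
by rewrite /chi (negbTE hm) scale0r.
Qed.

(** The weight omega^(-m) of [theta] is N-periodic and multiplicative, so acting on both factors
    amounts to weighting the total exponent m + n. *)
Lemma YE_theta a b q : pair_compatible N a b ->
  pair_compatible N (theta N a) (theta N b) -> linear a ->
  YE N (theta N a) (theta N b) q = theta N (YE N a b q).
Proof.
move=> hab hab' la; apply/funext => w; apply/funext => p.
pose chi n : R[i] := omega R N ^ (- n).
have per n : chi (n + N%:Z) = chi n.
  rewrite /chi opprD expfzDr ?omega_neq0 //.
  have -> : omega R N ^ (- N%:Z) = 1 by rewrite -exprnN omegaXN ?invr1.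
  by rewrite mulr1.
have := subE_periodic hN per (subE_YE w hab).
have -> : (fun m n => chi (m + n) *: prod2 a b w m n) = prod2 (theta N a) (theta N b) w.
  apply/funext => m; apply/funext => n.
  rewrite /prod2 /theta (linZ (lin_at m la)) scalerA; congr (_ *: _).
  by rewrite /chi opprD expfzDr ?omega_neq0.
move=> /(subE_uniq hN (subE_YE w hab')) E.
exact: (congr1 (fun f => f q p) E).
Qed.

Section Sums.
Variable X : set field.
Hypotheses (Xs : is_subspace X) (XE : X `<=` EWN W)
  (cX : forall a b, X a -> X b -> pair_compatible N a b).

Let Xsum r (f : 'I_r -> field) : (forall i, X (f i)) -> X (\sum_(i < r) f i).
Proof.
move=> hf; elim/big_rec: _ => [|i z _ hz]; first exact: Xs.1.
by rewrite -[f _]scale1r; exact: Xs.2.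
Qed.

Let Xadd a b : X a -> X b -> X (a + b).
Proof. by move=> ha hb; rewrite -[a]scale1r; exact: Xs.2. Qed.

Let YE_addl a b d q : X a -> X b -> X d -> YE N (a + b) d q = YE N a d q + YE N b d q.
Proof.
move=> ha hb hd; have := @YE_lin_l 1 a b d q (cX ha hd) (cX hb hd).
by rewrite !scale1r; apply; apply: cX => //; exact: Xadd.
Qed.

Let YE_addr a b d q : X a -> X b -> X d -> YE N d (a + b) q = YE N d a q + YE N d b q.
Proof.
move=> ha hb hd; have := @YE_lin_r 1 d a b q (XE hd).1 (cX hd ha) (cX hd hb).
by rewrite !scale1r; apply; apply: cX => //; exact: Xadd.
Qed.

Lemma YE_suml r (f : 'I_r -> field) d q : (forall i, X (f i)) -> X d ->
  YE N (\sum_(i < r) f i) d q = \sum_(i < r) YE N (f i) d q.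
Proof.
move=> hf hd; elim: r f hf => [|r IHr] f hf.
  rewrite !big_ord0; have c0 := cX Xs.1 hd.
  by have := @YE_lin_l (-1) 0 0 d q c0 c0;
    rewrite scaler0 addr0 scaleN1r addNr; apply.
by rewrite !big_ord_recr /= -IHr // YE_addl //; exact: Xsum.
Qed.

Lemma YE_sumr r (f : 'I_r -> field) d q : (forall i, X (f i)) -> X d ->
  YE N d (\sum_(i < r) f i) q = \sum_(i < r) YE N d (f i) q.
Proof.
move=> hf hd; have ld := (XE hd).1; elim: r f hf => [|r IHr] f hf.
  rewrite !big_ord0; have c0 := cX hd Xs.1.
  by have := @YE_lin_r (-1) d 0 0 q ld c0 c0;
    rewrite scaler0 addr0 scaleN1r addNr; apply.
by rewrite !big_ord_recr /= -IHr // YE_addr //; exact: Xsum.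
Qed.

End Sums.

Section Levels.
Variable U : set field.
Hypotheses (hU : U `<=` EWN W) (hS : S_local N U)
  (hg : graded_subspace N (lin_span U)).

Let level := level N U.

Let levelE n : level n `<=` EWN W. Proof. exact: (level_EWN_slocal hN hU hS n).1. Qed.

Let levelc n a b : level n a -> level n b -> pair_compatible N a b.
Proof.
move=> ha hb; have [hE hL] := level_EWN_slocal hN hU hS n.
exact: (slocal_compatible hN hE hE hL ha hb).
Qed.

Lemma spn_subspace S : is_subspace (@spn R W S).
Proof. by split=> *; [exact: spn0 | exact: spn_lin]. Qed.

Lemma level_subspace n : is_subspace (level n).
Proof. by case: n => [|n]; exact: spn_subspace. Qed.

(** For a product both factors are split into components, which lie in the preceding level by
    induction; products of components are homogeneous, so [component] keeps each of them or sends it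
    to 0. *)
Lemma level_component n a (j : 'I_N) : level n a -> level n (component j%:Z a).
Proof.
elim: n a j => [|n IH] a j; rewrite /level /=.
  elim=> [{}a [ha|->]||x b c _ hb _ hc].
  - have : lin_span U a.
      exists 1%N, (fun=> 1), (fun=> a); split=> // ; by rewrite big_ord1 scale1r.
    move=> /(graded_component j hg)[r [x [u [hu ->]]]].
    elim/big_rec: _ => [|i b _ hb]; first exact: spn0.
    by apply: spn_lin => //; apply: spn_in; left; exact: hu.
  - have -> : component j%:Z (idser W) = (N%:Z %| j%:Z)%Z%:R *: idser W.
      apply/funext => w; apply/funext => m; rewrite /component !fctE /idser.
      case: eqP => [->|_]; last by rewrite if_same scaler0.
      by rewrite add0r; case: ifP => _; rewrite ?scale1r ?scale0r.
    rewrite -[_ *: _]addr0; apply: spn_lin; last exact: spn0.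
    by apply: spn_in; right.
  - rewrite (lin0 (component_lin j%:Z)); exact: spn0.
  by rewrite component_lin; exact: spn_lin.
elim=> [{}a [ha|[b [c [q [hb [hc ->]]]]]]||x b c _ hb _ hc].
- by apply: spn_in; left; exact: IH.
- rewrite (sum_component b).
  rewrite (YE_suml (level_subspace n) (@levelc n)) => [|i|//]; last exact: IH.
  rewrite (lin_sum (component_lin j%:Z)); apply: spn_sum => i.
  rewrite {1}(sum_component c) (YE_sumr (level_subspace n) (@levelE n) (@levelc n)) => [|k|]; last 2 first.
  + exact: IH.
  + exact: IH.
  rewrite (lin_sum (component_lin j%:Z)); apply: spn_sum => k.
  set z := YE _ _ _ _.
  have hi := IH b i hb; have hk := IH c k hc.
  have hz : spn (level n `|` products N (level n)) z.
    by apply: spn_in; right; exists (component i%:Z b), (component k%:Z c), q.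
  have zh : EWN_homog N (i + k)%N z.
    split; first by apply: (EWN_YE hN); [exact: levelE hi|exact: levelE hk|exact: levelc hi hk].
    move=> w m; rewrite PoszD; apply: YE_homog.
    + exact: levelE hi.
    + exact: levelE hk.
    + exact: levelc hi hk.
    + by move=> w' m' /negbTE h; rewrite /component h.
    by move=> w' m' /negbTE h; rewrite /component h.
  by rewrite (component_homog _ zh); case: ifP => // _; exact: spn0.
- rewrite (lin0 (component_lin j%:Z)); exact: spn0.
by rewrite component_lin; exact: spn_lin.
Qed.

Lemma level_leq n n' : (n <= n')%N -> level n `<=` level n'.
Proof.
move=> h; rewrite -(subnK h); elim: (_ - n)%N => //= k IH a /IH ha.
by apply: spn_in; left.
Qed.

Definition closure_of : set field := \bigcup_n level n.

Lemma closure_EWN : closure_of `<=` EWN W.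
Proof. by move=> a [n _]; exact: levelE. Qed.

Lemma closure_common a b : closure_of a -> closure_of b -> exists n, level n a /\ level n b.
Proof.
move=> [n _ ha] [n' _ hb]; exists (maxn n n'); split.
  by apply: level_leq ha; rewrite leq_maxl.
by apply: level_leq hb; rewrite leq_maxr.
Qed.

Lemma closure_slocal : slocal N closure_of closure_of.
Proof.
move=> a b ha hb; have [n [an bn]] := closure_common ha hb.
have [k hk] := (level_EWN_slocal hN hU hS n).2 a b an bn; exists k.
by apply: RF_sub hk => c hc; exists n.
Qed.

Lemma closure_cgo : closed_graded_over N U closure_of.
Proof.
split.
- exact: closure_EWN.
- apply: graded_of_component; first exact: closure_EWN.
    split; first by exists 0%N => //; exact: spn0.
    move=> x a b ha hb; have [n [an bn]] := closure_common ha hb.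
    by exists n => //; exact: (level_subspace n).2.
  by move=> a j [n _ hn]; exists n => //; exact: level_component.
- move=> r a; exact: (slocal_compatible_seq hN closure_EWN closure_slocal).
- move=> a b n ha hb; have [k [ak bk]] := closure_common ha hb.
  by exists k.+1 => //; apply: spn_in; right; exists a, b, (- n - 1).
- by move=> a ha; exists 0%N => //; apply: spn_in; left.
by exists 0%N => //; apply: spn_in; right.
Qed.

Lemma level_gen n : level n `<=` gen N U.
Proof.
move=> a hn X HX; have [Xs _] := cgo_graded HX.
suff h : level n `<=` X by exact: h.
elim: n {a hn} => [|n IH]; apply: spn_sub => // a.
  by case=> [/(cgo_gen HX)//|->]; exact: cgo_one HX.
case=> [/IH//|[b [c [q [/IH hb [/IH hc ->]]]]]].
have -> : q = - (- q - 1) - 1 by rewrite opprB addrC opprK addKr.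
exact: (cgo_closed HX).
Qed.

Lemma genE : gen N U = closure_of.
Proof.
apply/seteqP; split; first exact: (gen_smallest closure_cgo).
by move=> a [n _]; exact: level_gen.
Qed.

Lemma gen_cgo : closed_graded_over N U (gen N U).
Proof. by rewrite genE; exact: closure_cgo. Qed.

Lemma gen_slocal : slocal N (gen N U) (gen N U).
Proof. by rewrite genE; exact: closure_slocal. Qed.

End Levels.
End Closure.

(** * The Jacobi identity from a single series *)

#[local] Arguments delta3 : simpl never.

Section AbstractJacobi.
Variables (R : realType) (V : lmodType R[i]).
Implicit Types (F G H P : int -> int -> V) (n p q r a b : int).

(* Coefficient of y^a in (1 - y)^n *)
Definition sgnbin n a : R[i] :=
  match a with Posz j => cbinom n%:~R j * (-1) ^+ j | Negz _ => 0 end.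

Lemma sgnbin_pascal n a : sgnbin (n + 1) a = sgnbin n a - sgnbin n (a - 1).
Proof.
case: a => [[|j]|j].
- by rewrite /= !cbinom0 subr0.
- rewrite (_ : Posz j.+1 - 1 = Posz j); last by lia.
  by rewrite /= intrD cbinom_pascal exprS; ring.
by rewrite (_ : Negz j - 1 = Negz j.+1) ?subr0 //; lia.
Qed.

Lemma sgnbin_neg n a : a < 0 -> sgnbin n a = 0. Proof. by case: a. Qed.

Lemma delta3E a b c : delta3 R a b c = if a + b + c == -1 then sgnbin (- a - 1) c else 0.
Proof. by case: c => // j; rewrite /= if_same. Qed.

(** The coefficient of x_1^q x_2^r in (x_1 - x_2)^n F, with the binomial expanded in nonnegative
    powers of x_2. *)
Definition expand2 n F q r : V :=
  \sum_(i \in [set: int]) sgnbin n (i - q + n) *: F i (q + r - n - i).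

(** The coefficient of x_1^q x_2^r in (x_2 - x_1)^n F, with the binomial expanded in nonnegative
    powers of x_1. *)
Definition expand1 n F q r : V :=
  \sum_(i \in [set: int]) sgnbin n (q - i) *: F i (q + r - n - i).

Lemma expand2_fins r0 n F q r : (forall i j, j < r0 -> F i j = 0) ->
  fins (fun i => sgnbin n (i - q + n) *: F i (q + r - n - i)).
Proof.
move=> h; apply: (@fins_window _ _ (q - n) (q + r - n - r0)) => i /orP[hi|hi].
  by rewrite sgnbin_neg ?scale0r //; lia.
by rewrite h ?scaler0 //; lia.
Qed.

Lemma expand1_fins q0 n F q r : (forall i j, i < q0 -> F i j = 0) ->
  fins (fun i => sgnbin n (q - i) *: F i (q + r - n - i)).
Proof.
move=> h; apply: (@fins_window _ _ q0 q) => i /orP[hi|hi].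
  by rewrite h ?scaler0 //; lia.
by rewrite sgnbin_neg ?scale0r //; lia.
Qed.

Lemma fins_shift (U : nmodType) (g : int -> U) c : fins g -> fins (fun i => g (i + c)).
Proof.
move=> [s h]; exists [seq i - c | i <- s] => i hi; apply: h.
by apply: contra hi => hi; apply/mapP; exists (i + c); rewrite ?addrK.
Qed.

Lemma finsZ (U : lmodType R[i]) (g : int -> U) x : fins g -> fins (fun i => x *: g i).
Proof. by move=> [s h]; exists s => i /h ->; rewrite scaler0. Qed.

Lemma fsumZ (U : lmodType R[i]) (g : int -> U) x : fins g ->
  \sum_(i \in [set: int]) x *: g i = x *: \sum_(i \in [set: int]) g i.
Proof.
by move=> h; rewrite (fsum_lin (f := fun v => x *: v)) // => c u v;
  rewrite scalerDr !scalerA mulrC.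
Qed.

(** Summation by parts along a diagonal of exponents with constant sum. *)
Lemma diagonal_rdif (c : int -> R[i]) (S : int) F :
  fins (fun i => c i *: F i (S - 1 - i)) -> fins (fun i => c (i + 1) *: F i (S - 1 - i)) ->
  \sum_(i \in [set: int]) c i *: rdif 1 F i (S - i) =
  \sum_(i \in [set: int]) (c i - c (i + 1)) *: F i (S - 1 - i).
Proof.
move=> h1 h2; transitivity (\sum_(i \in [set: int]) (c i *: F i (S - 1 - i) +
    -1 *: (c (i - 1 + 1) *: F (i - 1) (S - 1 - (i - 1))))).
  apply: eq_fsbigr => i _; rewrite scaleN1r subrK -scalerBr /rdif.
  by congr (_ *: (F _ _ - F _ _)); ring.
rewrite fsumD //; last by apply: finsZ; exact: (fins_shift (-1) h2).
rewrite fsumZ; last exact: (fins_shift (-1) h2).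
rewrite (fsum_shift (fun i => c (i + 1) *: F i (S - 1 - i))) -fsumZ // -fsumD //; last exact: finsZ.
by apply: eq_fsbigr => i _; rewrite scaleN1r -scalerBl.
Qed.

Lemma expand2_rdif r0 n F q r : (forall i j, j < r0 -> F i j = 0) ->
  expand2 n (rdif 1 F) q r = - expand2 (n + 1) F q r.
Proof.
move=> h; rewrite /expand2 diagonal_rdif; last 2 first.
- have := expand2_fins n q (r - 1) h; congr fins; apply/funext => i.
  by congr (_ *: F _ _); ring.
- have := expand2_fins n (q - 1) r h; congr fins; apply/funext => i.
  by congr (sgnbin _ _ *: F _ _); ring.
rewrite -scaleN1r -fsumZ; last exact: expand2_fins h.
apply: eq_fsbigr => i _; rewrite scaleN1r -scaleNr.
have -> : i - q + (n + 1) = (i - q + n + 1) by ring.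
rewrite sgnbin_pascal addrK opprB; congr (_ *: F _ _); last by ring.
by congr (_ - sgnbin _ _); ring.
Qed.

Lemma expand1_rdif q0 n F q r : (forall i j, i < q0 -> F i j = 0) ->
  expand1 n (rdif 1 F) q r = expand1 (n + 1) F q r.
Proof.
move=> h; rewrite /expand1 diagonal_rdif; last 2 first.
- have := expand1_fins n q (r - 1) h; congr fins; apply/funext => i.
  by congr (_ *: F _ _); ring.
- have := expand1_fins n (q - 1) r h; congr fins; apply/funext => i.
  by congr (sgnbin _ _ *: F _ _); ring.
apply: eq_fsbigr => i _; rewrite sgnbin_pascal.
by congr (_ *: F _ _); [congr (_ - sgnbin _ _)|]; ring.
Qed.

Lemma expand2_iter_rdif r0 n k F q r : (forall i j, j < r0 -> F i j = 0) ->
  expand2 n (iter k (rdif 1) F) q r = (-1) ^+ k *: expand2 (n + k%:Z) F q r.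
Proof.
elim: k n F => [|k IH] n F h; first by rewrite scale1r addr0.
rewrite iterSr IH => [|i j hj]; last by rewrite /rdif !h ?subr0 //; lia.
rewrite (expand2_rdif _ _ _ h) scalerN exprS mulN1r scaleNr.
have -> // : n + k%:Z + 1 = n + k.+1%:Z by lia.
Qed.

Lemma expand1_iter_rdif q0 n k F q r : (forall i j, i < q0 -> F i j = 0) ->
  expand1 n (iter k (rdif 1) F) q r = expand1 (n + k%:Z) F q r.
Proof.
elim: k n F => [|k IH] n F h; first by rewrite addr0.
rewrite iterSr IH => [|i j hi]; last by rewrite /rdif !h ?subr0 //; lia.
rewrite (expand1_rdif _ _ _ h).
have -> // : n + k%:Z + 1 = n + k.+1%:Z by lia.
Qed.

Lemma sgnbin_opp (j i : nat) : cbinom (- j.+1%:R) i * (-1) ^+ i = 'C(j + i, i)%:R :> R[i].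
Proof.
elim: i => [|i IH]; first by rewrite cbinom0 bin0 mulr1.
have h : i.+1%:R != 0 :> R[i] by rewrite pnatr_eq0.
apply: (mulIf h); rewrite -natrM [('C(_, _) * _)%N]mulnC addnS -mul_bin_diag natrM -IH.
rewrite mulrAC cbinomS exprS -!natr1 natrD; ring.
Qed.

Lemma signz_nat (j : nat) : (-1 : R[i]) ^ (- j%:Z) = (-1) ^+ j.
Proof. by rewrite -exprnN -exprVn invrN invr1. Qed.

Lemma signzN n : (-1 : R[i]) ^ (- n) = (-1) ^ n.
Proof.
case: n => j; first exact: signz_nat.
by rewrite NegzE opprK signz_nat.
Qed.

(* The three expansions of (x_1 - x_2)^n x_1^i x_2^j, in the coefficient form
   of the delta function identity. *)
Lemma sgnbin_three_terms n a b : a + b = n ->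
  sgnbin n a - (-1) ^ n * sgnbin n b =
  match - n - 1 with Posz j => cbinom (- b - 1)%:~R j | Negz _ => 0 end.
Proof.
move=> E; case: a b E => [a|a] [b|b] E.
- have -> : - n - 1 = Negz (a + b) by lia.
  rewrite -E -PoszD /= -exprnP -[(a + b)%:Z%:~R]/((a + b)%:R) !cbinom_natr.
  have -> : 'C(a + b, b) = 'C(a + b, a) by rewrite -[RHS]bin_sub ?leq_addr // addKn.
  have sb : (-1) ^+ b * (-1) ^+ b = 1 :> R[i] by rewrite -expr2 sqrr_sign.
  transitivity ('C(a + b, a)%:R * (-1) ^+ a * (1 - (-1) ^+ b * (-1) ^+ b) : R[i]).
    by rewrite exprD; ring.
  by rewrite sb subrr mulr0.
- rewrite /= mulr0 subr0.
  have [[j nE]|[j nE]] : (exists j : nat, n = j%:Z) \/ (exists j, n = - j.+1%:Z).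
    by case: n E => j _; [left; exists j|right; exists j; rewrite NegzE].
    rewrite (_ : - n - 1 = Negz j); last by lia.
    by rewrite nE -[j%:Z%:~R]/(j%:R) cbinom_natr bin_small ?mul0r //; lia.
  rewrite (_ : - n - 1 = j%:Z); last by lia.
  rewrite (_ : - Negz b - 1 = (j + a)%:Z); last by lia.
  rewrite nE mulrNz sgnbin_opp -[(j + a)%:Z%:~R]/((j + a)%:R) cbinom_natr.
  by rewrite -[in RHS]bin_sub ?leq_addr // addKn.
- rewrite /= sub0r.
  have [[j nE]|[j nE]] : (exists j : nat, n = j%:Z) \/ (exists j, n = - j.+1%:Z).
    by case: n E => j _; [left; exists j|right; exists j; rewrite NegzE].
    rewrite (_ : - n - 1 = Negz j); last by lia.
    by rewrite nE -[j%:Z%:~R]/(j%:R) cbinom_natr bin_small ?mul0r ?mulr0 ?oppr0 //; lia.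
  rewrite (_ : - n - 1 = j%:Z); last by lia.
  rewrite (_ : - b%:Z - 1 = - b.+1%:Z); last by lia.
  have sj : (-1) ^+ j * (-1) ^+ j = 1 :> R[i] by rewrite -expr2 sqrr_sign.
  rewrite nE !mulrNz sgnbin_opp signz_nat -[RHS]mulr1 -[X in _ = _ * X]sj [RHS]mulrA sgnbin_opp.
  by rewrite -[in RHS]bin_sub ?leq_addl // addnK addnC exprS; ring.
rewrite /= mulr0 subr0; have -> : - n - 1 = (a + b).+1%:Z by lia.
rewrite (_ : - Negz b - 1 = b%:Z); last by lia.
by rewrite -[b%:Z%:~R]/(b%:R) cbinom_natr bin_small //; lia.
Qed.

(** The delta function contributes (x_1 - x_2)^(-p-1) to the coefficient of x_0^p. *)
Lemma delta_first r0 P p q r : (forall i j, j < r0 -> P i j = 0) ->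
  mulser3 (delta3 R) (fun p q r => if p == 0 then P q r else 0) p q r =
  expand2 (- p - 1) P q r.
Proof.
move=> h; pose J := (absz (r - r0)%R).+1.
have hJ j : (J <= j)%N -> r - j%:Z < r0 by rewrite /J; clear; lia.
rewrite /mulser3 (@fsum_seq _ _ [seq (p, -1 - p - j%:Z, j%:Z) | j <- iota 0 J]).
- rewrite big_map sum_iota /expand2 (@fsum_window _ _ (q + p + 1) J); last first.
    move=> i /orP[hi|hi]; first by rewrite sgnbin_neg ?scale0r //; lia.
    by rewrite h ?scaler0 //; move: hi; rewrite /J; clear; lia.
  apply: eq_bigr => j _; rewrite /= subrr eqxx delta3E.
  rewrite (_ : p + (-1 - p - j%:Z) + j%:Z == -1); last by apply/eqP; ring.
  by congr (sgnbin _ _ *: P _ _); ring.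
- by rewrite map_inj_uniq ?iota_uniq // => i j [_]; lia.
move=> [[t1 t2] t3] ht /=; case: eqP => [e1|]; last by rewrite scaler0.
rewrite delta3E; case: eqP => [e2|]; last by rewrite scale0r.
case: t3 ht e2 => [j|j] ht e2; last by rewrite scale0r.
have [hj|/hJ hj] := ltnP j J; last by rewrite h ?scaler0.
case/negP: ht; apply/mapP; exists j; first by rewrite mem_iota.
by congr (_, _, _); move: e1 e2; clear; lia.
Qed.

(** The delta function contributes (x_2 + x_0)^(-q-1) to the coefficient of x_1^q, after the change
    of sign in [cbinom_opp]. *)
Lemma delta_third (J : nat) (S : int -> int -> V) p q r :
  (forall j b, (J <= j)%N -> S (p - j%:Z) b = 0) ->
  mulser3 (fun p q r => delta3 R r q p) (fun p q r => if q == 0 then S p r else 0) p q r =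
  \sum_(j < J) cbinom (- q - 1)%:~R j *: S (p - j%:Z) (r + q + 1 + j%:Z).
Proof.
move=> h; rewrite /mulser3 (@fsum_seq _ _ [seq (j%:Z, q, -1 - q - j%:Z) | j <- iota 0 J]).
- rewrite big_map sum_iota; apply: eq_bigr => j _; rewrite /= subrr eqxx delta3E.
  rewrite (_ : -1 - q - j%:Z + q + j%:Z == -1); last by apply/eqP; ring.
  have -> : (- q - 1)%:~R = - ((q + 1)%:~R) :> R[i] by rewrite -mulrNz opprD.
  rewrite -cbinom_opp; congr (cbinom _ _ * _ *: S _ _); last by ring.
  by rewrite -[X in _ = _ + X - _]/(j%:Z%:~R) -[X in _ = _ - X]/(1%:~R) -intrD -intrB;
    congr (_%:~R); ring.
- by rewrite map_inj_uniq ?iota_uniq // => i j [].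
move=> [[t1 t2] t3] ht /=; case: eqP => [e1|]; last by rewrite scaler0.
rewrite delta3E; case: eqP => [e2|]; last by rewrite scale0r.
case: t1 ht e2 => [j|j] ht e2; last by rewrite scale0r.
have [hj|hj] := ltnP j J; last by rewrite h ?scaler0.
case/negP: ht; apply/mapP; exists j; first by rewrite mem_iota.
by congr (_, _, _); move: e1 e2; clear; lia.
Qed.

Lemma expand1E (J : nat) n F q r : (forall j b, (J <= j)%N -> F (q - j%:Z) b = 0) ->
  expand1 n F q r = \sum_(j < J) sgnbin n j%:Z *: F (q - j%:Z) (r - n + j%:Z).
Proof.
move=> h; rewrite /expand1 (@fsum_seq _ _ [seq q - j%:Z | j <- iota 0 J]).
- rewrite big_map sum_iota; apply: eq_bigr => j _.
  by congr (sgnbin _ _ *: F _ _); ring.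
- by rewrite map_inj_uniq ?iota_uniq // => i j; lia.
move=> i hi; case E : (q - i) => [j|j]; last by rewrite scale0r.
have -> : i = q - j%:Z by rewrite -E; ring.
have [hj|hj] := ltnP j J; last by rewrite h ?scaler0.
case/negP: hi; apply/mapP; exists j; first by rewrite mem_iota.
by rewrite -E; ring.
Qed.

(* The Laurent series x^(-k) h(x) *)
Definition shifted_coef (k : nat) (h : nat -> R[i]) : int -> R[i] :=
  fun p => match p + k%:Z with Posz d => h d | Negz _ => 0 end.

(** Next to delta((x_2 - x_1) / (-x_0)) the variable -x_0 may be replaced by x_2 - x_1. Thus
    f_i(-x_0), where f_i = x^(-k) h_i, becomes h_i(x_2 - x_1) and lowers the exponent of the
    binomial by k. *)
Lemma delta_second (k s : nat) (h : 'I_s -> nat -> R[i]) (Q : 'I_s -> int -> int -> V) q0 p q r :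
  (forall i a b, a < q0 -> Q i a b = 0) -> (forall i, lowfin 1 (Q i)) ->
  mulser3 (fun p q r => - (-1) ^ p * delta3 R p r q)
    (fun p q r => \sum_(i < s) ((-1) ^ p * shifted_coef k (h i) p) *: Q i q r) p q r =
  - (-1) ^ p *: expand1 (- p - 1 - k%:Z) (\sum_(i < s) hact 1 (h i) (Q i)) q r.
Proof.
move=> hq hl; set n := - p - 1 - k%:Z.
pose J := (absz (q - q0)%R).+1.
have hJ i j b : (J <= j)%N -> Q i (q - j%:Z) b = 0.
  by move=> hj; apply: hq; move: hj; rewrite /J; clear; lia.
have /choice[Df hDf] (i : 'I_s) : exists D, forall (j D' : nat), (j < J)%N -> (D <= D')%N ->
    van2 1 D' (Q i) (q - j%:Z) (r - n + j%:Z).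
  apply: exists_uniform_bound => j _.
  have [D hD] := hl i (q - j%:Z) (r - n + j%:Z).
  by exists D => D' DD; exact: van2_le hD.
pose D := \max_(i < s) Df i.
have hD i j : (j < J)%N -> van2 1 D (Q i) (q - j%:Z) (r - n + j%:Z).
  by move=> hj; apply: (hDf i j D hj); rewrite /D leq_bigmax.
have sE (d j : nat) : Q^~ (q - j%:Z) =1 Q^~ (q - j%:Z) by [].
rewrite /mulser3 (@fsum_seq _ _ [seq (p + k%:Z - d%:Z, j%:Z, -1 - (p + k%:Z - d%:Z) - j%:Z) |
  d <- iota 0 D, j <- iota 0 J]).
- rewrite big_allpairs_dep sum_iota.
  transitivity (\sum_(d < D) \sum_(j < J) \sum_(i < s)
      (- (-1) ^ p * (h i d * sgnbin (n + d%:Z) j%:Z)) *: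
      Q i (q - j%:Z) (r - (n + d%:Z) + j%:Z)).
    apply: eq_bigr => d _; rewrite sum_iota; apply: eq_bigr => j _ /=.
    rewrite scaler_sumr; apply: eq_bigr => i _; rewrite scalerA delta3E.
    rewrite (_ : p + k%:Z - d%:Z + (-1 - (p + k%:Z - d%:Z) - j%:Z) + j%:Z == -1); last first.
      by apply/eqP; ring.
    have -> : p - (p + k%:Z - d%:Z) = d%:Z - k%:Z by ring.
    rewrite /shifted_coef subrK.
    have -> : - (p + k%:Z - d%:Z) - 1 = n + d%:Z by rewrite /n; ring.
    congr (_ *: Q _ _ _); last by rewrite /n; ring.
    have -> : (-1) ^ p = (-1) ^ (p + k%:Z - d%:Z) * (-1) ^ (d%:Z - k%:Z) :> R[i].
      by rewrite -expfzDr ?oppr_eq0 ?oner_eq0 //; congr (_ ^ _); ring.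
    rewrite /sgnbin; ring.
  transitivity (- (-1) ^ p *: \sum_(i < s) \sum_(d < D) h i d *:
      expand1 n (iter d (rdif 1) (Q i)) q r).
    under eq_bigr do rewrite exchange_big /=.
    rewrite exchange_big scaler_sumr; apply: eq_bigr => i _ /=.
    rewrite scaler_sumr; apply: eq_bigr => d _.
    rewrite (expand1_iter_rdif _ _ _ _ (hq i)) (expand1E _ _ (hJ i)).
    by rewrite !scaler_sumr; apply: eq_bigr => j _; rewrite !scalerA mulrA.
  congr (_ *: _); rewrite (@expand1E J) => [|j b hj]; last first.
    by rewrite !fct_sumE big1 // => i _; rewrite (hactE (D := 0)) ?big_ord0 // => i' j' _;
      rewrite hq //; move: hj; rewrite /J; clear; lia.
  transitivity (\sum_(i < s) \sum_(j < J) sgnbin n j%:Z *: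
      hact 1 (h i) (Q i) (q - j%:Z) (r - n + j%:Z)); last first.
    rewrite exchange_big /=; apply: eq_bigr => j _.
    by rewrite -scaler_sumr !fct_sumE.
  apply: eq_bigr => i _.
  transitivity (\sum_(d < D) \sum_(j < J) sgnbin n j%:Z *: (h i d *:
      iter d (rdif 1) (Q i) (q - j%:Z) (r - n + j%:Z))).
    apply: eq_bigr => d _; rewrite (@expand1E J) => [|j b hj].
      by rewrite scaler_sumr; apply: eq_bigr => j _; rewrite !scalerA mulrC.
    rewrite (iter_rdif_van (D := 0)) // => i' j' _.
    by rewrite hq //; move: hj; rewrite /J; clear; lia.
  rewrite exchange_big /=; apply: eq_bigr => j _.
  by rewrite -scaler_sumr (hactE _ (hD i j (ltn_ord j))).
- apply: allpairs_uniq; rewrite ?iota_uniq // => -[d j] [d' j'] _ _ /= [e1 e2 _].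
  by congr (_, _); move: e1 e2; clear; lia.
move=> [[t1 t2] t3] ht /=; rewrite delta3E.
case: eqP => [e|]; last by rewrite mulr0 scale0r.
case: t2 ht e => [j|j] ht e; last by rewrite mulr0 scale0r.
rewrite big1 ?scaler0 // => i _; rewrite /shifted_coef.
case E : (p - t1 + k%:Z) => [d|d]; last by rewrite mulr0 scale0r.
have [hj|hj] := ltnP j J; last by rewrite hJ ?scaler0.
have [hd|hd] := ltnP d D.
  case/negP: ht; apply/allpairsP; exists (d, j); split; rewrite ?mem_iota //=.
  by congr (_, _, _); move: E e; clear; lia.
have := hD i j hj 0%N d hd; rewrite mulr0 subr0 mul1r.
have -> : r - n + j%:Z - d%:Z = r - t3 by move: E e; rewrite /n; clear; lia.
by move=> ->; rewrite scaler0.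
Qed.

(** Up to signs, the left side at x_0^p is the difference of the two expansions of (x_1 -
    x_2)^(-p-1-k) H, a finite sum since H is truncated in both variables. [sgnbin_three_terms]
    evaluates it and Vandermonde's identity recognises H(x_2 + x_0, x_2). All exponents here are
    integers, hence [rdif 1] and [sb 1]. *)
Lemma jacobi_of_expansions (k s : nat) (h : 'I_s -> nat -> R[i]) (P S H : int -> int -> V)
    (Q : 'I_s -> int -> int -> V) (r0 q0 L : int) :
  (forall i j, j < r0 -> P i j = 0) ->
  (forall i a b, a < q0 -> Q i a b = 0) -> (forall i, lowfin 1 (Q i)) ->
  tr2 L H -> H = iter k (rdif 1) P -> H = \sum_(i < s) hact 1 (h i) (Q i) ->
  (forall a b, S a b = (-1) ^+ k *: sb 1 H (a + k%:Z) b) ->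
  forall p q r,
  mulser3 (delta3 R) (fun p q r => if p == 0 then P q r else 0) p q r -
  mulser3 (fun p q r => - (-1) ^ p * delta3 R p r q)
    (fun p q r => \sum_(i < s) ((-1) ^ p * shifted_coef k (h i) p) *: Q i q r) p q r =
  mulser3 (fun p q r => delta3 R r q p) (fun p q r => if q == 0 then S p r else 0) p q r.
Proof.
move=> hP hQ lQ tH HP HQ hS p q r.
rewrite (delta_first _ _ _ hP) (delta_second _ _ _ _ _ hQ lQ) -HQ.
set n := - p - 1 - k%:Z.
have sk : (-1) ^+ k * (-1) ^+ k = 1 :> R[i] by rewrite -expr2 sqrr_sign.
have -> : expand2 (- p - 1) P q r = (-1) ^+ k *: expand2 n H q r.
  rewrite HP (expand2_iter_rdif _ _ _ _ hP) scalerA sk scale1r.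
  by rewrite /n subrK.
pose K := (absz (q + r - n - L - L)%R).+1.
have tK i c : (i < L) || (L + K%:Z <= i) -> c *: H i (q + r - n - i) = 0.
  by move=> hi; rewrite tH ?scaler0 //; move: hi; rewrite /K; clear; lia.
rewrite /expand2 /expand1 !(@fsum_window _ _ L K); try by move=> i; exact: tK.
rewrite scaleNr opprK.
have sp : (-1) ^ p = - ((-1) ^+ k * (-1) ^ n) :> R[i].
  have e0 : -1 != 0 :> R[i] by rewrite oppr_eq0 oner_eq0.
  have -> : (-1) ^+ k = (-1) ^ k%:Z :> R[i] by [].
  rewrite -expfzDr // (_ : k%:Z + n = - (p + 1)); last by rewrite /n; ring.
  by rewrite signzN expfzDr // expr1z mulrN1 opprK.
(* For p + k < 0 the exponent n is nonnegative: both expansions are those of a polynomial and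
   cancel, while S has no terms to contribute. *)
case E : (p + k%:Z) => [e|e]; last first.
  rewrite (@delta_third 0) ?big_ord0; last first.
    move=> j b _; rewrite hS sb_neg ?scaler0 //; move: E; clear; lia.
  rewrite !scaler_sumr -big_split big1 //= => j _.
  have := @sgnbin_three_terms n (L + j%:Z - q + n) (q - (L + j%:Z)).
  have -> : - n - 1 = Negz e by rewrite -E /n; ring.
  have e1 : L + j%:Z - q + n + (q - (L + j%:Z)) = n by ring.
  move=> /(_ e1) h0; rewrite sp !scalerA -scalerDl mulNr -mulrA -mulrBr h0.
  by rewrite mulr0 scale0r.
rewrite (@delta_third e.+1); last first.
  by move=> j b hj; rewrite hS sb_neg ?scaler0 //; move: E hj; clear; lia.
transitivity (\sum_(j < K) ((-1) ^+ k * cbinom (L + j%:Z - q - 1)%:~R e) *: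
    H (L + j%:Z) (q + r - n - (L + j%:Z))).
  rewrite !scaler_sumr -big_split /=; apply: eq_bigr => j _.
  have := @sgnbin_three_terms n (L + j%:Z - q + n) (q - (L + j%:Z)).
  have -> : - n - 1 = e%:Z by rewrite -E /n; ring.
  have e1 : L + j%:Z - q + n + (q - (L + j%:Z)) = n by ring.
  move=> /(_ e1) h0; rewrite sp !scalerA -scalerDl mulNr -mulrA -mulrBr h0.
  by congr (_ * cbinom _%:~R _ *: _); ring.
(* Vandermonde for (- q - 1) + (L + j): x_0^l comes from (x_2 + x_0)^(-q-1) and x_0^(e-l) from the
   substitution in H. *)
transitivity (\sum_(l < e.+1) \sum_(j < K) ((-1) ^+ k * (cbinom (- q - 1)%:~R l *
    cbinom (L + j%:Z)%:~R (e - l))) *: H (L + j%:Z) (q + r - n - (L + j%:Z))).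
  rewrite exchange_big /=; apply: eq_bigr => j _.
  rewrite -scaler_suml -mulr_sumr vandermonde -intrD; congr (_ * cbinom _%:~R _ *: _).
  by ring.
apply: eq_bigr => l _; rewrite hS.
have le : (l <= e)%N by rewrite -ltnS.
have -> : p - l%:Z + k%:Z = (e - l)%N%:Z by rewrite -subzn // -E; ring.
rewrite /= (@fsum_window _ _ L K); last first.
  move=> i hi; have -> : r + q + 1 + l%:Z - i + 1%:Z * (e - l)%N%:Z = q + r - n - i.
    by rewrite -subzn // -E /n; ring.
  exact: tK.
rewrite !scaler_sumr; apply: eq_bigr => j _; rewrite !scalerA divr1.
congr (_ *: H _ _); first by ring.
by rewrite -subzn // -E /n; ring.
Qed.

End AbstractJacobi.

(** * Iterated substitutions *)

Section DoubleSubstitution.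
Variables (R : realType) (N : nat).
Hypothesis hN : (0 < N)%N.
Variable V : lmodType R[i].
Implicit Types (G : int -> int -> int -> V) (y s t p L : int).

Definition tr3 L G := forall y s t, [|| y < L, s < L | t < L] -> G y s t = 0.

Lemma fsum_big (T : choiceType) (K : nat) (g : 'I_K -> T -> V) :
  (forall u, fins (g u)) ->
  \sum_(n \in [set: T]) \sum_(u < K) g u n = \sum_(u < K) \sum_(n \in [set: T]) g u n.
Proof.
elim: K g => [|K IH] g h.
  rewrite big_ord0 fsbig1 // => n _; by rewrite big_ord0.
rewrite big_ord_recr /= -IH => [|u]; last exact: h.
rewrite -fsumD; last exact: h.
  by apply: eq_fsbigr => n _; rewrite big_ord_recr.
elim: K {IH} g h => [|K IH] g h.
  by exists [::] => x _; rewrite big_ord0.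
have [r hr] := IH (fun u => g (widen_ord (leqnSn _) u)) (fun u => h _).
have [r' hr'] := h (widen_ord (leqnSn K.+1) ord_max).
exists (r ++ r') => x; rewrite mem_cat negb_or => /andP[/hr e /hr' e'].
by rewrite big_ord_recr /= e' addr0.
Qed.

(* The substitutions s = t + x_2 and y = t + x_1, in this order. *)
Definition subst_sy G (i j p : int) : V := sb N (fun y p => sb N (G y) j p) i p.

(* The substitutions y = t + x_1 and s = t + x_2, in this order. *)
Definition subst_ys G (i j p : int) : V :=
  sb N (fun s p => sb N (fun y t => G y s t) i p) j p.

(* The substitutions y = s + x_0 and s = t + x_2, in this order. *)
Definition subst_iter G (q r p : int) : V :=
  sb N (fun n t => sb N (fun y s => G y s t) q n) r p.

Let Q x i : R[i] := cbinom (x%:~R / N%:R) i.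

(** The three exponents of G are at least L and add up to p + N (i + j), so the window K contains
    those of y and s. The resulting double sum is symmetric in the two substitutions. *)
Lemma subst_syE L G (i j K : nat) p : tr3 L G ->
  (p + N%:Z * (i + j)%:Z - L - L < L + K%:Z) ->
  subst_sy G i j p = \sum_(u < K) \sum_(v < K)
    (Q (L + u%:Z) i * Q (L + v%:Z) j) *: G (L + u%:Z) (L + v%:Z)
      (p + N%:Z * (i + j)%:Z - (L + u%:Z) - (L + v%:Z)).
Proof.
move=> t hK; rewrite -[LHS]/(\sum_(m \in [set: int])
  Q m i *: sb N (G m) j (p - m + N%:Z * i%:Z)).
have E y : sb N (G y) j (p - y + N%:Z * i%:Z) = \sum_(v < K)
    Q (L + v%:Z) j *: G y (L + v%:Z) (p + N%:Z * (i + j)%:Z - y - (L + v%:Z)).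
  have e s : p - y + N%:Z * i%:Z - s + N%:Z * j%:Z = p + N%:Z * (i + j)%:Z - y - s.
    by rewrite PoszD; ring.
  rewrite /= (@fsum_window _ _ L K) => [|s hs].
    by apply: eq_bigr => v _; rewrite e.
  rewrite e; have [hy|hy] := ltP y L; first by rewrite t ?hy ?scaler0.
  rewrite t ?scaler0 //; move: hs hy hK; clear.
  by move: (N%:Z * (i + j)%:Z) => z; lia.
rewrite (@fsum_window _ _ L K) => [|y hy].
  by apply: eq_bigr => u _; rewrite E scaler_sumr; apply: eq_bigr => v _; rewrite scalerA.
rewrite E big1 ?scaler0 // => v _; rewrite t ?scaler0 //.
move: hy hK; clear; move: (v : nat) (N%:Z * (i + j)%:Z) => v' z; lia.
Qed.

Lemma subst_sy_neg G i j p : (i < 0) || (j < 0) -> subst_sy G i j p = 0.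
Proof.
rewrite /subst_sy => /orP[h|h]; first by rewrite sb_neg.
case: i => // i; rewrite /= fsbig1 // => m _; rewrite sb_neg ?scaler0 //.
Qed.

Lemma subst_ysE L G (i j p : int) : tr3 L G -> subst_ys G i j p = subst_sy G i j p.
Proof.
move=> t; have t' : tr3 L (fun s y t => G y s t).
  by move=> s y t' h; apply: t; move: h; rewrite orbCA.
have -> : subst_ys G i j p = subst_sy (fun s y t => G y s t) j i p by [].
case: i => [i|i]; last by rewrite !subst_sy_neg ?orbT.
case: j => [j|j]; last by rewrite !subst_sy_neg ?orbT.
pose K := (absz (p + N%:Z * (i + j)%:Z - L - L - L)%R).+1.
have hK : p + N%:Z * (i + j)%:Z - L - L < L + K%:Z by rewrite /K; clear; lia.
rewrite (subst_syE t hK) (@subst_syE L _ j i K) //; last by rewrite addnC.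
rewrite exchange_big; apply: eq_bigr => u _; apply: eq_bigr => v _.
by rewrite mulrC [(j + i)%N]addnC; congr (_ *: G _ _ _); ring.
Qed.

(** Under y = s + x_0 the exponent of s grows by that of y, less q; hence the sum inside the second
    binomial. *)
Lemma subst_iterE L G (q r K : nat) p : tr3 L G ->
  (p + N%:Z * (q + r)%:Z - L - L < L + K%:Z) ->
  subst_iter G q r p = \sum_(u < K) \sum_(v < K)
    (Q (L + u%:Z) q * cbinom ((L + v%:Z)%:~R / N%:R + ((L + u%:Z)%:~R / N%:R - q%:R)) r) *:
      G (L + u%:Z) (L + v%:Z) (p + N%:Z * (q + r)%:Z - (L + u%:Z) - (L + v%:Z)).
Proof.
move=> t hK; rewrite -[LHS]/(\sum_(n \in [set: int])
  Q n r *: sb N (fun y s => G y s (p - n + N%:Z * r%:Z)) q n).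
have E n : Q n r *: sb N (fun y s => G y s (p - n + N%:Z * r%:Z)) q n =
    \sum_(u < K) (Q (L + u%:Z) q * Q n r) *:
      G (L + u%:Z) (n - (L + u%:Z) + N%:Z * q%:Z) (p - n + N%:Z * r%:Z).
  rewrite /= (@fsum_window _ _ L K) => [|y hy].
    by rewrite scaler_sumr; apply: eq_bigr => u _; rewrite scalerA mulrC.
  rewrite t ?scaler0 //; move: hy hK; rewrite PoszD mulrDr; clear.
  by move: (N%:Z * q%:Z) (N%:Z * r%:Z) => z z'; lia.
transitivity (\sum_(n \in [set: int]) \sum_(u < K) (Q (L + u%:Z) q * Q n r) *:
    G (L + u%:Z) (n - (L + u%:Z) + N%:Z * q%:Z) (p - n + N%:Z * r%:Z)).
  by apply: eq_fsbigr => n _; exact: E.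
rewrite fsum_big => [|u]; last first.
  apply: (@fins_window _ _ (L + (L + u%:Z) - N%:Z * q%:Z) (p + N%:Z * r%:Z - L)) => n hn.
  rewrite t ?scaler0 //; move: hn; clear.
  by move: (u : nat) (N%:Z * q%:Z) (N%:Z * r%:Z) => u' z z'; lia.
apply: eq_bigr => u _; rewrite -(fsum_shift _ (L + u%:Z - N%:Z * q%:Z)).
rewrite (@fsum_window _ _ L K) => [|s hs].
  apply: eq_bigr => v _; congr (_ * cbinom _ _ *: G _ _ _).
  - rewrite intrD intrB intrM mulrDl mulrBl.
    by rewrite [_ * q%:Z%:~R]mulrC mulfK // pnatr_eq0 -lt0n.
  - by ring.
  by rewrite PoszD; ring.
rewrite t ?scaler0 //; move: hs hK; rewrite PoszD mulrDr; clear.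
by move: (u : nat) (N%:Z * q%:Z) (N%:Z * r%:Z) => u' z z'; lia.
Qed.

Lemma subst_iter_neg G q r p : (q < 0) || (r < 0) -> subst_iter G q r p = 0.
Proof.
rewrite /subst_iter => /orP[h|h]; last by rewrite sb_neg.
case: r => // r; rewrite /= fsbig1 // => m _; rewrite sb_neg ?scaler0 //.
Qed.

(** This is t + (x_2 + x_0) = (t + x_2) + x_0. On coefficients, [cbinom_mul] rewrites binom(i, q)
    binom(u, i) and Vandermonde's identity sums over i. *)
Lemma sb_subst_sy L G (q r p : int) : tr3 L G ->
  sb 1 (fun i j => subst_sy G i j p) q r = subst_iter G q r p.
Proof.
move=> t; case: q => [q|q]; last by rewrite subst_iter_neg.
case: r => [r|r]; last first.
  rewrite subst_iter_neg ?orbT //= fsbig1 // => i _.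
  have [hi|hi] := ltP i 0; first by rewrite subst_sy_neg ?hi ?scaler0.
  have [hiq|hiq] := ltP i q%:Z.
    case: i hi hiq => // i _ hiq.
    by rewrite divr1 -[i%:Z%:~R]/(i%:R) cbinom_natr bin_small ?scale0r //; move: hiq; clear; lia.
  by rewrite subst_sy_neg ?scaler0 //; move: hiq; clear; lia.
pose K := (absz (p + N%:Z * (q + r)%:Z - L - L - L)%R).+1.
have hK : p + N%:Z * (q + r)%:Z - L - L < L + K%:Z by rewrite /K; clear; lia.
rewrite (subst_iterE t hK) /= (@fsum_window _ _ 0 (q + r).+1) => [|i hi]; last first.
  by rewrite subst_sy_neg ?scaler0 //; move: hi; clear; lia.
transitivity (\sum_(i < (q + r).+1) \sum_(u < K) \sum_(v < K)
    ('C(i, q)%:R * (Q (L + u%:Z) i * Q (L + v%:Z) (q + r - i))) *: G (L + u%:Z) (L + v%:Z)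
      (p + N%:Z * (q + r)%:Z - (L + u%:Z) - (L + v%:Z))).
  apply: eq_bigr => i _; rewrite add0r divr1 cbinom_natr.
  have hi : (i <= q + r)%N by rewrite -ltnS.
  have -> : r%:Z - i%:Z + 1%:Z * q%:Z = (q + r - i)%N%:Z by rewrite -subzn // PoszD; ring.
  rewrite (@subst_syE L _ i (q + r - i) K) ?subnKC // scaler_sumr.
  apply: eq_bigr => u _; rewrite scaler_sumr; apply: eq_bigr => v _.
  by rewrite scalerA.
rewrite exchange_big; apply: eq_bigr => u _ /=.
rewrite exchange_big; apply: eq_bigr => v _ /=; rewrite -scaler_suml.
congr (_ *: _); rewrite [_ / _ + (_ - _)]addrC -vandermonde mulr_sumr.
rewrite -addnS big_split_ord /= big1 ?add0r => [|i _]; last by rewrite bin_small ?mul0r.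
apply: eq_bigr => l _; have hl : (l <= r)%N by rewrite -ltnS.
have := @cbinom_mul R ((L + u%:Z)%:~R / N%:R) (q + l) q (leq_addr _ _).
rewrite cbinom_natr addKn subnDl /Q => e.
by rewrite [RHS]mulrA -e; ring.
Qed.

End DoubleSubstitution.

(** * Iterated vertex operators as iterated substitutions *)

Section Chains.
Variables (R : realType) (N : nat).
Hypothesis hN : (0 < N)%N.
Variable W : lmodType R[i].
Notation field := (W -> int -> W).
Implicit Types (F P Phi : int -> int -> int -> W) (a b c : field) (w : W).

Lemma iter_comm (X : Type) (f g : X -> X) k l x : (forall x, f (g x) = g (f x)) ->
  iter k f (iter l g x) = iter l g (iter k f x).
Proof.
move=> h; elim: k => //= k ->; elim: l => //= l IH.
by rewrite h IH.
Qed.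

Lemma subE_rdif (F Phi : int -> int -> W) :
  subE N F Phi -> subE N (rdif N F) (- shl 1 Phi).
Proof.
move=> h; have := subE_lin hN (-1) (subE_dif hN h) (subE_0 N W).
by rewrite !addr0 !scaleN1r rdifE.
Qed.

Lemma sub3_rst F Phi : sub3 N F Phi -> sub3 N (rst N F) (- shiftq Phi).
Proof. by move=> h y; exact: subE_rdif. Qed.

(* P(x_1, x_2, x) arises from Phi(y, x_2, x) by the substitution y = x + x_1. *)
Definition sub_y Phi P := forall j, subE N (fun y p => Phi y j p) (fun i p => P i j p).

(** Multiplication by minus the first variable: the image of t - y under y = t + x_1, and of s - y
    under y = s + x_0. *)
Definition shift1 P : int -> int -> int -> W := fun i j p => - P (i - 1) j p.

(** Multiplication by x_2 - x_1, the image of s - y. *)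
Definition diff12 P : int -> int -> int -> W := fun i j p => P i (j - 1) p - P (i - 1) j p.

Lemma sub_y_lin x Phi Phi' P P' : sub_y Phi P -> sub_y Phi' P' ->
  sub_y (x *: Phi + Phi') (x *: P + P').
Proof. by move=> h h' j; exact: (subE_lin hN x (h j) (h' j)). Qed.

Lemma sub_y0 : sub_y 0 0. Proof. by move=> j; exact: subE_0. Qed.

Lemma sub_y_ryt Phi P : sub_y Phi P -> sub_y (ryt N Phi) (shift1 P).
Proof. by move=> h j; exact: (subE_rdif (h j)). Qed.

Lemma sub_y_shiftq Phi P : sub_y Phi P -> sub_y (shiftq Phi) (shiftq P).
Proof. by move=> h j; exact: (h (j - 1)). Qed.

Lemma sub_yN Phi P : sub_y Phi P -> sub_y (- Phi) (- P).
Proof.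
move=> h; have := sub_y_lin (-1) h sub_y0.
by rewrite !addr0 !scaleN1r.
Qed.

Lemma sub_y_diff12 Phi P : sub_y Phi P -> sub_y (ryt N Phi + shiftq Phi) (diff12 P).
Proof.
move=> h; have := sub_y_lin 1 (sub_y_shiftq h) (sub_y_ryt h).
by rewrite !scale1r [X in sub_y X _]addrC.
Qed.

(* P(x_1, x_2, x) is F(x + x_1, x + x_2, x), where s = t + x_2 is substituted
   before y = t + x_1. *)
Definition sub_sy F P := exists2 Phi, sub3 N F Phi & sub_y Phi P.

Lemma sub_sy_rys F P : sub_sy F P -> sub_sy (rys N F) (diff12 P).
Proof.
by move=> [Phi h h']; exists (ryt N Phi + shiftq Phi); [exact: sub3_rys|exact: sub_y_diff12].
Qed.

Lemma sub_sy_ryt F P : sub_sy F P -> sub_sy (ryt N F) (shift1 P).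
Proof. by move=> [Phi h h']; exists (ryt N Phi); [exact: sub3_ryt|exact: sub_y_ryt]. Qed.

Lemma sub_sy_rst F P : sub_sy F P -> sub_sy (rst N F) (- shiftq P).
Proof.
move=> [Phi h h']; exists (- shiftq Phi); first exact: sub3_rst.
by apply: sub_yN; exact: sub_y_shiftq.
Qed.

Lemma sub_sy_lin x F F' P P' : sub_sy F P -> sub_sy F' P' ->
  sub_sy (x *: F + F') (x *: P + P').
Proof.
move=> [Phi h h'] [Phi' g g']; exists (x *: Phi + Phi'); first exact: sub3_lin.
exact: sub_y_lin.
Qed.

Lemma sub_sy0 : sub_sy 0 0.
Proof. by exists 0; [exact: sub3_0 | exact: sub_y0]. Qed.

Lemma sb_tr2_out (L : int) (G : int -> int -> W) (i : nat) p :
  tr2 L G -> p + N%:Z * i%:Z < L + L -> sb N G i p = 0.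
Proof.
move=> t hp; rewrite /= fsbig1 // => m _; rewrite t ?scaler0 //.
by move: hp; clear; move: (N%:Z * i%:Z) => z; lia.
Qed.

Lemma sb0 q p : sb N (0 : int -> int -> W) q p = 0.
Proof. by case: q => // q; rewrite /= fsbig1 // => m _; rewrite scaler0. Qed.

Lemma tr2_of_tr3 L F y : tr3 L F -> tr2 L (F y).
Proof. by move=> t s x h; apply: t; rewrite h orbT. Qed.

Lemma tr2_slice L F (j : int) : tr3 L F -> exists L', tr2 L' (fun y p => sb N (F y) j p).
Proof.
move=> t; case: j => [j|j]; last by exists 0.
exists (Order.min L (L + L - N%:Z * j%:Z)) => y p; rewrite !lt_min.
case/orP => /andP[h1 h2].
  rewrite (_ : F y = 0) ?sb0 //; apply/funext => s; apply/funext => x.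
  by rewrite t ?h1.
apply: (@sb_tr2_out L); first exact: tr2_of_tr3.
by move: h2; clear; move: (N%:Z * j%:Z) => z; lia.
Qed.

(** When F is truncated in all variables there is no pole to clear at either stage, and uniqueness
    of the substitution leaves only the explicit formula. *)
Lemma sub_sy_eq L F P : sub_sy F P -> tr3 L F -> forall i j p, P i j p = subst_sy N F i j p.
Proof.
move=> [Phi h h'] t i j p.
have PhiE y : Phi y = sb N (F y).
  exact: (subE_uniq hN (h y) (subE_sb N (@tr2_of_tr3 L F y t))).
have [L' t'] := tr2_slice j t.
have := h' j; rewrite (_ : (fun y p => Phi y j p) = fun y p => sb N (F y) j p); last first.
  by apply/funext => y; rewrite PhiE.
move=> /(subE_uniq hN (subE_sb N t')) E.
exact: esym (congr1 (fun f => f i p) E).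
Qed.

Lemma sub_sy_prod a b c w : linear a -> pair_compatible N b c ->
  (forall j, pair_compatible N a (YE N b c j)) ->
  sub_sy (fun y s t => a (b (c w t) s) y)
    (fun i j p => YE N a (YE N b c j) i w p).
Proof.
move=> la cbc ca; exists (fun y j p => a (YE N b c j w p) y).
  by move=> y; exact: (subE_map (lin_at y la) (subE_YE w cbc)).
by move=> j; exact: (subE_YE w (ca j)).
Qed.

Definition flip3 F : int -> int -> int -> W := fun s y t => F y s t.

(* As sub_sy, but y = t + x_1 is substituted before s = t + x_2. *)
Definition sub_ys F P := sub_sy (flip3 F) (flip3 P).

Lemma sub_ys_ryt F P : sub_ys F P -> sub_ys (ryt N F) (shift1 P).
Proof. by move=> h; exact: (sub_sy_rst h). Qed.

Lemma sub_ys_rst F P : sub_ys F P -> sub_ys (rst N F) (- shiftq P).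
Proof. by move=> h; exact: (sub_sy_ryt h). Qed.

Lemma sub_ys_lin x F F' P P' : sub_ys F P -> sub_ys F' P' ->
  sub_ys (x *: F + F') (x *: P + P').
Proof. by move=> h h'; exact: (sub_sy_lin x h h'). Qed.

Lemma sub_ys_eq L F P : sub_ys F P -> tr3 L F -> forall i j p, P i j p = subst_sy N F i j p.
Proof.
move=> h t i j p; rewrite -(subst_ysE N i j p t).
apply: (sub_sy_eq (L := L) h) => s y x hs; apply: t.
by move: hs; rewrite orbCA.
Qed.

(* P(x_0, x_2, x) is F(x + x_2 + x_0, x + x_2, x), where y = s + x_0 is
   substituted before s = t + x_2. *)
Definition sub_iter F P := exists2 Phi,
  forall t, subE N (fun y s => F y s t) (Phi t) &
  forall q, subE N (fun n t => Phi t q n) (fun r p => P q r p).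

Definition rot3 F : int -> int -> int -> W := fun t y s => F y s t.

Lemma sub_iter_lin x F F' P P' : sub_iter F P -> sub_iter F' P' ->
  sub_iter (x *: F + F') (x *: P + P').
Proof.
move=> [Phi h h'] [Phi' g g']; exists (x *: Phi + Phi').
  by move=> t; exact: (subE_lin hN x (h t) (g t)).
by move=> q; exact: (subE_lin hN x (h' q) (g' q)).
Qed.

Lemma sub_iter0 : sub_iter 0 0.
Proof. by exists 0 => *; exact: subE_0. Qed.

Lemma sub_iterN F P : sub_iter F P -> sub_iter (- F) (- P).
Proof.
move=> h; have := sub_iter_lin (-1) h sub_iter0.
by rewrite !addr0 !scaleN1r.
Qed.

Lemma sub_iter_rys F P : sub_iter F P -> sub_iter (rys N F) (shift1 P).
Proof.
move=> [Phi h h']; exists (- shiftq Phi) => [t|q].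
  exact: (subE_rdif (h t)).
have := subE_lin hN (-1) (h' (q - 1)) (subE_0 N W).
by rewrite !addr0 !scaleN1r.
Qed.

Lemma sub_iter_rst F P : sub_iter F P -> sub_iter (rst N F) (- shiftq P).
Proof.
move=> [Phi h h'].
suff : sub_iter (fun y s t => F y (s - N%:Z) t - F y s (t - N%:Z)) (shiftq P).
  move=> /sub_iterN; congr sub_iter; do 3!apply/funext => ?.
  by rewrite -[LHS]/(- (_ - _)) opprB.
exists (ryt N Phi) => [t|q]; first exact: (sub3_ryt hN (F := rot3 F) h).
exact: (subE_dif hN (h' q)).
Qed.

(** t - y becomes -x_0 - x_2. The proof treats y - t, for which [sub3_rys] applies to the arguments
    rotated by [rot3]. *)
Lemma sub_iter_ryt F P : sub_iter F P -> sub_iter (ryt N F) (shift1 P - shiftq P).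
Proof.
move=> [Phi h h'].
suff : sub_iter (fun y s t => F (y - N%:Z) s t - F y s (t - N%:Z))
    (shiftq P + fun q r p => P (q - 1) r p).
  move=> /sub_iterN; congr sub_iter; do 3!apply/funext => ?.
    by rewrite -[LHS]/(- (_ - _)) opprB.
  by rewrite -[LHS]/(- (_ + _)) opprD addrC.
exists (ryt N Phi + shiftq Phi) => [t|q]; first exact: (sub3_rys hN (F := rot3 F) h).
have := subE_lin hN 1 (subE_dif hN (h' q)) (h' (q - 1)).
by rewrite !scale1r.
Qed.

Lemma sub_iter_eq L F P : sub_iter F P -> tr3 L F ->
  forall q r p, P q r p = subst_iter N F q r p.
Proof.
move=> [Phi h h'] t q r p.
have t' x : tr2 L (fun y s => F y s x).
  by move=> y s hs; apply: t; move: hs => /orP[] ->; rewrite ?orbT.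
have PhiE x : Phi x = sb N (fun y s => F y s x).
  exact: (subE_uniq hN (h x) (subE_sb N (t' x))).
have [L' t2] : exists L', tr2 L' (fun n x => sb N (fun y s => F y s x) q n).
  case: (q) => [j|j]; last by exists 0.
  exists (Order.min L (L + L - N%:Z * j%:Z)) => n x; rewrite !lt_min.
  case/orP => /andP[h1 h2].
    apply: (sb_tr2_out (t' x)); move: h2; clear.
    by move: (N%:Z * j%:Z) => z; lia.
  rewrite (_ : (fun y s => F y s x) = 0) ?sb0 //; apply/funext => y; apply/funext => s.
  by rewrite t ?h1 ?orbT.
have := h' q; rewrite (_ : (fun n t => Phi t q n) =
    fun n x => sb N (fun y s => F y s x) q n); last first.
  by apply/funext => n; apply/funext => x; rewrite PhiE.
move=> /(subE_uniq hN (subE_sb N t2)) E.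
exact: esym (congr1 (fun f => f r p) E).
Qed.

Lemma sub_iter_prod a b c w : pair_compatible N a b ->
  (forall q, pair_compatible N (YE N a b q) c) ->
  sub_iter (fun y s t => a (b (c w t) s) y)
    (fun q r p => YE N (YE N a b q) c r w p).
Proof.
move=> cab cc; exists (fun t q n => YE N a b q (c w t) n) => [t|q].
  exact: (subE_YE (c w t) cab).
exact: (subE_YE w (cc q)).
Qed.

End Chains.

Arguments rst {R} N {W}.
Arguments shift1 {R W}.
Arguments diff12 {R W}.

(** * The common series behind the three terms of the Jacobi identity *)

Section JacobiData.
Variables (R : realType) (N : nat).
Hypothesis hN : (0 < N)%N.
Variable W : lmodType R[i].
Notation field := (W -> int -> W).
Implicit Types (P S : int -> int -> int -> W) (a b c : field) (w : W).

Lemma lowfin1_of_bounds (Q : int -> int -> W) (i0 : int) :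
  (forall i j, i < i0 -> Q i j = 0) ->
  (forall i, exists j0 : int, forall j, j < j0 -> Q i j = 0) -> lowfin 1 Q.
Proof.
move=> h h' m n; apply: (@exists_total_bound nat id (fun i j =>
  Q (m - 1%:Z * i%:Z) (n - 1%:Z * j%:Z) = 0)).
  exists (absz (m - i0)%R).+1 => i j hi; rewrite h //; move: hi; clear; lia.
move=> i; have [j0 hj] := h' (m - 1%:Z * i%:Z).
by exists (absz (n - j0)%R).+1 => j hj'; rewrite hj //; move: hj'; clear; lia.
Qed.

Lemma lowfin_swap (F : int -> int -> W) : lowfin N F -> lowfin N (fun m n => F n m).
Proof.
move=> h m n; have [D v] := h n m; exists D => i j ij.
by rewrite v // addnC.
Qed.

(** Under y = t + x_1 the factor h(s - y) turns into a Taylor expansion in x_1, and s = t + x_2 then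
    turns it into h(x_2 - x_1). The second stage is again a limit, along the same partial sums of
    h. *)
Lemma sub_ys_hact a b c (h : nat -> R[i]) w : EWN W a -> EWN W b -> EWN W c ->
  pair_compatible N a c -> (forall i, pair_compatible N b (YE N a c i)) ->
  sub_ys N (fun y s t => hact N h (fun m n => b (a (c w t) m) n) y s)
    (fun i j p => hact 1 h (fun i j => YE N b (YE N a c i) j w p) i j).
Proof.
move=> ha hb hc cac cb.
pose g := fun j => h j * (-1) ^+ j.
pose F0 s y t := b (a (c w t) y) s.
pose Phi s i p := b (YE N a c i w p) s.
have lb s := lin_at s hb.1.
have [i0 hi0] := YE_bounded hN cac.
pose S i := (absz (i - i0)%R).+1.
have hS i : i - (S i)%:Z < i0 by rewrite /S; clear; lia.
have sF : sub3 N F0 Phi by move=> s; exact: (subE_map (lb s) (subE_YE w cac)).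
have uF : utame N F0 := utame_prod hN w ha hc hb cac.
have eE i : EWN W (YE N a c i) := EWN_YE hN i ha hc cac.
have lP i : lowfin N (fun s p => Phi s i p).
  exact: (lowfin_swap (lowfin_prod hN w (eE i) hb)).
have bP s i p : i < i0 -> Phi s i p = 0.
  by move=> hi; rewrite /Phi hi0 // (lin0 (lb s)).
have E : flip3 (fun y s t => hact N h (fun m n => b (a (c w t) m) n) y s) =
    hact_ys N g F0.
  do 3!apply/funext => ?.
  exact: (hact_swap N h (fun n m => b (a (c w _) m) n)).
rewrite /sub_ys E; exists (fun s i p =>
    \sum_(l < S i) hact N (divder g l) (fun s p => Phi s (i - l%:Z) p) s p).
  exact: (sub3_hact_ys hN g uF sF lP bP hS).
move=> i; pose Q j i p := YE N b (YE N a c i) j w p.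
pose op (X : int -> int -> int -> W) := ryt N X + shiftq X.
have sQ : sub_y N Phi Q by move=> i'; exact: (subE_YE w (cb i')).
(* At the exponent i of x_1 the partial sums involve only the exponents i - l. Those below i0 give
   0, so finitely many pole orders have to be dominated. *)
have [k [L hk]] : exists k L, forall l : nat,
    tr2 L (iter k (dif N) (fun s p => Phi s (i - l%:Z) p)).
  have [l _|k hk] := @exists_uniform_bound (S i) (fun l k => exists L,
      tr2 L (iter k (dif N) (fun s p => Phi s (i - l%:Z) p))).
  - have [k [L [t _]]] := sQ (i - l%:Z).
    by exists k => k' kk; exists L; exact: tr2_iter_le kk t.
  - have [||L hL] := @common_lower_bound 'I_(S i) (fun l L =>
        tr2 L (iter k (dif N) (fun s p => Phi s (i - l%:Z) p))).
    + by move=> l L L' LL; exact: tr2_le.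
    + by move=> l; have [L hL] := hk l k (ltn_ord l) (leqnn _); exists L.
    exists k, L => l; have [hl|hl] := ltnP l (S i); first exact: (hL (Ordinal hl)).
    have -> : (fun s p => Phi s (i - l%:Z) p) = 0.
      apply/funext => s; apply/funext => p; apply: bP.
      by move: hl (hS i); clear; move: (S i) => z; lia.
    move=> m n _; elim: k {hk hL} m n => // k IH m n.
    by rewrite iterS /dif !IH subr0.
apply: (@subE_lim _ _ hN _ k L
  (fun M => fun s p => (\sum_(j < M) g j *: iter j op Phi) s i p)
  (fun M => fun j p => (\sum_(l < M) g l *: iter l (diff12) Q) j i p)).
- move=> M.
  pose U (X : int -> int -> int -> W) := forall l : nat,
    tr2 L (iter k (dif N) (fun s p => X s (i - l%:Z) p)).
  suff /(_ 0%N) : U (\sum_(j < M) g j *: iter j op Phi) by rewrite subr0.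
  apply: (@psum_rel _ _ _ (fun X _ => U X) op op g M Phi Phi) => //.
  + move=> l m n _; elim: k {hk U} m n => // k IH m n.
    by rewrite iterS /dif !IH subr0.
  + move=> x X _ Y _ hX hY l.
    rewrite -[X in iter k _ X]/(x *: (fun s p => X s (i - l%:Z) p) +
      (fun s p => Y s (i - l%:Z) p)) iter_dif_lin.
    exact: tr2_lin.
  move=> X _ hX l.
  have -> : (fun s p => op X s (i - l%:Z) p) = -1 *: (shl N%:Z (fun s p => X s (i - l%:Z) p)) +
      (1 *: (shr N (fun s p => X s (i - l%:Z) p)) + (fun s p => X s (i - l.+1%:Z) p)).
    apply/funext => s; apply/funext => p; rewrite !fctE /= scaleN1r scale1r addrA [- _ + _]addrC.
    rewrite -[LHS]/(_ - _ + X s (i - l%:Z - 1) p).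
    by have -> : i - l%:Z - 1 = i - l.+1%:Z by lia.
  rewrite !iter_dif_lin iter_dif_shl iter_dif_shr.
  apply: tr2_lin; first exact: tr2_shl.
  by apply: tr2_lin; first exact: tr2_shr.
- by move=> s p; exact: (@evto_hact_ys_taylor _ _ _ g Phi i0 S s i p lP bP hS).
- move=> M; suff /(_ i) : sub_y N (\sum_(j < M) g j *: iter j op Phi)
      (\sum_(l < M) g l *: iter l (diff12) Q) by [].
  apply: (@psum_rel _ _ _ (@sub_y R N W) op (diff12) g M Phi Q) => //.
  + exact: sub_y0.
  + by move=> *; exact: (sub_y_lin hN).
  by move=> *; exact: (sub_y_diff12 hN).
move=> j p.
have l1 : lowfin 1 (fun i j => Q j i p).
  apply: (@lowfin1_of_bounds _ i0).
    move=> i' j' hi; rewrite /Q hi0 //.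
    have c0 : pair_compatible N b 0 by have := cb i'; rewrite hi0.
    have -> : YE N b 0 j' = 0; last by [].
    have := @YE_lin_r _ _ hN _ (-1) b 0 0 j' hb.1 c0 c0.
    by rewrite scaler0 addr0 scaleN1r addNr; apply.
  move=> i'; have [j0 hj] := YE_bounded hN (cb i').
  by exists j0 => j' hj'; rewrite /Q hj.
have := hact_evto h i j l1; apply: (evto_eq (M0 := 0%N)) => M _.
rewrite !fct_sumE; apply: eq_bigr => n _; rewrite -[RHS]/(g n *: _).
rewrite /g -scalerA; congr (_ *: _).
elim: (n : nat) i j {l1 hk k L} => [|n' IH] i' j' //.
  by rewrite scale1r.
rewrite iterS /rdif !IH [in RHS]iterS /diff12 exprS mulN1r scaleNr -scalerBr -scalerN opprB.
by [].
Qed.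

Lemma RF_family (A B : set field) G : A `<=` EWN W -> B `<=` EWN W -> RF N A B G ->
  exists (s : nat) (h : 'I_s -> nat -> R[i]) (a' b' : 'I_s -> field),
    (forall i, A (a' i) /\ B (b' i)) /\
    forall w, G w = \sum_(i < s) hact N (h i) (fun m n => b' i (a' i w m) n).
Proof.
move=> hA hB; elim=> [|x G1 G2 _ [s1 [h1 [a1 [b1 [m1 e1]]]]] _ [s2 [h2 [a2 [b2 [m2 e2]]]]]|h a b ha hb].
- exists 0%N, (fun _ _ => 0), (fun _ => 0), (fun _ => 0); split; first by case.
  by move=> w; rewrite big_ord0.
- pose pick T (f1 : 'I_s1 -> T) (f2 : 'I_s2 -> T) (i : 'I_(s1 + s2)) :=
    match fintype.split i with inl j => f1 j | inr j => f2 j end.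
  exists (s1 + s2)%N, (pick _ (fun j n => x * h1 j n) h2), (pick _ a1 a2), (pick _ b1 b2).
  split; first by move=> i; rewrite /pick; case: fintype.split.
  move=> w; rewrite -[LHS]/(x *: G1 w + G2 w) e1 e2 big_split_ord /= scaler_sumr.
  congr (_ + _); apply: eq_bigr => i _.
    rewrite /pick (_ : fintype.split (lshift s2 i) = inl i); last exact: (unsplitK (inl i)).
    rewrite hact_scale //; exact: (lowfin_prod hN w (hA _ (m1 i).1) (hB _ (m1 i).2)).
  by rewrite /pick (_ : fintype.split (rshift s1 i) = inr i) //; exact: (unsplitK (inr i)).
exists 1%N, (fun=> h), (fun=> a), (fun=> b); split=> // w.
by rewrite big_ord1.
Qed.

(* The power series x^e h(x) *)
Definition hshift (e : nat) (h : nat -> R[i]) : nat -> R[i] :=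
  fun d => if (d < e)%N then 0 else h (d - e)%N.

Lemma hact_hshift e h (F : int -> int -> W) : lowfin N F ->
  hact N (hshift e h) F = iter e (rdif N) (hact N h F).
Proof.
elim: e h => [|e IH] h f.
  by congr hact; apply/funext => d; rewrite /hshift subn0.
have f' := lowfin_hact h f.
have -> : hshift e.+1 h = hshift e (hshift 1 h).
  apply/funext => d; rewrite /hshift; case: ltnP => h1; case: ltnP => h2 //.
  - by rewrite ifT //; lia.
  - by exfalso; lia.
  - by rewrite ifF; [congr h; lia | lia].
rewrite IH // iterSr; congr iter; apply/funext => m; apply/funext => n.
rewrite -hact_rdif //; have [D v] := f m n.
have v1 : van2 N D.+1 F m n by apply: van2_le v.
rewrite (hactE _ v1) (hactE _ (van2_rdif v1)) big_ord_recl /= scale0r add0r.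
by apply: eq_bigr => j _; rewrite /hshift /= subn1 /= -iterSr.
Qed.

(** x^(-k) h = x^(-k-e) (x^e h): the cleared pole order can be adapted to the third vector while the
    Laurent series of the Jacobi identity stays the same. *)
Lemma shifted_coef_hshift k e (h : nat -> R[i]) :
  shifted_coef (k + e) (hshift e h) = shifted_coef k h.
Proof.
apply/funext => p; rewrite /shifted_coef /hshift PoszD addrA.
case: (p + k%:Z) => d.
  by rewrite -PoszD ltnNge leq_addl /= addnK.
case E : (Negz d + e%:Z) => [d'|d'] //.
by rewrite ifT //; lia.
Qed.

Definition shiftI S : int -> int -> int -> W := fun q r p => S (q - 1) r p.
(** Multiplication by x_2 + x_0, the image of y - t under the iterated substitution. *)
Definition sumshift S : int -> int -> int -> W := fun q r p => S q (r - 1) p + S (q - 1) r p.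

Lemma iter_opp (X : lmodType R[i]) (f : X -> X) k x : linear f ->
  iter k (fun y => - f y) x = (-1) ^+ k *: iter k f x.
Proof.
move=> lf; elim: k => [|k IH]; first by rewrite scale1r.
by rewrite !iterS IH (linZ lf) exprS mulN1r scaleNr.
Qed.

Lemma iter_shiftI k S q r p : iter k shiftI S q r p = S (q - k%:Z) r p.
Proof.
elim: k q => [|k IH] q; first by rewrite subr0.
by rewrite iterS /shiftI IH; congr S; lia.
Qed.

Lemma iter_shiftq k S q r p : iter k shiftq S q r p = S q (r - k%:Z) p.
Proof.
elim: k r => [|k IH] r; first by rewrite subr0.
by rewrite iterS /shiftq IH; congr S; lia.
Qed.

(** Multiplication by x_2 + x_0 loses nothing on series bounded below in x_0: the coefficients are
    recovered by induction on the exponent of x_0. *)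
Lemma iter_sumshift_inj k q0 S :
  (forall q r p, q < q0 -> S q r p = 0) -> iter k sumshift S = 0 -> S = 0.
Proof.
move=> hS; elim: k => // k IH; rewrite iterS => e; apply: IH.
have : forall q r p, q < q0 -> iter k sumshift S q r p = 0.
  elim: k {e} => [|k IHk] q r p hq; first exact: hS.
  by rewrite iterS /sumshift !IHk ?addr0 //; lia.
move: (iter k sumshift S) e => Z e z.
apply/funext => q; apply/funext => r; apply/funext => p. rewrite -[RHS]/(0 : W).
have [d] := int_lt_shift q q0; elim: d q r => [|d IHd] q r hq.
  by rewrite z //; move: hq; rewrite addr0.
have := congr1 (fun f => f q (r + 1) p) e; rewrite -[LHS]/(Z q (r + 1 - 1) p + Z (q - 1) (r + 1) p).
rewrite addrK (IHd (q - 1)); last by move: hq; clear; lia.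
by rewrite addr0.
Qed.

Lemma linear_shiftI : linear shiftI. Proof. by []. Qed.
Lemma linear_shiftq3 : linear (@shiftq R W). Proof. by []. Qed.
Lemma linear_sumshift : linear sumshift.
Proof.
move=> x S S'; do 3!apply/funext => ?.
by rewrite /sumshift !fctE /= scalerDr addrACA.
Qed.

Lemma iter_linear (X : lmodType R[i]) (f : X -> X) k : linear f -> linear (iter k f).
Proof. by move=> lf; elim: k => [|k IH] x u v //=; rewrite IH lf. Qed.

Lemma sb1_shifts (L : int) k S q r p :
  (forall p, tr2 L (fun i j => S i j p)) ->
  sb 1 (fun i j => S (i - k%:Z) (j - k%:Z) p) q r =
  iter k sumshift (iter k shiftq (fun q r p => sb 1 (fun i j => S i j p) q r)) q r p.
Proof.
move=> t.
have -> : (fun i j => S (i - k%:Z) (j - k%:Z) p) = fun i j => iter k shiftI (iter k shiftq S) i j p.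
  by apply/funext => i; apply/funext => j; rewrite iter_shiftI iter_shiftq.
have t1 p' : tr2 L (fun i j => iter k shiftq S i j p').
  by move=> i j h; rewrite iter_shiftq t //; lia.
have -> : iter k shiftq (fun q r p => sb 1 (fun i j => S i j p) q r) =
    fun q r p => sb 1 (fun i j => iter k shiftq S i j p) q r.
  elim: k {t1} => // k IH; rewrite iterS IH; apply/funext => x; apply/funext => y; apply/funext => z.
  exact: esym (@sb_shr R 1 isT W (fun i j => iter k shiftq S i j z) x y).
move: (iter k shiftq S) t1 => {}S {}t.
elim: k q r p => // k IH q r p.
rewrite [in RHS]iterS /sumshift -!IH iterS.
have tk : tr2 L (fun i j => iter k shiftI S i j p).
  by move=> i j h; rewrite iter_shiftI t //; lia.
exact: (sb_shl (isT : (0 < 1)%N) q r tk).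
Qed.

Lemma rys_ryt_comm (F : int -> int -> int -> W) : rys N (ryt N F) = ryt N (rys N F).
Proof.
apply/funext => y; apply/funext => s; apply/funext => t.
by rewrite /rys /ryt !opprB addrACA [RHS]addrACA [- _ - _]addrC.
Qed.

Lemma rys_rst_comm (F : int -> int -> int -> W) : rys N (rst N F) = rst N (rys N F).
Proof.
apply/funext => y; apply/funext => s; apply/funext => t.
by rewrite /rst /rdif /rys !opprB addrACA [RHS]addrACA [- _ - _]addrC.
Qed.

Lemma iter_diff12 k (P : int -> int -> int -> W) i j p :
  iter k diff12 P i j p = iter k (rdif 1) (fun i j => P i j p) i j.
Proof. by elim: k i j => // k IH i j; rewrite !iterS /diff12 /rdif !IH. Qed.

Lemma iter_rdif_sum k s (X : 'I_s -> int -> int -> W) :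
  iter k (rdif N) (\sum_(i < s) X i) = \sum_(i < s) iter k (rdif N) (X i).
Proof.
have l x X1 X2 := @iter_rdif_lin R N W k x X1 X2.
apply: (big_morph (iter k (rdif N))) => [x y|].
  by have := l 1 x y; rewrite !scale1r.
by have := l (-1) 0 0; rewrite !scaleN1r !addNr.
Qed.

Lemma iter_shift1 k S : iter k shift1 S = (-1) ^+ k *: iter k shiftI S.
Proof. exact: (iter_opp k S linear_shiftI). Qed.

Definition oppshiftq S : int -> int -> int -> W := - shiftq S.

Lemma iter_oppshiftq k S : iter k oppshiftq S = (-1) ^+ k *: iter k shiftq S.
Proof. exact: (iter_opp k S linear_shiftq3). Qed.

Lemma sub_ys_sum s (F P : 'I_s -> int -> int -> int -> W) :
  (forall i, sub_ys N (F i) (P i)) -> sub_ys N (\sum_(i < s) F i) (\sum_(i < s) P i).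
Proof.
move=> h; elim/big_rec2: _ => [|i x y _ hxy]; first exact: (sub_sy0 N).
by have := sub_ys_lin hN 1 (h i) hxy; rewrite !scale1r.
Qed.

(** K factors are needed for locality of a and b, and e factors to truncate the triple product.
    Substituting in G gives x_1^k x_2^k H with nonnegative exponents only, whence the bound -k,
    which depends on neither w nor p. *)
Lemma jacobi_data (A : set field) a b c K s (h : 'I_s -> nat -> R[i]) (a' b' : 'I_s -> field) :
  A `<=` EWN W -> slocal N A A -> (forall a b q, A a -> A b -> A (YE N a b q)) ->
  A a -> A b -> A c -> (forall i, A (a' i) /\ A (b' i)) ->
  (forall w, iter K (rdif N) (prod2 a b w) =
    \sum_(i < s) hact N (h i) (fun m n => b' i (a' i w m) n)) ->
  exists e, forall w p,
    let k := (K + e)%N in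
    let H := iter k (rdif 1) (fun i j => YE N a (YE N b c j) i w p) in
    [/\ tr2 (- k%:Z) H,
      H = \sum_(i < s) hact 1 (hshift e (h i)) (fun x y => YE N (b' i) (YE N (a' i) c x) y w p)
    & forall x y, YE N (YE N a b x) c y w p = (-1) ^+ k *: sb 1 H (x + k%:Z) y].
Proof.
move=> hA hS YA ha hb hc hab E.
have cA x y (hx : A x) (hy : A y) : pair_compatible N x y := slocal_compatible hN hA hA hS hx hy.
have [e he] := slocal_triple hN hA hS ha hb hc.
exists e => w p k H.
have ek : (e <= k)%N by rewrite /k leq_addl.
pose F y s t := a (b (c w t) s) y.
have [L hL] := he k ek w.
set G := iter k (rys N) (iter k (ryt N) (iter k (rst N) F)) in hL.
have tG : tr3 L G by exact: hL.
have sn : (-1) ^+ k * (-1) ^+ k = 1 :> R[i] by rewrite -expr2 sqrr_sign.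
have sh X i j p' : iter k shift1 (iter k oppshiftq X) i j p' = X (i - k%:Z) (j - k%:Z) p' :> W.
  rewrite iter_shift1 iter_oppshiftq (linZ (iter_linear k linear_shiftI)) scalerA sn scale1r.
  by rewrite iter_shiftI iter_shiftq.
pose P3 i j p := YE N a (YE N b c j) i w p.
pose H3 := iter k diff12 P3.
have H3E : H = fun i j => H3 i j p.
  by apply/funext => i; apply/funext => j; rewrite /H3 iter_diff12.
have HE i j p' : H3 (i - k%:Z) (j - k%:Z) p' = subst_sy N G i j p'.
  have : sub_sy N G (iter k diff12 (iter k shift1 (iter k oppshiftq P3))).
    have s0 : sub_sy N F P3.
      by apply: sub_sy_prod => [||j']; [exact: (hA _ ha).1|exact: cA|apply: cA => //; exact: YA].
    have s1 : sub_sy N (iter k (rst N) F) (iter k oppshiftq P3).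
      by elim: (k) => // k' IH; exact: (sub_sy_rst hN IH).
    have s2 : sub_sy N (iter k (ryt N) (iter k (rst N) F)) (iter k shift1 (iter k oppshiftq P3)).
      by elim: {1 3}(k) => // k' IH; exact: (sub_sy_ryt hN IH).
    by rewrite /G; elim: {1 4}(k) => // k' IH; exact: (sub_sy_rys hN IH).
  rewrite iter_comm; last first.
    move=> X; apply/funext => x; apply/funext => y; apply/funext => z.
    by rewrite /shift1 /diff12 opprB opprK addrC.
  rewrite (@iter_comm _ diff12 oppshiftq) //; last first.
    move=> X; apply/funext => x; apply/funext => y; apply/funext => z.
    rewrite /diff12 /oppshiftq -[LHS]/(- X x (y - 1 - 1) z - (- X (x - 1) (y - 1) z)).
    by rewrite -[RHS]/(- (_ - _)) opprB opprK addrC.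
  by move=> /(sub_sy_eq hN)/(_ tG i j p') <-; rewrite sh.
have H3t p' : tr2 (- k%:Z) (fun i j => H3 i j p').
  move=> i j hij; have := HE (i + k%:Z) (j + k%:Z) p'; rewrite !addrK => ->.
  by rewrite subst_sy_neg //; move: hij; clear; lia.
split; first by rewrite H3E.
- pose B := \sum_(i < s) fun x y p => hact 1 (hshift e (h i))
      (fun x y => YE N (b' i) (YE N (a' i) c x) y w p) x y.
  have BE : sub_ys N (iter k (rys N) F) B.
    have -> : iter k (rys N) F = \sum_(i < s) fun y s t =>
        hact N (hshift e (h i)) (fun m n => b' i (a' i (c w t) m) n) y s.
      apply/funext => y; apply/funext => x; apply/funext => t.
      rewrite iter_rys /k addnC iterD (E (c w t)) iter_rdif_sum !fct_sumE.
      apply: eq_bigr => i _; rewrite hact_hshift //.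
      exact: (lowfin_prod hN _ (hA _ (hab i).1) (hA _ (hab i).2)).
    apply: sub_ys_sum => i; have [h1 h2] := hab i.
    apply: sub_ys_hact; [exact: hA|exact: hA|exact: hA|exact: cA|].
    by move=> j; apply: cA => //; exact: YA.
  have : sub_ys N G (iter k shift1 (iter k oppshiftq B)).
    have s1 : sub_ys N (iter k (rst N) (iter k (rys N) F)) (iter k oppshiftq B).
      by elim: {1 3}(k) => // k' IH; exact: (sub_ys_rst hN IH).
    have s2 : sub_ys N (iter k (ryt N) (iter k (rst N) (iter k (rys N) F)))
        (iter k shift1 (iter k oppshiftq B)).
      by elim: {1 4}(k) => // k' IH; exact: (sub_ys_ryt hN IH).
    move: s2; rewrite -(iter_comm _ _ _ rys_rst_comm) -(iter_comm _ _ _ rys_ryt_comm).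
    exact.
  move=> /(sub_ys_eq hN)/(_ tG) BG.
  rewrite H3E; apply/funext => i; apply/funext => j.
  have := BG (i + k%:Z) (j + k%:Z) p; rewrite sh -HE !addrK => <-.
  by rewrite /B !fct_sumE.
pose R3 q r p := YE N (YE N a b q) c r w p.
pose SB q r p := sb 1 (fun i j => H3 i j p) q r.
have cab := cA _ _ ha hb.
have [q0 hq0] := YE_bounded hN cab.
have R3b q r p' : q < q0 -> R3 q r p' = 0.
  move=> hq; rewrite /R3 hq0 //.
  have c0 : pair_compatible N 0 c by have := cA _ _ (YA _ _ q ha hb) hc; rewrite hq0.
  have -> : YE N 0 c r = 0; last by [].
  have := @YE_lin_l _ _ hN _ (-1) 0 0 c r c0 c0.
  by rewrite scaler0 addr0 scaleN1r addNr; apply.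
(* The factors t - s, t - y and s - y become -x_2, -(x_0 + x_2) and -x_0; the three k-th powers
   leave the sign (-1)^k. *)
have RE : iter k sumshift (iter k shiftq SB) =
    (-1) ^+ k *: iter k sumshift (iter k shiftI (iter k shiftq R3)).
  have : sub_iter N G (iter k shift1 (iter k (fun P => shift1 P - shiftq P) (iter k oppshiftq R3))).
    have s0 : sub_iter N F R3 by apply: sub_iter_prod => // q; apply: cA => //; exact: YA.
    have s1 : sub_iter N (iter k (rst N) F) (iter k oppshiftq R3).
      by elim: (k) => // k' IH; exact: (sub_iter_rst hN IH).
    have s2 : sub_iter N (iter k (ryt N) (iter k (rst N) F))
        (iter k (fun P => shift1 P - shiftq P) (iter k oppshiftq R3)).
      by elim: {1 3}(k) => // k' IH; exact: (sub_iter_ryt hN IH).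
    by rewrite /G; elim: {1 4}(k) => // k' IH; exact: (sub_iter_rys hN IH).
  move=> /(sub_iter_eq hN)/(_ tG) e1.
  apply/funext => q; apply/funext => r; apply/funext => p'.
  rewrite -(sb1_shifts k q r p' H3t).
  rewrite (_ : (fun i j => _) = fun i j => subst_sy N G i j p'); last first.
    by apply/funext => i; apply/funext => j; exact: HE.
  rewrite (sb_subst_sy hN _ _ _ tG) -e1.
  have opE : (fun P => shift1 P - shiftq P) = (fun P => - sumshift P).
    apply/funext => X; apply/funext => x; apply/funext => y; apply/funext => z.
    by rewrite -[RHS]/(- (_ + _)) opprD addrC.
  rewrite opE (iter_opp _ _ linear_sumshift) iter_oppshiftq iter_shift1.
  rewrite (linZ (iter_linear k linear_sumshift)) !(linZ (iter_linear k linear_shiftI)).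
  rewrite !scalerA sn mulr1; congr ((_ *: _) _ _ _).
  apply: iter_comm => X.
  by apply/funext => x; apply/funext => y; apply/funext => z.
have lS := iter_linear k linear_sumshift.
have : iter k shiftq SB - (-1) ^+ k *: iter k shiftI (iter k shiftq R3) = 0.
  (* A substituted series has no negative power of x_0, and x_0^k [R3] starts at q0 + k. *)
  apply: (@iter_sumshift_inj k (Order.min 0 (q0 + k%:Z))).
    move=> q r p'; rewrite lt_min => /andP[h1 h2].
    rewrite -[LHS]/(iter k shiftq SB q r p' -
      (-1) ^+ k *: iter k shiftI (iter k shiftq R3) q r p').
    rewrite iter_shiftI !iter_shiftq /SB sb_neg // R3b ?scaler0 ?subr0 //.
    by move: h2; clear; lia.
  by rewrite (linB lS) (linZ lS) RE subrr.
move=> /subr0_eq e1 x y; have := congr1 (fun f => f (x + k%:Z) (y + k%:Z) p) e1.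
rewrite /= -[RHS]/((-1) ^+ k *: iter k shiftI (iter k shiftq R3) (x + k%:Z) (y + k%:Z) p).
rewrite iter_shiftI !iter_shiftq !addrK /SB -H3E => ->.
by rewrite scalerA sn scale1r.
Qed.

End JacobiData.

(** * Vacuum and creation properties *)

Section Vacuum.
Variables (R : realType) (N : nat).
Hypothesis hN : (0 < N)%N.
Variable W : lmodType R[i].
Notation field := (W -> int -> W).
Implicit Types (a b : field).

Lemma tr2_vacuum_l b w : EWN W b -> exists L : int, tr2 L (prod2 (idser W) b w).
Proof.
move=> hb; have [L h] := hb.2 w; exists (Order.min 0 L) => m n.
rewrite !lt_min /prod2 /idser => /orP[/andP[h1 _]|/andP[_ h2]].
  by rewrite lt_eqF.
by rewrite h //; case: ifP.
Qed.

Lemma tr2_vacuum_r a w : EWN W a -> exists L : int, tr2 L (prod2 a (idser W) w).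
Proof.
move=> ha; have [L h] := ha.2 w; exists (Order.min 0 L) => m n.
rewrite !lt_min /prod2 /idser => /orP[/andP[_ h2]|/andP[h1 _]].
  by case: eqP => _; [exact: h|exact: (field0 _ ha.1)].
by rewrite lt_eqF // (field0 _ ha.1).
Qed.

(** With no pole to clear, uniqueness identifies [YE] with the plain substitution, whichever
    exponent its definition selects. *)
Lemma YE_of_tr2 a b w q p : EWN W a -> EWN W b ->
  (forall w, exists L : int, tr2 L (prod2 a b w)) ->
  YE N a b q w p = sb N (prod2 a b w) q p.
Proof.
move=> ha hb h.
have c : pair_compatible N a b.
  by exists 0%N; split; [exact: linear_prod2 ha.1 hb.1|exact: h].
have [L hL] := h w.
by rewrite (subE_uniq hN (subE_sb N hL) (subE_YE w c)).
Qed.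

Lemma YE_vacuum_l b q : EWN W b -> YE N (idser W) b q = if q == 0 then b else 0.
Proof.
move=> hb; apply/funext => w; apply/funext => p.
rewrite YE_of_tr2 //; [|exact: EWN_idser|by move=> w'; exact: tr2_vacuum_l].
case: q => q; last by rewrite sb_neg.
rewrite /= (@fsum_window _ _ 0 1) => [|m hm]; last first.
  rewrite /prod2 /idser; have -> : (m == 0) = false by move: hm; clear; lia.
  by rewrite scaler0.
rewrite big_ord1 /prod2 /idser /= mul0r.
case: q => [|q]; first by rewrite cbinom0 scale1r subr0 mulr0 addr0.
by rewrite /cbinom big_ord_recl subrr !mul0r scale0r.
Qed.

Lemma YE_vacuum_r a q : EWN W a ->
  (q < 0 -> YE N a (idser W) q = 0) /\ YE N a (idser W) 0 = a.
Proof.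
move=> ha; have E w q' p : YE N a (idser W) q' w p = sb N (prod2 a (idser W) w) q' p.
  by rewrite YE_of_tr2 //; [exact: EWN_idser|move=> w'; exact: tr2_vacuum_r].
split=> [hq|]; apply/funext => w; apply/funext => p; rewrite E; first by rewrite sb_neg.
rewrite /= (@fsum_window _ _ p 1) => [|m hm]; last first.
  rewrite /prod2 /idser mulr0 addr0; have -> : (p - m == 0) = false by move: hm; clear; lia.
  by rewrite (field0 _ ha.1) scaler0.
by rewrite big_ord1 /prod2 /idser addr0 subrr mulr0 addr0 eqxx cbinom0 scale1r.
Qed.

End Vacuum.

(** * The vertex algebra and its twisted module *)

Section GeneratedAlgebra.
Variables (R : realType) (N : nat).
Hypothesis hN : (0 < N)%N.
Variable W : lmodType R[i].
Notation field := (W -> int -> W).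
Variable U : set field.
Hypothesis hU : U `<=` EWN W.
Hypothesis hS : S_local N U.
Hypothesis hg : graded_subspace N (lin_span U).
Local Notation V := (genV N U).
Local Notation Y := (genV_Y N U).
Local Notation fld := (gen_val N U).
Implicit Types (u v c : V) (a b : field).

Let cgo : closed_graded_over N U (gen N U) := gen_cgo hN hU hS hg.

Let genE : gen N U `<=` EWN W := cgo_sub cgo.

Let genL : slocal N (gen N U) (gen N U) := gen_slocal hN hU hS hg.

Lemma gen_valP v : gen N U (fld v).
Proof. by case: v => a /=; rewrite unfold_in inE. Qed.

Lemma gen_val_inj : injective fld. Proof. exact: val_inj. Qed.

Lemma gen_val_linear : linear fld. Proof. by []. Qed.

Lemma linear_at w p : linear (fun v => fld v w p).
Proof. by move=> x u v; rewrite gen_val_linear. Qed.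

Lemma genV_ext u v : (forall w p, fld u w p = fld v w p) -> u = v.
Proof. by move=> h; apply: gen_val_inj; do 2!apply/funext => ?. Qed.

Let cV u v : pair_compatible N (fld u) (fld v) :=
  slocal_compatible hN genE genE genL (gen_valP u) (gen_valP v).

Let EV v : EWN W (fld v) := genE (gen_valP v).

Let gYE a b q : gen N U a -> gen N U b -> gen N U (YE N a b q).
Proof. by move=> ha hb; have := gen_YE q (mem_set ha) (mem_set hb); rewrite inE. Qed.

Lemma genV_Y_linear : linear Y.
Proof.
move=> x u v; apply/funext => c; apply/funext => q; apply: gen_val_inj.
exact: (YE_lin_l hN q (cV u c) (cV v c) (cV (x *: u + v) c)).
Qed.

Lemma genV_Y_linear_r u : linear (Y u).
Proof.
move=> x v c; apply/funext => q; apply: gen_val_inj.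
exact: (YE_lin_r hN q (EV u).1 (cV u v) (cV u c) (cV u (x *: v + c))).
Qed.

Lemma genV_Y_bounded u v : exists q0, forall q, q < q0 -> Y u v q = 0.
Proof.
have [q0 h] := YE_bounded hN (cV u v); exists q0 => q hq.
by apply: gen_val_inj; rewrite /= h.
Qed.

Lemma genV_Y_field u : hom_laurent (Y u).
Proof. by split; [exact: genV_Y_linear_r|move=> v; exact: genV_Y_bounded]. Qed.

Lemma genV_Y0 u q : Y u 0 q = 0.
Proof. by rewrite (lin0 (genV_Y_linear_r u)). Qed.

(** [jacobi_data] gives identities between coefficients at w and p. The maps [linear_at] are linear,
    commute with the series operations and separate the elements of <U>, so with bounds uniform in w
    and p the identities lift to <U>. *)
Lemma genV_S_jacobi u v : exists (s : nat) (u' v' : 'I_s -> V) (f : 'I_s -> int -> R[i]),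
  (forall i, laurent (f i)) /\ S_jacobi Y u v u' v' f.
Proof.
have [K rf] := genL (gen_valP u) (gen_valP v).
have [s [h [a' [b' [mem E]]]]] := RF_family hN genE genE rf.
pose u' i : V := GenV (mem_set (mem i).1).
pose v' i : V := GenV (mem_set (mem i).2).
pose f i := shifted_coef K (h i).
exists s, u', v', f; split.
  move=> i; exists (- K%:Z) => m hm; rewrite /f /shifted_coef.
  by case e : (m + K%:Z) => [d|d] //; move: e hm; clear; lia.
move=> c p q r.
have [e he] := jacobi_data hN genE genL gYE (gen_valP u) (gen_valP v) (gen_valP c) mem E.
(* e depends on c, whereas f was fixed before c was introduced. *)
have -> : f = fun i => shifted_coef (K + e) (hshift e (h i)).
  by apply/funext => i; rewrite (shifted_coef_hshift hN).
pose P i j := Y u (Y v c j) i.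
pose Q i x y := Y (v' i) (Y (u' i) c x) y.
pose S x y := Y (Y u v x) c y.
pose H := iter (K + e) (rdif 1) P.
have [r0 hr0] := genV_Y_bounded v c.
have [q0 hq0] : exists q0, forall i q, q < q0 -> Y (u' i) c q = 0.
  apply: common_lower_bound => [i L L' LL hL q' hq'|i]; last exact: genV_Y_bounded.
  by apply: hL; exact: lt_le_trans LL.
have lQ i : lowfin 1 (Q i).
  apply: (@lowfin1_of_bounds _ _ _ q0) => [x y hx|x]; first by rewrite /Q hq0 ?genV_Y0.
  exact: genV_Y_bounded.
have HE w p' : (fun x y => fld (H x y) w p') = iter (K + e) (rdif 1)
    (fun i j => YE N (fld u) (YE N (fld v) (fld c) j) i w p').
  exact: esym (iter_rdif_map 1 (K + e) P (linear_at w p')).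
have tH : tr2 (- (K + e)%:Z) H.
  move=> x y hxy; apply: genV_ext => w p'; have [t _ _] := he w p'.
  by rewrite -HE in t; exact: t.
apply: (@jacobi_of_expansions _ _ (K + e) s (fun i => hshift e (h i)) P S H Q r0 q0
  (- (K + e)%:Z)) => //.
- by move=> i j hj; rewrite /P hr0 // genV_Y0.
- by move=> i x y hx; rewrite /Q hq0 // genV_Y0.
- apply/funext => x; apply/funext => y; apply: genV_ext => w p'.
  have [_ HQ _] := he w p'; rewrite -HE in HQ.
  rewrite [LHS](congr1 (fun f => f x y) HQ) !fct_sumE (lin_sum (linear_at w p')).
  apply: eq_bigr => i _.
  by have := hact_map (N := 1) (hshift e (h i)) (linear_at w p') (lQ i) => /(congr1 (fun f => f x y)) /= <-.
move=> x y; apply: genV_ext => w p'; have [_ _ hS'] := he w p'.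
rewrite -HE in hS'; rewrite [LHS]hS' (linZ (linear_at w p')); congr (_ *: _).
exact: (sb_map 1 _ _ (linear_at w p') tH).
Qed.

Lemma genV_weak_quantum_vertex_algebra :
  weak_quantum_vertex_algebra Y (genV_one N U).
Proof.
split; [exact: genV_Y_linear|exact: genV_Y_field| | | |exact: genV_S_jacobi].
- apply/funext => v; apply/funext => q; apply: gen_val_inj.
  by rewrite /= (YE_vacuum_l hN _ (EV v)) /idser; case: eqP.
- by move=> v m hm; apply: gen_val_inj; rewrite /= (YE_vacuum_r hN m (EV v)).1.
by move=> v; apply: gen_val_inj; rewrite /= (YE_vacuum_r hN 0 (EV v)).2.
Qed.

Lemma theta_has_period a : iter N (@theta R W N) a = a.
Proof.
have E k w m : iter k (@theta R W N) a w m = (omega R N ^ (- m)) ^+ k *: a w m.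
  elim: k => [|k IH]; first by rewrite expr0 scale1r.
  by rewrite iterS /theta IH scalerA exprS.
apply/funext => w; apply/funext => m; rewrite E exprnP exprz_exp mulrC -exprz_exp.
by rewrite -exprnP omegaXN // exp1rz scale1r.
Qed.

Lemma genV_theta_val k v : fld (iter k (genV_theta N U) v) = iter k (@theta R W N) (fld v).
Proof. by elim: k => // k IH; rewrite !iterS -IH. Qed.

Lemma genV_theta_period : has_period N (genV_theta N U).
Proof. by move=> v; apply: gen_val_inj; rewrite genV_theta_val theta_has_period. Qed.

Lemma genV_theta_automorphism : va_automorphism Y (genV_one N U) (genV_theta N U).
Proof.
split.
- move=> x u v; apply: genV_ext => w p; rewrite /= /theta.
  rewrite -[LHS]/(_ *: (x *: fld u w p + fld v w p)) scalerDr scalerA mulrC -scalerA.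
  by [].
- exists (iter N.-1 (genV_theta N U)) => v.
    by rewrite -iterSr prednK // genV_theta_period.
  by rewrite -iterS prednK // genV_theta_period.
- apply: genV_ext => w p; rewrite /= /theta /idser.
  by case: eqP => [->|_]; rewrite ?scaler0 // oppr0 expr0z scale1r.
move=> u v q; apply: gen_val_inj; rewrite /=.
rewrite (YE_theta hN q (cV u v) _ (EV u).1) //.
exact: (cV (genV_theta N U u) (genV_theta N U v)).
Qed.

(** For the exponent k that [YE] selects, weak associativity is the defining formula of [YE]. *)
Lemma genV_twisted_module :
  twisted_module N Y (genV_one N U) (genV_theta N U) fld.
Proof.
split; [by []|exact: EV|by []|by []|].
move=> u v; set k := xget 0%N [set k | hom_laurent2 (mulx12 N k (prod2 (fld u) (fld v)))].
exists k; split; first exact: (xgetPex 0%N (cV u v)).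
by move=> w q p; rewrite /= /YE -/k subrK.
Qed.

End GeneratedAlgebra.

Theorem theorem3p13 (R : realType) (W : lmodType R[i]) (N : nat)
    (U : set (W -> int -> W)) (hN : (0 < N)%N)
    (hU : U `<=` EWN W) (hS : S_local N U)
    (hg : graded_subspace N (lin_span U)) :
  [/\ closed_graded_over N U (gen N U),
      weak_quantum_vertex_algebra (genV_Y N U) (genV_one N U),
      va_automorphism (genV_Y N U) (genV_one N U) (genV_theta N U)
        /\ has_period N (genV_theta N U)
    & twisted_module N (genV_Y N U) (genV_one N U) (genV_theta N U)
        (gen_val N U)
        /\ injective (gen_val N U)].
Proof.
split.
- exact: gen_cgo.
- exact: genV_weak_quantum_vertex_algebra.
- by split; [exact: genV_theta_automorphism | exact: genV_theta_period].
by split; [exact: genV_twisted_module | exact: gen_val_inj].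
Qed.
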